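(* Let $k\ge 2$, $i_1,\ldots,i_k\in\{0,1,\ldots,m\}$, let $\{\phi_j\}_{j=0}^\infty$ be an arbitrary complete orthonormal system in $L_2([t,T])$, and let $\Phi\in L_2([t,T]^k)$. Assume that for all $r=1,2,\ldots,[k/2]$ and all pairings $(\{\{g_1,g_2\},\ldots,\{g_{2r-1},g_{2r}\}\},\{q_1,\ldots,q_{k-2r}\})$ of $\{1,\ldots,k\}$ the limiting trace $T^{k-2r}_{g_1,\ldots,g_{2r}}\Phi$ exists. Then the multiple Stratonovich stochastic integral $\hat J^{S}[\Phi]_{T,t}^{(i_1\ldots i_k)}$ exists and, with probability 1, $$\hat J^{S}[\Phi]_{T,t}^{(i_1\ldots i_k)}=J'[\Phi]_{T,t}^{(i_1\ldots i_k)}+\sum_{r=1}^{[k/2]}\ \sum_{(\{\{g_1,g_2\},\ldots,\{g_{2r-1},g_{2r}\}\},\{q_1,\ldots,q_{k-2r}\})}\ \prod_{s=1}^r\mathbf 1_{\{i_{g_{2s-1}}=i_{g_{2s}}\neq 0\}}\ J'\left[T^{k-2r}_{g_1,\ldots,g_{2r}}\Phi\right]_{T,t}^{(i_{q_1}\ldots i_{q_{k-2r}})},$$ where the inner sum runs over all pairings of $\{1,\ldots,k\}$ with $r$ pairs.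
   Context: Let $0\le t<T$, and let $\mathbf w_\tau=(\mathbf w^{(1)}_\tau,\ldots,\mathbf w^{(m)}_\tau)$, $\tau\in[0,T]$, be a standard $m$-dimensional Wiener process with independent components on a complete probability space with filtration; put $\mathbf w^{(0)}_\tau=\tau$. $[x]$ is the integer part of $x$, $\mathbf 1_A$ is an indicator, l.i.m. is the limit in mean square, and $L_2([t,T]^0):=\mathbb R$. Pairings: for $1\le r\le[k/2]$, a pairing of $\{1,\ldots,k\}$ with $r$ pairs is $(\{\{g_1,g_2\},\ldots,\{g_{2r-1},g_{2r}\}\},\{q_1,\ldots,q_{k-2r}\})$, where $\{g_1,\ldots,g_{2r},q_1,\ldots,q_{k-2r}\}=\{1,\ldots,k\}$; the pairs, the order of the pairs, and the set of the $q$'s are unordered, and one labels $q_1<\ldots<q_{k-2r}$. Fourier coefficients: $C_{j_k\ldots j_1}=\int_{[t,T]^k}\Phi(t_1,\ldots,t_k)\prod_{l=1}^k\phi_{j_l}(t_l)\,dt_1\ldots dt_k$. Limiting trace: $$T^{k-2r,p}_{g_1,\ldots,g_{2r}}\Phi(t_{q_1},\ldots,t_{q_{k-2r}})=\sum_{j_{q_1},\ldots,j_{q_{k-2r}}=0}^p\ \sum_{j_{g_1},j_{g_3},\ldots,j_{g_{2r-1}}=0}^p C_{j_k\ldots j_1}\Big|_{j_{g_1}=j_{g_2},\ldots,j_{g_{2r-1}}=j_{g_{2r}}}\phi_{j_{q_1}}(t_{q_1})\cdots\phi_{j_{q_{k-2r}}}(t_{q_{k-2r}}),$$ and $T^{k-2r}_{g_1,\ldots,g_{2r}}\Phi:=\lim_{p\to\infty}T^{k-2r,p}_{g_1,\ldots,g_{2r}}\Phi$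 in $L_2([t,T]^{k-2r})$; it is said to exist if this limit exists. Stratonovich integral: $\zeta_j^{(i)}=\int_t^T\phi_j(\tau)\,d\mathbf w_\tau^{(i)}$ and $$\hat J^{S}[\Phi]_{T,t}^{(i_1\ldots i_k)}=\mathop{\mathrm{l.i.m.}}_{p\to\infty}\sum_{j_1,\ldots,j_k=0}^p C_{j_k\ldots j_1}\prod_{l=1}^k\zeta_{j_l}^{(i_l)}.$$ Multiple Wiener integral: $J'[\cdot]_{T,t}^{(i_1\ldots i_n)}$ is the continuous linear map from $L_2([t,T]^n)$ to square-integrable random variables defined on step functions $\sum_{j_1,\ldots,j_n=0}^{N-1}a_{j_1\ldots j_n}\prod_{l}\mathbf 1_{[\tau_{j_l},\tau_{j_l+1})}(t_l)$ (for partitions $t=\tau_0<\ldots<\tau_N=T$, with $a_{j_1\ldots j_n}=0$ whenever two of the indices coincide) by $\sum a_{j_1\ldots j_n}\prod_{l}(\mathbf w^{(i_l)}_{\tau_{j_l+1}}-\mathbf w^{(i_l)}_{\tau_{j_l}})$ and extended by mean-square continuity. For $n=0$, $J'[c]:=c$ for $c\in\mathbb R$. *)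

(* Defs.v *)
From HB Require Import structures.
From mathcomp Require Import all_boot all_order all_algebra.
From mathcomp Require Import all_classical all_reals all_analysis.

Set Implicit Arguments.
Unset Strict Implicit.
Unset Printing Implicit Defensive.

Import Order.TTheory GRing.Theory Num.Theory.
Import numFieldNormedType.Exports.

Local Open Scope classical_set_scope.
Local Open Scope ring_scope.

(* L_2([t,T]^n) is represented by L_2(mu_n), where mu_n is the n-fold product
   of Lebesgue measure on R cut down to [t,T]. As mu_n vanishes outside the
   cube, functions are (Borel, total) on R^n and their values off the cube are
   irrelevant; mu_0 is the unit mass at the empty tuple, so that
   L_2([t,T]^0) is R. *)
Section Cube.
Context {R : realType}.
Local Open Scope ereal_scope.

Definition interval_measure (t T : R) : set (measurableTypeR R) -> \bar R :=
  mrestr lebesgue_measure (measurable_itv `[t, T]).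

HB.instance Definition _ t T := Measure.on (interval_measure t T).

Lemma interval_measure_fin t T : fin_num_fun (interval_measure t T).
Proof.
apply: lty_fin_num_fun; rewrite /= /interval_measure /mrestr setTI.
by rewrite lebesgue_measure_itv; case: ifP => _; rewrite ltry.
Qed.

HB.instance Definition _ t T :=
  Measure_isFinite.Build _ _ _ (interval_measure t T)
    (@interval_measure_fin t T).

Definition tuple_cons n (x : measurableTypeR R * n.-tuple (measurableTypeR R)) :
  n.+1.-tuple (measurableTypeR R) := [tuple of x.1 :: x.2].

Lemma measurable_tuple_cons n : measurable_fun setT (@tuple_cons n).
Proof.
exact: (@measurable_cons _ _ _ _ fst n snd measurable_fst measurable_snd).
Qed.

Section step.
Variables (t T : R) (n : nat).
Variable mu : {finite_measure set (n.-tuple (measurableTypeR R)) -> \bar R}.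

Definition cons_measure :=
  pushforward (interval_measure t T \x mu) (@tuple_cons n).

Let cons_measure0 : cons_measure set0 = 0.
Proof. by apply: measure0; exact: measurable_tuple_cons. Qed.

Let cons_measure_ge0 A : 0 <= cons_measure A.
Proof. by apply: measure_ge0; exact: measurable_tuple_cons. Qed.

Let cons_measure_sigma_additive : semi_sigma_additive cons_measure.
Proof.
by apply: measure_semi_sigma_additive; exact: measurable_tuple_cons.
Qed.

HB.instance Definition _ := isMeasure.Build _ _ _ cons_measure
  cons_measure0 cons_measure_ge0 cons_measure_sigma_additive.

Let cons_measure_fin : fin_num_fun cons_measure.
Proof.
apply: lty_fin_num_fun; rewrite /= /cons_measure /pushforward preimage_setT.
rewrite -setXTT product_measure1E// lte_mul_pinfty//.
- exact: fin_num_measure.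
- by rewrite ltey_eq fin_num_measure.
Qed.

HB.instance Definition _ :=
  Measure_isFinite.Build _ _ _ cons_measure cons_measure_fin.

End step.

Fixpoint cube_measure (t T : R) (n : nat) :
    {finite_measure set (n.-tuple (measurableTypeR R)) -> \bar R} :=
  match n with
  | 0 => dirac [tuple]
  | n'.+1 => cons_measure t T (cube_measure t T n')
  end.

End Cube.

Section L2.
Local Open Scope ereal_scope.
Context d (E : measurableType d) (R : realType).
Variable mu : {measure set E -> \bar R}.

Definition cvgL2 (u : nat -> E -> R) (f : E -> R) : Prop :=
  [/\ forall p, u p \in Lfun mu 2%:E,
      f \in Lfun mu 2%:E &
      'N[mu]_2%:E[EFin \o (u p \- f)%R] @[p --> \oo] --> 0].

(* A chosen L_2-limit (unique mu-a.e.), and 0 when there is none. *)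
Definition limL2 (u : nat -> E -> R) : E -> R :=
  xget (cst 0%R) [set f | cvgL2 u f].

End L2.

Section OrthonormalSystem.
Context {R : realType}.
Variables t T : R.
Local Notation mu := (interval_measure t T).

(* Completeness is density of the linear span. *)
Definition complete_orthonormal_system (phi : nat -> R -> R) : Prop :=
  [/\ forall j, phi j \in Lfun mu 2%:E,
      forall i j, \int[mu]_x (phi i x * phi j x) = (i == j)%:R &
      forall (f : R -> R) (e : R), f \in Lfun mu 2%:E -> 0 < e ->
        exists (N : nat) (c : nat -> R),
          ('N[mu]_2%:E[EFin \o (f \- \sum_(j < N) c j \*o phi j)%R] < e%:E)%E].

End OrthonormalSystem.

Section Wiener.
Context d (Omega : measurableType d) (R : realType).
Variables (P : probability Omega R) (m : nat).

Definition is_filtration (T : R) (F : R -> set (set Omega)) : Prop :=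
  [/\ forall s : R, s \in `[0, T] -> sigma_algebra setT (F s),
      forall s : R, s \in `[0, T] -> F s `<=` measurable &
      forall s s' : R, 0 <= s -> s <= s' -> s' <= T -> F s `<=` F s'].

(* The last clause says at once that w_s' - w_s is independent of F_s, that its
   m components are mutually independent, and that each of them is centred
   Gaussian with variance s' - s: normal_prob takes a standard deviation. *)
Definition is_wiener (T : R) (F : R -> set (set Omega))
    (w : 'I_m -> R -> Omega -> R) : Prop :=
  [/\ forall i (s : R), s \in `[0, T] ->
        forall B : set (measurableTypeR R), measurable B -> F s (w i s @^-1` B),
      forall i, {ae P, forall omega, w i 0 omega = 0},
      forall i, {ae P, forall omega,
        {within `[0, T], continuous (fun s => w i s omega)}} &
      forall s s' : R, 0 <= s -> s < s' -> s' <= T ->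
      forall (A : set Omega) (B : 'I_m -> set (measurableTypeR R)),
        F s A -> (forall i, measurable (B i)) ->
        P (A `&` \bigcap_i [set omega | B i (w i s' omega - w i s omega)]) =
        (P A * \prod_(i < m) normal_prob 0 (Num.sqrt (s' - s)) (B i))%E].

(* Indices run over 0, ..., m; index 0 is time. *)
Definition with_time (w : 'I_m -> R -> Omega -> R) (i : 'I_m.+1) (s : R) :
    Omega -> R :=
  if unlift ord0 i is Some i' then w i' s else cst s.

End Wiener.

(* A step function of n variables: partition points knots 0, ..., knots
   step_size, and a value on each product of half-open cells. *)
Record step_data (R : realType) (n : nat) := StepData {
  step_size : nat;
  knots : nat -> R;
  coefs : n.-tuple 'I_step_size -> R }.

Section MultipleWienerIntegral.
Context d (Omega : measurableType d) (R : realType).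
Variables (P : probability Omega R) (t T : R) (m : nat).
Variable w : 'I_m -> R -> Omega -> R.

Definition is_step n (s : step_data R n) : Prop :=
  [/\ knots s 0 = t, knots s (step_size s) = T,
      forall j, (j < step_size s)%N -> knots s j < knots s j.+1 &
      forall j : n.-tuple 'I_(step_size s), ~~ uniq j -> coefs j = 0].

Definition step_fun n (s : step_data R n) (x : n.-tuple (measurableTypeR R)) : R :=
  \sum_(j : n.-tuple 'I_(step_size s)) coefs j *
    \prod_(l < n) \1_(`[knots s (tnth j l), knots s (tnth j l).+1[ : set R)
                    (tnth x l).

Definition step_integral n (i : 'I_n -> 'I_m.+1) (s : step_data R n)
    (omega : Omega) : R :=
  \sum_(j : n.-tuple 'I_(step_size s)) coefs j *
    \prod_(l < n) (with_time w (i l) (knots s (tnth j l).+1) omega -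
                   with_time w (i l) (knots s (tnth j l)) omega).

(* Extension by mean-square continuity: X is a mean-square limit of the
   integrals of step functions that converge to f in L_2([t,T]^n). *)
Definition is_multiple_wiener n (i : 'I_n -> 'I_m.+1)
    (f : n.-tuple (measurableTypeR R) -> R) (X : Omega -> R) : Prop :=
  exists s : nat -> step_data R n,
    [/\ forall N, is_step (s N),
        cvgL2 (cube_measure t T n) (fun N => step_fun (s N)) f &
        cvgL2 P (fun N => step_integral i (s N)) X].

(* J'[f]; for n = 0, f is the constant f [tuple]. *)
Definition multiple_wiener n :
    ('I_n -> 'I_m.+1) -> (n.-tuple (measurableTypeR R) -> R) -> Omega -> R :=
  match n with
  | 0 => fun _ f => cst (f [tuple])
  | n'.+1 => fun i f => xget (cst 0) [set X | is_multiple_wiener i f X]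
  end.

(* The integral of a deterministic f : R -> R on [t,T] against w^(i): Lebesgue
   integral for i = 0, and Ito integral otherwise. For a deterministic
   integrand the latter is the mean-square limit over step functions of one
   variable; the off-diagonal condition of is_step is then void. *)
Definition single_integral (i : 'I_m.+1) (f : R -> R) : Omega -> R :=
  if i == ord0 then cst (\int[interval_measure t T]_x f x)
  else multiple_wiener (fun _ : 'I_1 => i) (fun x => f (thead x)).

End MultipleWienerIntegral.

Section Pairings.
Variable k : nat.

(* A pairing is given by its set of pairs; the remaining indices q_1 < q_2 <
   ... are the increasing enumeration enum_val of unpaired g, which has
   k - 2r elements when there are r pairs. *)
Definition pairings (r : nat) : {set {set {set 'I_k}}} :=
  [set g : {set {set 'I_k}} |
    [&& finset.trivIset g, [forall B in g, #|B| == 2] & #|g| == r]]%SET.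

Definition unpaired (g : {set {set 'I_k}}) : {set 'I_k} :=
  (~: finset.cover g)%SET.

Definition constant_on (I : eqType) (B : {set 'I_k}) (j : 'I_k -> I) : bool :=
  [forall a in B, forall b in B, j a == j b].

End Pairings.

Section Stratonovich.
Context d (Omega : measurableType d) (R : realType).
Variables (P : probability Omega R) (t T : R) (m : nat).
Variable w : 'I_m -> R -> Omega -> R.
Variables (k : nat) (i : 'I_k -> 'I_m.+1) (phi : nat -> R -> R).
Variable Phi : k.-tuple (measurableTypeR R) -> R.

Definition fourier_coef (j : 'I_k -> nat) : R :=
  \int[cube_measure t T k]_x (Phi x * \prod_(l < k) phi (j l) (tnth x l)).

(* The sum over j_{q_1}, j_{q_2}, ..., and j_{g_1}, j_{g_3}, ..., with
   j_{g_2} := j_{g_1}, ..., is the sum over all multi-indices in {0..p}^k which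
   are constant on every pair. *)
Definition partial_trace (g : {set {set 'I_k}}) (p : nat)
    (x : #|unpaired g|.-tuple (measurableTypeR R)) : R :=
  \sum_(j : {ffun 'I_k -> 'I_p.+1} | [forall B in g, constant_on B j])
    fourier_coef (fun l => j l) *
    \prod_(l < #|unpaired g|) phi (j (enum_val l)) (tnth x l).

Arguments partial_trace : clear implicits.

Definition limiting_trace_exists (g : {set {set 'I_k}}) : Prop :=
  exists f, cvgL2 (cube_measure t T _) (partial_trace g) f.

Definition limiting_trace (g : {set {set 'I_k}}) :
    #|unpaired g|.-tuple (measurableTypeR R) -> R :=
  limL2 (cube_measure t T _) (partial_trace g).

Definition stratonovich_sum (p : nat) (omega : Omega) : R :=
  \sum_(j : {ffun 'I_k -> 'I_p.+1})
    fourier_coef (fun l => j l) *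
    \prod_(l < k) single_integral P t T w (i l) (phi (j l)) omega.

Definition stratonovich_exists : Prop :=
  exists X, cvgL2 P stratonovich_sum X.

Definition stratonovich_integral : Omega -> R := limL2 P stratonovich_sum.

End Stratonovich.

Arguments partial_trace {R} t T {k} phi Phi g p x.
Arguments limiting_trace {R} t T {k} phi Phi g _.

(* Main.v *)
(* The key is the product formula for integrals of tensor products,
     zeta(f_0) J'[f_1 x ... x f_n] = J'[f_0 x ... x f_n]
       + sum_l 1{i_0 = i_l <> 0} <f_0, f_l> J'[product of the f_j, j <> 0, l]   a.s.
   On a uniform grid, and up to the fluctuations of the quadratic covariations
   around their means, it is an algebraic identity between sums over cells; the
   fluctuations vanish in mean square with the mesh. It extends to all of L_2 by
   density, because E |J'[f]|^2 <= C |f|^2: in a sum over cells with distinct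
   indices, the increment with the largest index is independent of the others.
   Multiplying the zeta's one after the other gives a sum over all pairings.
   By orthonormality of the phi_j, the inner products retain exactly the
   multi-indices that are constant on the pairs, so that summation against the
   Fourier coefficients turns the term of a pairing g into J' of the partial trace
   along g. Continuity of J' then gives the limit of each term; for the empty
   pairing it is J'[Phi], since the Fourier series of Phi converges in L_2. *)
Require Import Defs.
From HB Require Import structures.
From mathcomp Require Import all_boot all_order all_algebra.
From mathcomp Require Import all_classical all_reals all_analysis.
From mathcomp Require Import measurable_realfun ring lra.

Set Implicit Arguments.
Unset Strict Implicit.
Unset Printing Implicit Defensive.

Import Order.TTheory GRing.Theory Num.Theory.
Import numFieldNormedType.Exports.

Local Open Scope classical_set_scope.
Local Open Scope ring_scope.

Local Arguments cube_measure {R} t T n : simpl never.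

(** * Square-integrable functions *)

(** J' is a chosen representative of a mean-square class, so its algebra holds only almost surely;
    each identity is used for finitely many indices, which keeps the null sets harmless. The left
    side of the product formula is a product of two mean-square limits and converges only in L_1,
    where its limit must be identified. Two obstacles shape the rest. The diagonal terms contain the
    product f_0 f_l, which for general L_2 factors is only in L_1. So the formula is proved on a
    class of bounded functions closed under products, and its diagonal term, in which the merged
    variable runs against time, is reduced to the inner product <f_0, f_l>, continuous in L_2,
    before the passage to L_2. Moreover, time, Wiener increments and compensated products of
    increments must be estimated together: [is_noise] asks of an integrator a single inequality
    against coefficients known at the left end of each cell, so that one bound, with a product of
    constants, gives both the continuity of J' and the vanishing of the fluctuations. The constants
    n! and powers of 1 + T are not sharp; only their finiteness counts. *)

Definition sqnorm d (E : measurableType d) (R : realType)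
    (mu : {measure set E -> \bar R}) (f : E -> R) : R :=
  \int[mu]_x (f x ^+ 2).

Notation L2 mu f := (f \in Lfun mu 2%:E).

Section SquareNorm.
Context d (E : measurableType d) (R : realType).
Variable mu : {measure set E -> \bar R}.
Implicit Types f g : E -> R.

Lemma L2P f : L2 mu f <->
  measurable_fun setT f /\ mu.-integrable setT (EFin \o (fun x => f x ^+ 2)).
Proof.
split=> [fL|[mf fi]].
  split; last exact: Lfun2_integrable_sqr.
  by move: fL; rewrite inE => /andP[/[!inE]].
rewrite inE; apply/andP; split; rewrite inE//=.
rewrite /finite_norm unlock poweR_lty//.
move/integrableP : fi => [_]; apply: le_lt_trans.
rewrite le_eqVlt; apply/orP; left; apply/eqP; apply: eq_integral => x _ /=.
by rewrite normrX -powR_mulrn.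
Qed.

Lemma L2_measurable f : L2 mu f -> measurable_fun setT f.
Proof. by move=> /L2P[]. Qed.

Lemma L2_integrable_sqr f : L2 mu f ->
  mu.-integrable setT (EFin \o (fun x => f x ^+ 2)).
Proof. by move=> /L2P[]. Qed.

Lemma L2M_integrable f g : L2 mu f -> L2 mu g ->
  mu.-integrable setT (EFin \o (fun x => f x * g x)).
Proof. by move=> fL gL; apply/Lfun1_integrable; exact: Lfun2_mul_Lfun1. Qed.

Lemma L2D f g : L2 mu f -> L2 mu g -> L2 mu (fun x => f x + g x).
Proof.
move=> /L2P[mf fi] /L2P[mg gi]; apply/L2P; split.
  exact: measurable_funD.
apply: (@le_integrable _ _ _ _ _ measurableT _
   (fun x => (2 * f x ^+ 2 + 2 * g x ^+ 2)%:E)).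
- by apply/measurable_EFinP/measurable_funX/measurable_funD.
- move=> x _ /=; have [fx gx] := (sqr_ge0 (f x), sqr_ge0 (g x)).
  rewrite lee_fin !ger0_norm ?sqr_ge0//; last lra.
  by rewrite -subr_ge0 (_ : _ - _ = (f x - g x) ^+ 2) ?sqr_ge0//; ring.
- exact: (integrableD measurableT (integrableZl measurableT 2 fi)
     (integrableZl measurableT 2 gi)).
Qed.

Lemma L2Z a f : L2 mu f -> L2 mu (fun x => a * f x).
Proof.
move=> /L2P[mf fi]; apply/L2P; split; first exact: measurable_funM.
have := integrableZl measurableT (a ^+ 2) fi.
by apply: eq_integrable => // x _ /=; rewrite exprMn.
Qed.

Lemma L2N f : L2 mu f -> L2 mu (fun x => - f x).
Proof.
by move=> fL; under eq_fun do rewrite -mulN1r; exact: L2Z.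
Qed.

Lemma L2B f g : L2 mu f -> L2 mu g -> L2 mu (fun x => f x - g x).
Proof. by move=> fL gL; exact: (L2D fL (L2N gL)). Qed.

Lemma L2_0 : L2 mu (fun _ => 0).
Proof.
apply/L2P; split; first exact: measurable_cst.
have := integrable0 mu setT; apply: eq_integrable => // x _ /=.
by rewrite expr0n.
Qed.

Lemma L2_sum (I : Type) (r : seq I) (Q : pred I) (f : I -> E -> R) :
  (forall i, Q i -> L2 mu (f i)) -> L2 mu (fun x => \sum_(i <- r | Q i) f i x).
Proof.
move=> fL; elim: r => [|i r IH].
  by under eq_fun do rewrite big_nil; exact: L2_0.
under eq_fun do rewrite big_cons; case: (boolP (Q i)) => // Qi.
by apply: L2D => //; exact: fL.
Qed.

Lemma L2_bounded_mul (M : R) f g : measurable_fun setT g ->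
  (forall x, `|g x| <= M) -> L2 mu f -> L2 mu (fun x => g x * f x).
Proof.
move=> mg gM /L2P[mf fi]; apply/L2P; split; first exact: measurable_funM.
apply: (@le_integrable _ _ _ _ _ measurableT _
   (fun x => (M ^+ 2 * f x ^+ 2)%:E)).
- by apply/measurable_EFinP/measurable_funX/measurable_funM.
- move=> x _ /=; rewrite lee_fin -exprMn !ger0_norm ?sqr_ge0// !exprMn.
  rewrite ler_wpM2r ?sqr_ge0// -[leLHS]real_normK ?num_real//.
  by rewrite lerXn2r ?nnegrE// (le_trans _ (gM x)).
- by have := integrableZl measurableT (M ^+ 2) fi; apply: eq_integrable.
Qed.

Lemma sqnorm_ge0 f : 0 <= sqnorm mu f.
Proof. by apply: Rintegral_ge0 => x _; exact: sqr_ge0. Qed.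

Lemma eq_sqnorm f g : f =1 g -> sqnorm mu f = sqnorm mu g.
Proof. by move=> fg; apply: eq_Rintegral => x _; rewrite fg. Qed.

Lemma sqnormZ a f : L2 mu f ->
  sqnorm mu (fun x => a * f x) = a ^+ 2 * sqnorm mu f.
Proof.
move=> fL; rewrite /sqnorm; under eq_Rintegral do rewrite exprMn.
by rewrite RintegralZl//; exact: L2_integrable_sqr.
Qed.

Lemma sqnormN f : sqnorm mu (fun x => - f x) = sqnorm mu f.
Proof. by apply: eq_Rintegral => x _; rewrite sqrrN. Qed.

Lemma sqnormBC f g :
  sqnorm mu (fun x => f x - g x) = sqnorm mu (fun x => g x - f x).
Proof. by rewrite -sqnormN; apply: eq_sqnorm => x; rewrite opprB. Qed.

Lemma sqnorm0 : sqnorm mu (fun _ => 0) = 0.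
Proof.
rewrite /sqnorm; under eq_Rintegral do rewrite expr0n/=.
rewrite /Rintegral integral0_eq//.
Qed.

Lemma ler_sqnorm f g : measurable_fun setT f -> L2 mu g ->
  (forall x, f x ^+ 2 <= g x ^+ 2) -> L2 mu f /\ sqnorm mu f <= sqnorm mu g.
Proof.
move=> mf /L2P[mg gi] fg.
have fi : mu.-integrable setT (EFin \o (fun x => f x ^+ 2)).
  apply: le_integrable gi => //.
    by apply/measurable_EFinP/measurable_funX.
  by move=> x _ /=; rewrite lee_fin !ger0_norm ?sqr_ge0.
by split; [apply/L2P|apply: le_Rintegral].
Qed.

Lemma sqnormD_le f g : L2 mu f -> L2 mu g ->
  sqnorm mu (fun x => f x + g x) <= 2 * sqnorm mu f + 2 * sqnorm mu g.
Proof.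
move=> fL gL; have fi := L2_integrable_sqr fL; have gi := L2_integrable_sqr gL.
have [f2 g2] := (integrableZl measurableT 2 fi, integrableZl measurableT 2 gi).
rewrite /sqnorm -!RintegralZl// -RintegralD//.
apply: le_Rintegral => //; first exact: L2_integrable_sqr (L2D fL gL).
  exact: (integrableD measurableT f2 g2).
move=> x _; rewrite -subr_ge0 (_ : _ - _ = (f x - g x) ^+ 2) ?sqr_ge0//; ring.
Qed.

Lemma sqdist_le f g h : L2 mu f -> L2 mu g -> L2 mu h ->
  sqnorm mu (fun x => f x - h x) <=
  2 * sqnorm mu (fun x => f x - g x) + 2 * sqnorm mu (fun x => g x - h x).
Proof.
move=> fL gL hL; have := sqnormD_le (L2B fL gL) (L2B gL hL).
by rewrite (@eq_sqnorm _ (fun x => f x - h x))// => x; rewrite addrA subrK.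
Qed.

Lemma sqnorm_expand a f g : L2 mu f -> L2 mu g ->
  sqnorm mu (fun x => f x + a * g x) =
  sqnorm mu f + 2 * a * (\int[mu]_x (f x * g x)) + a ^+ 2 * sqnorm mu g.
Proof.
move=> fL gL; rewrite /sqnorm.
transitivity (\int[mu]_x (f x ^+ 2 + ((2 * a) * (f x * g x) + a ^+ 2 * g x ^+ 2))).
  by apply: eq_Rintegral => x _; ring.
have fi := L2_integrable_sqr fL; have gi := L2_integrable_sqr gL.
have fgi := L2M_integrable fL gL.
have i1 := integrableZl measurableT (2 * a) fgi.
have i2 := integrableZl measurableT (a ^+ 2) gi.
rewrite RintegralD//; last first.
  exact: (integrableD measurableT i1 i2).
by rewrite RintegralD// !RintegralZl// addrA.
Qed.

(** The quadratic [a |-> sqnorm (f + a g)] is nonnegative for every real [a], and one well-chosen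
    value of [a] suffices in each case. *)
Lemma Cauchy_Schwarz f g : L2 mu f -> L2 mu g ->
  (\int[mu]_x (f x * g x)) ^+ 2 <= sqnorm mu f * sqnorm mu g.
Proof.
move=> fL gL; set b := Rintegral _ _ _.
have H a : 0 <= sqnorm mu f + 2 * a * b + a ^+ 2 * sqnorm mu g.
  by rewrite -sqnorm_expand// sqnorm_ge0.
have [g0|g0] := eqVneq (sqnorm mu g) 0.
  suff -> : b = 0 by rewrite expr0n mulr_ge0 ?sqnorm_ge0.
  apply/eqP; apply: contraT => b0.
  (* When [g] has norm zero the quadratic is affine in [a]; with nonzero slope [2 b] it would take
     the value -1 here. *)
  have := H (- (sqnorm mu f + 1) / (2 * b)).
  rewrite g0 (_ : _ + _ = -1) ?ler0N1//.
  by field.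
have gp : 0 < sqnorm mu g by rewrite lt0r g0 sqnorm_ge0.
(* The minimiser of the quadratic. *)
have := H (- b / sqnorm mu g).
rewrite -(ler_pM2r gp) mul0r.
rewrite [X in 0 <= X -> _](_ : _ = sqnorm mu f * sqnorm mu g - b ^+ 2).
  by rewrite subr_ge0.
by field.
Qed.

Lemma L1_product_le f g : L2 mu f -> L2 mu g ->
  (\int[mu]_x `|f x * g x|) ^+ 2 <= sqnorm mu f * sqnorm mu g.
Proof.
have nL h : L2 mu h -> L2 mu (fun x => `|h x|).
  move=> /[dup] hL /L2_measurable mh; apply: (@ler_sqnorm _ h _ hL _).1.
    exact: measurableT_comp.
  by move=> x; rewrite real_normK ?num_real.
have nE h : sqnorm mu (fun x => `|h x|) = sqnorm mu h.
  by apply: eq_Rintegral => x _; rewrite real_normK ?num_real.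
move=> fL gL; under eq_Rintegral do rewrite normrM.
by rewrite -(nE f) -(nE g); apply: Cauchy_Schwarz; exact: nL.
Qed.

Lemma sqnorm_eq0 f : L2 mu f -> sqnorm mu f = 0 -> {ae mu, forall x, f x = 0}.
Proof.
move=> fL; have [mf fi] := (L2P f).1 fL; rewrite /sqnorm /Rintegral => f0.
have fin := integrable_fin_num measurableT fi.
have {}f0 : (\int[mu]_x `|(f x ^+ 2)%:E| = 0)%E.
  rewrite -[RHS]/(0%:E) -f0 fineK//; apply: eq_integral => x _ /=.
  by rewrite ger0_norm ?sqr_ge0.
have m2 : measurable_fun setT (EFin \o (fun x => f x ^+ 2)).
  by apply/measurable_EFinP/measurable_funX.
have := (ae_eq_integral_abs mu measurableT m2).1 f0.
apply: filterS => x /(_ I) /= -[/eqP].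
by rewrite sqrf_eq0 => /eqP.
Qed.

Lemma ae_eq_sqnorm f g : L2 mu f -> L2 mu g ->
  {ae mu, forall x, f x = g x} -> sqnorm mu f = sqnorm mu g.
Proof.
move=> /L2P[mf _] /L2P[mg _] fg; rewrite /sqnorm /Rintegral; congr fine.
apply: ae_eq_integral => //; [exact/measurable_EFinP/measurable_funX..|].
by apply: filterS fg => x /= -> _.
Qed.

Lemma ae_sqdist0 f g : measurable_fun setT f -> measurable_fun setT g ->
  {ae mu, forall x, f x = g x} -> sqnorm mu (fun x => f x - g x) = 0.
Proof.
move=> mf mg fg; rewrite /sqnorm /Rintegral.
rewrite [X in fine X](_ : _ = 0%E)// -(integral0 mu setT).
apply: ae_eq_integral => //.
- by apply/measurable_EFinP/measurable_funX/measurable_funB.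
- by apply: filterS fg => x /= -> _; rewrite subrr expr0n.
Qed.

Lemma ae_L2 f g : measurable_fun setT g -> L2 mu f ->
  {ae mu, forall x, f x = g x} -> L2 mu g.
Proof.
move=> mg /L2P[mf fi] fg; apply/L2P; split => //; apply/integrableP; split.
  by apply/measurable_EFinP/measurable_funX.
move/integrableP : fi => [_]; apply: le_lt_trans.
rewrite le_eqVlt; apply/orP; left; apply/eqP; apply: ae_eq_integral => //.
- by apply/measurableT_comp => //; apply/measurable_EFinP/measurable_funX.
- by apply/measurableT_comp => //; apply/measurable_EFinP/measurable_funX.
- by apply: filterS fg => x /= -> _.
Qed.

End SquareNorm.

Lemma squeeze_cvg0 (R : realType) (a b : nat -> R) :
  (forall n, 0 <= a n <= b n) -> b n @[n --> \oo] --> 0 ->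
  a n @[n --> \oo] --> 0.
Proof.
move=> ab b0; apply: (@squeeze_cvgr _ _ _ _ (fun=> 0) b) => //.
- exact: nearW.
- exact: cvg_cst.
Qed.

Lemma le_cvg_lb (R : realType) (a l : R) (b : nat -> R) :
  (forall n, a <= b n) -> b n @[n --> \oo] --> l -> a <= l.
Proof.
move=> ab bl; rewrite -(cvg_lim _ bl)//; apply: limr_ge => //.
  by apply/cvg_ex; exists l.
exact: nearW.
Qed.

Lemma cvg0_eventually (R : realType) (a : nat -> R) (e : R) :
  a n @[n --> \oo] --> 0 -> 0 < e -> exists N, forall n, (N <= n)%N -> a n < e.
Proof.
move=> /cvgrPdist_lt /(_ e) + e0 => /(_ e0)[N _ NP]; exists N => n Nn.
by have := NP n Nn; rewrite sub0r normrN => /(le_lt_trans (ler_norm _)).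
Qed.

Lemma eventually_cvg0 (R : realType) (a : nat -> R) : (forall n, 0 <= a n) ->
  (forall e, 0 < e -> exists N, forall n, (N <= n)%N -> a n < e) ->
  a n @[n --> \oo] --> 0.
Proof.
move=> a0 H; apply/cvgrPdist_lt => e /H[N NP]; exists N => // n /= Nn.
by rewrite sub0r normrN ger0_norm// NP.
Qed.

(** * Mean-square convergence *)

Section MeanSquareLimits.
Context d (E : measurableType d) (R : realType).
Variable mu : {measure set E -> \bar R}.
Implicit Types (f g : E -> R) (u v : nat -> E -> R).

Lemma Lnorm_sqnorm f : L2 mu f ->
  ('N[mu]_2%:E[EFin \o f] = (Num.sqrt (sqnorm mu f))%:E)%E.
Proof.
move=> fL; rewrite unlock -powR12_sqrt ?sqnorm_ge0// -poweR_EFin.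
rewrite /sqnorm /Rintegral fineK; last first.
  exact: integrable_fin_num (L2_integrable_sqr fL).
congr (_ `^ _)%E; apply: eq_integral => x _ /=.
by rewrite powR_mulrn// real_normK ?num_real.
Qed.

(** Squared norms are integrals and expand algebraically, so all later limits are handled in this
    form and not through ['N[mu]_2], which carries a square root. *)
Lemma cvgL2P u f : cvgL2 mu u f <->
  [/\ forall p, L2 mu (u p), L2 mu f &
      sqnorm mu (fun x => u p x - f x) @[p --> \oo] --> 0].
Proof.
have key : (forall p, L2 mu (u p)) -> L2 mu f ->
    (fun p => 'N[mu]_2%:E[EFin \o (u p \- f)%R])%E =
    (fun p => (Num.sqrt (sqnorm mu (fun x => u p x - f x)))%:E).
  by move=> uL fL; apply/funext => p; rewrite Lnorm_sqnorm//; exact: L2B.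
split=> -[uL fL ufc]; split => //; move: ufc; rewrite key//.
  move=> /fine_cvgP[_] h.
  have -> : (fun p => sqnorm mu (fun x => u p x - f x)) =
            (fun p => Num.sqrt (sqnorm mu (fun x => u p x - f x)) *
                      Num.sqrt (sqnorm mu (fun x => u p x - f x))).
    by apply/funext => p; rewrite -expr2 sqr_sqrtr ?sqnorm_ge0.
  rewrite -[X in _ --> X](mulr0 0); exact: cvgM.
move=> h; apply: cvg_EFin; first exact: nearW.
apply: eventually_cvg0 => [n|e e0]; first exact: sqrtr_ge0.
have [N NP] := cvg0_eventually h (exprn_gt0 2 e0).
exists N => n /NP /=; rewrite -(ltr_sqrt _ (exprn_gt0 2 e0)).
by rewrite sqrtr_sqr gtr0_norm.
Qed.

Lemma cvgL2_ext u v f : (forall p, u p =1 v p) -> cvgL2 mu u f -> cvgL2 mu v f.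
Proof. by move=> uv; have -> : u = v by apply/funext => p; apply/funext. Qed.

Lemma cvgL2_cst f : L2 mu f -> cvgL2 mu (fun=> f) f.
Proof.
move=> fL; apply/cvgL2P; split => //.
rewrite (_ : sqnorm _ _ = 0); first exact: cvg_cst.
by rewrite -(sqnorm0 mu); apply: eq_sqnorm => x; rewrite subrr.
Qed.

Lemma cvgL2D u v f g : cvgL2 mu u f -> cvgL2 mu v g ->
  cvgL2 mu (fun p x => u p x + v p x) (fun x => f x + g x).
Proof.
move=> /cvgL2P[uL fL uf] /cvgL2P[vL gL vg]; apply/cvgL2P.
split=> [p||]; [exact: L2D|exact: L2D|].
apply: (@squeeze_cvg0 _ _ (fun p => 2 * sqnorm mu (fun x => u p x - f x) +
    2 * sqnorm mu (fun x => v p x - g x))).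
  move=> p; rewrite sqnorm_ge0/=.
  have := sqnormD_le (L2B (uL p) fL) (L2B (vL p) gL); apply: le_trans.
  by rewrite le_eqVlt; apply/orP; left; apply/eqP; apply: eq_sqnorm => x; ring.
rewrite -[X in _ --> X](_ : 2 * 0 + 2 * 0 = 0); last by rewrite mulr0 addr0.
by apply: cvgD; apply: cvgMr.
Qed.

Lemma cvgL2Z a u f : cvgL2 mu u f ->
  cvgL2 mu (fun p x => a * u p x) (fun x => a * f x).
Proof.
move=> /cvgL2P[uL fL uf]; apply/cvgL2P.
split=> [p||]; [exact: L2Z|exact: L2Z|].
rewrite (_ : (fun p => _) = fun p => a ^+ 2 * sqnorm mu (fun x => u p x - f x)).
  by rewrite -[X in _ --> X](mulr0 (a ^+ 2)); exact: cvgMr.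
apply/funext => p; rewrite -sqnormZ; last exact: L2B.
by apply: eq_sqnorm => x; rewrite mulrBr.
Qed.

Lemma cvgL2_sum (I : Type) (r : seq I) (Q : pred I) (u : I -> nat -> E -> R)
    (f : I -> E -> R) : (forall i, Q i -> cvgL2 mu (u i) (f i)) ->
  cvgL2 mu (fun p x => \sum_(i <- r | Q i) u i p x)
    (fun x => \sum_(i <- r | Q i) f i x).
Proof.
move=> uf; elim: r => [|i r IH].
  under [X in cvgL2 _ _ X]eq_fun do rewrite big_nil.
  by apply: cvgL2_ext (cvgL2_cst (L2_0 mu)) => p x; rewrite big_nil.
under [X in cvgL2 _ _ X]eq_fun do rewrite big_cons.
case: (boolP (Q i)) => Qi; last first.
  by apply: cvgL2_ext IH => p x; rewrite big_cons (negbTE Qi).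
by apply: cvgL2_ext (cvgL2D (uf _ Qi) IH) => p x; rewrite big_cons Qi.
Qed.

Lemma cvgL2_ae_seq u v f : (forall p, measurable_fun setT (v p)) ->
  (forall p, {ae mu, forall x, u p x = v p x}) ->
  cvgL2 mu u f -> cvgL2 mu v f.
Proof.
move=> mv uv /cvgL2P[uL fL ufc]; apply/cvgL2P.
have vL p : L2 mu (v p) by exact: ae_L2 (mv p) (uL p) (uv p).
split => //.
rewrite (_ : (fun p => _) = fun p => sqnorm mu (fun x => u p x - f x))//.
apply/funext => p; apply: ae_eq_sqnorm; [exact: L2B|exact: L2B|].
by apply: filterS (uv p) => x ->.
Qed.

Lemma sqdist_eq0_ae f g : L2 mu f -> L2 mu g ->
  sqnorm mu (fun x => f x - g x) = 0 -> {ae mu, forall x, f x = g x}.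
Proof.
move=> fL gL /(sqnorm_eq0 (L2B fL gL)); apply: filterS => x /eqP.
by rewrite subr_eq0 => /eqP.
Qed.

Lemma cvgL2_unique u f g : cvgL2 mu u f -> cvgL2 mu u g ->
  {ae mu, forall x, f x = g x}.
Proof.
move=> /cvgL2P[uL fL uf] /cvgL2P[_ gL ug]; apply: sqdist_eq0_ae => //.
apply/eqP; rewrite eq_le sqnorm_ge0 andbT.
apply: (@le_cvg_lb _ _ _ (fun p => 2 * sqnorm mu (fun x => u p x - f x) +
    2 * sqnorm mu (fun x => u p x - g x))).
  by move=> p; rewrite (sqnormBC _ (u p) f); exact: sqdist_le.
rewrite -[X in _ --> X](_ : 2 * 0 + 2 * 0 = 0); last by rewrite mulr0 addr0.
by apply: cvgD; apply: cvgMr.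
Qed.

(* The factor 2 is the price of working with squared norms only. *)
Lemma sqnorm_lim_le u f (C : R) (b : nat -> R) (l : R) : 0 <= C ->
  cvgL2 mu u f -> (forall p, sqnorm mu (u p) <= C * b p) ->
  b p @[p --> \oo] --> l -> sqnorm mu f <= 2 * C * l.
Proof.
move=> C0 /cvgL2P[uL fL uf] ub bl.
apply: (@le_cvg_lb _ _ _ (fun p => 2 * sqnorm mu (fun x => u p x - f x) +
    2 * C * b p)); last first.
  rewrite -[X in _ --> X](_ : 2 * 0 + 2 * C * l = 2 * C * l); last first.
    by rewrite mulr0 add0r.
  by apply: cvgD; apply: cvgMr.
move=> p; have := sqnormD_le (L2B fL (uL p)) (uL p).
rewrite sqnormBC (@eq_sqnorm _ _ _ _ _ f); last by move=> x; rewrite subrK.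
move=> /le_trans; apply; rewrite lerD2l -mulrA ler_wpM2l//.
Qed.

Lemma limL2_cvg u f : cvgL2 mu u f -> cvgL2 mu u (limL2 mu u).
Proof. by move=> uf; rewrite /limL2; case: xgetP => [g ->//|/(_ f)]. Qed.

Lemma limL2_ae u f : cvgL2 mu u f -> {ae mu, forall x, limL2 mu u x = f x}.
Proof. by move=> /[dup] /limL2_cvg h /(cvgL2_unique h). Qed.

End MeanSquareLimits.

Import HBSimple HBNNSimple.

(** * Finite measures: products of limits and density arguments *)

Section FiniteMeasure.
Context d (E : measurableType d) (R : realType).
Variable mu : {finite_measure set E -> \bar R}.
Implicit Types (f g h : E -> R) (u v w : nat -> E -> R).

Lemma L2_cst c : L2 mu (fun=> c).
Proof. exact: Lfun_cst. Qed.

Lemma L2_indic (A : set E) : measurable A -> L2 mu (\1_A : E -> R).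
Proof.
move=> mA; have := @L2_bounded_mul _ _ _ mu 1 (cst 1) (\1_A : E -> R).
under eq_fun do rewrite mulr1; apply; last exact: L2_cst.
  exact: measurable_indic.
by move=> x; rewrite indicE; case: (_ \in _); rewrite ?normr1 ?normr0.
Qed.

Lemma L2_integrable f : L2 mu f -> mu.-integrable setT (EFin \o f).
Proof.
move=> fL; have := L2M_integrable fL (L2_cst 1).
by under eq_fun do rewrite mulr1.
Qed.

Lemma sqr_Rintegral_le f : L2 mu f ->
  (\int[mu]_x `|f x|) ^+ 2 <= sqnorm mu f * sqnorm mu (fun=> 1).
Proof.
move=> fL; have := L1_product_le fL (L2_cst 1).
by under eq_Rintegral do rewrite mulr1.
Qed.

(* The product of two mean-square convergent sequences converges in L_1, which
   identifies its limit. *)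
Lemma cvgL2_mul_unique u v w f g h :
  cvgL2 mu u f -> cvgL2 mu v g -> cvgL2 mu w h ->
  (forall p, {ae mu, forall x, u p x * v p x = w p x}) ->
  {ae mu, forall x, f x * g x = h x}.
Proof.
move=> /cvgL2P[uL fL uf] /cvgL2P[vL gL vg] /cvgL2P[wL hL wh] uvw.
have fgi := L2M_integrable fL gL.
have hi := L2_integrable hL.
have Di : mu.-integrable setT (EFin \o (fun x => f x * g x - h x)).
  exact: (integrableB measurableT fgi hi).
have nint (k : E -> R) : mu.-integrable setT (EFin \o k) ->
    mu.-integrable setT (EFin \o (fun x => `|k x|)).
  by move=> ki; have := integrable_abse ki; apply: eq_integrable.
have iB (k l : E -> R) : mu.-integrable setT (EFin \o k) ->
    mu.-integrable setT (EFin \o l) ->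
    mu.-integrable setT (EFin \o (fun x => k x - l x)).
  by move=> ki li; exact: (integrableB measurableT ki li).
pose I0 := \int[mu]_x `|f x * g x - h x|.
suff I00 : I0 = 0.
  have mD := measurable_int mu Di.
  have : (\int[mu]_x `|(EFin \o (fun x => (f x * g x - h x)%R)) x| = 0)%E.
    rewrite -[RHS]/(0%:E) -I00 /I0 /Rintegral fineK//.
    by have := integrable_fin_num measurableT (nint _ Di).
  move=> /(ae_eq_integral_abs mu measurableT mD) ; apply: filterS => x /(_ I) /=.
  by move=> [] /eqP; rewrite subr_eq0 => /eqP.
apply/eqP; rewrite -sqrf_eq0 eq_le sqr_ge0 andbT.
(* Since [u p * v p = w p] a.e., [f * g - h] equals [(w p - h) - (u p - f) * v p - f * (v p - g)]
   there. The terms of [b p] bound the squared L_1 norms of these summands, the norm of [v p] being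
   estimated through that of [g]; the 3 comes from [(x + y + z)^2 <= 3 (x^2 + y^2 + z^2)]. *)
pose b p := 3 * (sqnorm mu f * sqnorm mu (fun x => v p x - g x) +
  sqnorm mu (fun x => u p x - f x) *
    (2 * sqnorm mu (fun x => v p x - g x) + 2 * sqnorm mu g) +
  sqnorm mu (fun x => w p x - h x) * sqnorm mu (fun=> 1)).
apply: (@le_cvg_lb _ _ _ b); last first.
  rewrite (_ : 0 = 3 * (sqnorm mu f * 0 + 0 * (2 * 0 + 2 * sqnorm mu g) +
     0 * sqnorm mu (fun=> 1))); last by ring.
  apply: cvgMr; apply: cvgD; last exact: cvgMl.
  apply: cvgD; first exact: cvgMr.
  apply: cvgM => //; apply: cvgD; [exact: cvgMr|exact: cvg_cst].
move=> p; set A1 := \int[mu]_x `|f x * (v p x - g x)|.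
set A2 := \int[mu]_x `|(u p x - f x) * v p x|.
set A3 := \int[mu]_x `|w p x - h x|.
have i1 := nint _ (L2M_integrable fL (L2B (vL p) gL)).
have i2 := nint _ (L2M_integrable (L2B (uL p) fL) (vL p)).
have i3 := nint _ (L2_integrable (L2B (wL p) hL)).
have Ile : I0 <= A1 + A2 + A3.
  have -> : I0 = \int[mu]_x `|(w p x - h x) - (u p x - f x) * v p x -
      f x * (v p x - g x)|.
    rewrite /I0 /Rintegral; congr fine; apply: ae_eq_integral => //.
    - by have := measurable_int mu (nint _ Di).
    - apply/measurable_EFinP; apply: measurableT_comp => //.
      apply: measurable_funB; first apply: measurable_funB.
      + exact: L2_measurable (L2B (wL p) hL).
      + apply: measurable_funM; last exact: L2_measurable (vL p).
        exact: L2_measurable (L2B (uL p) fL).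
      + apply: measurable_funM; first exact: L2_measurable fL.
        exact: L2_measurable (L2B (vL p) gL).
    - apply: filterS (uvw p) => x /= <- _; congr (`| _ |%:E); ring.
  rewrite /A1 /A2 /A3 -!RintegralD//; last first.
    exact: (integrableD measurableT i1 i2).
  apply: le_Rintegral => //.
  - apply: (nint); apply: (iB); last exact: L2M_integrable fL (L2B (vL p) gL).
    apply: (iB); last exact: L2M_integrable (L2B (uL p) fL) (vL p).
    exact: L2_integrable (L2B (wL p) hL).
  - exact: (integrableD measurableT (integrableD measurableT i1 i2) i3).
  - move=> x _; apply: le_trans (ler_normB _ _) _.
    by have := ler_normB (w p x - h x) ((u p x - f x) * v p x); lra.
have a1 := L1_product_le fL (L2B (vL p) gL).
have a2 := L1_product_le (L2B (uL p) fL) (vL p).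
have a3 := sqr_Rintegral_le (L2B (wL p) hL).
have I0_ge0 : 0 <= I0 by apply: Rintegral_ge0.
apply: (@le_trans _ _ (3 * (A1 ^+ 2 + A2 ^+ 2 + A3 ^+ 2))).
  apply: (@le_trans _ _ ((A1 + A2 + A3) ^+ 2)).
    by rewrite lerXn2r ?nnegrE// (le_trans I0_ge0 Ile).
  rewrite -subr_ge0 (_ : _ - _ = (A1 - A2) ^+ 2 + (A2 - A3) ^+ 2 + (A1 - A3) ^+ 2);
    last by ring.
  by rewrite !addr_ge0 ?sqr_ge0.
rewrite /b ler_wpM2l//; apply: lerD; last exact: a3.
apply: lerD; first exact: a1.
apply: (le_trans a2); rewrite ler_wpM2l ?sqnorm_ge0//.
have := sqnormD_le (L2B (vL p) gL) gL.
by rewrite (@eq_sqnorm _ _ _ _ _ (v p))// => x; rewrite subrK.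
Qed.

Lemma cvgL2_dominated u f g : (forall n, measurable_fun setT (u n)) ->
  measurable_fun setT f -> L2 mu g ->
  (forall x, u n x @[n --> \oo] --> f x) -> (forall n x, `|u n x| <= g x) ->
  cvgL2 mu u f.
Proof.
move=> mu_ mf gL uf ug.
have fg x : `|f x| <= g x.
  have : `|u n x| @[n --> \oo] --> `|f x| by apply: cvg_norm; exact: uf.
  move=> h; rewrite -(cvg_lim _ h)//; apply: limr_le; last exact: nearW.
  by apply/cvg_ex; exists `|f x|.
have sqle (a b : R) : `|a| <= b -> a ^+ 2 <= b ^+ 2.
  move=> ab; rewrite -[leLHS]real_normK ?num_real// lerXn2r// nnegrE//.
  exact: le_trans ab.
have fL : L2 mu f.
  by apply: (@ler_sqnorm _ _ _ mu f g _ gL _).1 => // x; exact: sqle.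
have uL n : L2 mu (u n).
  by apply: (@ler_sqnorm _ _ _ mu (u n) g _ gL _).1 => // x; exact: sqle.
apply/cvgL2P; split => //.
(* Pointwise [|u n - f| <= 2 g], so the squares are dominated by [4 g^2]. *)
have := @dominated_convergence _ _ _ mu setT measurableT
  (fun n x => ((u n x - f x) ^+ 2)%:E) (cst 0%E)
  (fun x => (4 * g x ^+ 2)%:E).
case.
- by move=> n; apply/measurable_EFinP/measurable_funX/measurable_funB.
- exact: measurable_cst.
- apply: aeW => x _; apply: cvg_EFin; first exact: nearW.
  rewrite [X in _ --> X](_ : _ = (f x - f x) ^+ 2); last by rewrite subrr expr0n.
  rewrite (_ : _ \o _ = fun n => (u n x - f x) * (u n x - f x)); last first.
    by apply/funext => n /=; rewrite expr2.
  by rewrite expr2; apply: cvgM; (apply: cvgB; [exact: uf|exact: cvg_cst]).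
- exact: (integrableZl measurableT 4 (L2_integrable_sqr gL)).
- apply: aeW => x n _; rewrite lee_fin ger0_norm ?sqr_ge0//.
  have -> : 4 * g x ^+ 2 = (2 * g x) ^+ 2 by ring.
  apply: sqle; apply: le_trans (ler_normB _ _) _.
  by rewrite mulr_natl mulr2n lerD.
- move=> _ _; rewrite integral0 => /fine_cvgP[_ h]; exact: h.
Qed.

(** The form in which density arguments are run: [S] is a property of functions, and closure under
    limits is asked as approximability by members of [S], so that it can be checked with one
    epsilon. Membership of zero is not built in; it follows from that of any function. *)
Definition L2_closed_linear (S : (E -> R) -> Prop) :=
  [/\ forall f, S f -> L2 mu f,
      forall a f g, S f -> S g -> S (fun x => a * f x + g x) &
      forall f, L2 mu f ->
        (forall e, 0 < e -> exists2 g, S g & sqnorm mu (fun x => f x - g x) < e) ->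
        S f].

Definition L2_closure (D : (E -> R) -> Prop) f : Prop := L2 mu f /\
  forall e, 0 < e -> exists2 g, D g & sqnorm mu (fun x => f x - g x) < e.

Section Closure.
Variable D : (E -> R) -> Prop.
Hypothesis DL : forall f, D f -> L2 mu f.

Lemma sub_L2_closure f : D f -> L2_closure D f.
Proof.
move=> Df; split=> [|e e0]; first exact: DL.
by exists f => //; rewrite (@eq_sqnorm _ _ _ _ _ (fun=> 0)) ?sqnorm0// => x; rewrite subrr.
Qed.

Lemma L2_closure_sequence f : L2_closure D f ->
  exists2 u : nat -> E -> R, (forall p, D (u p)) & cvgL2 mu u f.
Proof.
move=> [fL Df].
have /choice[u uP] p : exists g, D g /\ sqnorm mu (fun x => f x - g x) < p.+1%:R^-1.
  by have [|g] := Df p.+1%:R^-1; [rewrite invr_gt0|exists g].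
exists u; first by move=> p; have [] := uP p.
apply/cvgL2P; split => // [p|]; first by apply: DL; have [] := uP p.
apply: (@squeeze_cvg0 _ _ (fun p => p.+1%:R^-1)); last exact: cvg_harmonic.
by move=> p; rewrite sqnorm_ge0 sqnormBC ltW//; have [] := uP p.
Qed.

Lemma L2_closure_closed_linear :
  (forall a f g, D f -> D g -> D (fun x => a * f x + g x)) ->
  L2_closed_linear (L2_closure D).
Proof.
move=> Dlin; split=> [f []//|a f1 f2 [f1L f1D] [f2L f2D]|f fL fD].
  split; first by apply: L2D => //; exact: L2Z.
  (* The weights absorb the factor 2 of [sqnormD_le] in both terms; adding 1 to [a^2] keeps the
     divisor positive when [a = 0]. *)
  move=> e e0; have a1 : 0 < 4 * (a ^+ 2 + 1) by have := sqr_ge0 a; lra.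
  have [|g1 Dg1 b1] := f1D (e / (4 * (a ^+ 2 + 1))); first by rewrite divr_gt0.
  have [|g2 Dg2 b2] := f2D (e / 4); first by rewrite divr_gt0.
  exists (fun x => a * g1 x + g2 x); first exact: Dlin.
  have fgE x : a * f1 x + f2 x - (a * g1 x + g2 x) =
    a * (f1 x - g1 x) + (f2 x - g2 x) by ring.
  have d1 := L2B f1L (DL Dg1); have d2 := L2B f2L (DL Dg2).
  rewrite (eq_sqnorm _ fgE).
  apply: le_lt_trans (sqnormD_le (L2Z a d1) d2) _; rewrite sqnormZ//.
  have aux (x y A e' : R) : 0 <= x -> 0 <= A -> x < e' / (4 * (A + 1)) -> y < e' / 4 ->
      2 * (A * x) + 2 * y < e'.
    move=> x0 A0; rewrite ltr_pdivlMr => [hx hy|]; last by lra.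
    have : x * (4 * (A + 1)) = 4 * (A * x) + 4 * x by ring.
    lra.
  exact: aux (sqnorm_ge0 _ _) (sqr_ge0 _) b1 b2.
split => // e e0; have [|h [hL hD] fh] := fD (e / 4); first by rewrite divr_gt0.
have [|g Dg b] := hD (e / 4); first by rewrite divr_gt0.
exists g => //; apply: le_lt_trans (sqdist_le fL hL (DL Dg)) _.
have aux (x y e' : R) : x < e' / 4 -> y < e' / 4 -> 2 * x + 2 * y < e' by move=> *; lra.
exact: aux fh b.
Qed.

End Closure.

Section ClosedLinear.
Variable S : (E -> R) -> Prop.
Hypothesis HS : L2_closed_linear S.

Lemma L2_closed_ext f g : f =1 g -> S f -> S g.
Proof. by move=> /funext ->. Qed.

Lemma L2_closed_cvg u f : (forall n, S (u n)) -> cvgL2 mu u f -> S f.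
Proof.
case: HS => SL2 _ Scl Su /cvgL2P[uL fL uf]; apply: Scl => // e e0.
have [N /(_ N (leqnn _)) h] := cvg0_eventually uf e0.
by exists (u N) => //; rewrite sqnormBC.
Qed.

Lemma L2_closed0 f : S f -> S (fun=> 0).
Proof.
case: HS => SL2 Slin Scl Sf.
apply: L2_closed_ext (Slin (-1) f f Sf Sf) => x; ring.
Qed.

Lemma L2_closedZ a f : S f -> S (fun x => a * f x).
Proof.
move=> Sf; have := L2_closed0 Sf; case: HS => SL2 Slin Scl S0.
apply: L2_closed_ext (Slin a f _ Sf S0) => x; ring.
Qed.

Lemma L2_closedD f g : S f -> S g -> S (fun x => f x + g x).
Proof.
move=> Sf Sg; case: HS => SL2 Slin Scl.
apply: L2_closed_ext (Slin 1 f g Sf Sg) => x; ring.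
Qed.

Lemma L2_closed_sum (I : Type) (r : seq I) (Q : pred I) (f : I -> E -> R) :
  S (fun=> 0) -> (forall i, Q i -> S (f i)) ->
  S (fun x => \sum_(i <- r | Q i) f i x).
Proof.
move=> S0 Sf; elim: r => [|i r IH].
  by apply: L2_closed_ext S0 => x; rewrite big_nil.
case: (boolP (Q i)) => Qi.
  by apply: L2_closed_ext (L2_closedD (Sf _ Qi) IH) => x; rewrite big_cons Qi.
by apply: L2_closed_ext IH => x; rewrite big_cons (negbTE Qi).
Qed.

(** The sets whose indicator lies in [S] form a Dynkin system: complements by linearity, disjoint
    unions by dominated convergence with the bound 1, which has finite norm. Simple functions follow
    by linearity, nonnegative functions by increasing simple approximation, all others by splitting
    into positive and negative parts. *)
Lemma L2_closed_total (G : set (set E)) :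
  @measurable _ E = <<s G >> -> setI_closed G ->
  S \1_setT -> (forall A, G A -> S \1_A) -> forall f, L2 mu f -> S f.
Proof.
move=> GE GI ST SG.
have [SL2 Slin Scl] := HS.
have S0 := L2_closed0 ST.
have Sind A : measurable A -> S \1_A.
  rewrite GE; move: A; apply: (dynkin_induction GE GI) => //.
    move=> A mA SA.
    apply: L2_closed_ext (L2_closedD ST (L2_closedZ (-1) SA)) => x.
    rewrite !indicE in_setT in_setC; case: (x \in A) => /=; ring.
  move=> F mF tF SF.
  apply: (@L2_closed_cvg (fun n x => \sum_(k < n) \1_(F k) x)).
    move=> n; exact: L2_closed_sum.
  have inc x (k j : nat) : F k x -> F j x -> k = j.
    move=> Fk Fj; apply: (tF k j) => //; exists x; split => //.
  have val1 n x : \sum_(k < n) \1_(F k) x =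
      \1_(\big[setU/set0]_(k < n) F k) x :> R.
    rewrite indicE; case: (boolP (x \in _)) => [|].
      rewrite inE -bigcup_mkord => -[k /= kn Fk].
      rewrite (bigD1 (Ordinal kn))//= indicE mem_set// big1 ?addr0// => j jk.
      rewrite indicE memNset// => Fj; move/eqP : jk; apply; apply/val_inj => /=.
      exact: inc Fj Fk.
    rewrite notin_setE -bigcup_mkord => nF; rewrite big1// => j _.
    by rewrite indicE memNset// => Fj; apply: nF; exists j => //=.
  apply: (@cvgL2_dominated _ _ (cst 1)).
  - by move=> n; apply: measurable_sum => k; exact: measurable_indic.
  - by apply: measurable_indic; exact: bigcup_measurable.
  - exact: L2_cst.
  - move=> x; rewrite [X in _ --> X]indicE; case: (boolP (x \in _)) => [|].
      rewrite inE => -[k _ Fk]; apply: cvg_near_cst.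
      exists k.+1 => // n /= kn; rewrite val1 indicE mem_set//.
      by rewrite -bigcup_mkord; exists k.
    rewrite notin_setE => nF; apply: cvg_near_cst; apply: nearW => n.
    by rewrite big1// => j _; rewrite indicE memNset// => Fj; apply: nF; exists j.
  - move=> n x; rewrite val1 indicE /cst.
    by case: (_ \in _); rewrite ?normr1 ?normr0.
have Snn (f : E -> R) : L2 mu f -> (forall x, 0 <= f x) -> S f.
  move=> fL f0; have mf := L2_measurable fL.
  have mfE : measurable_fun setT (EFin \o f) by apply/measurable_EFinP.
  have f0E x : setT x -> (0 <= (EFin \o f) x)%E by move=> _; rewrite lee_fin.
  pose a (n : nat) (x : E) : R := nnsfun_approx measurableT mfE n x.
  apply: (@L2_closed_cvg a).
    move=> n; have [s ->] : exists s : seq R,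
        a n = fun x => \sum_(y <- s) y * \1_(a n @^-1` [set y]) x.
      eexists; apply/funext => x; rewrite /a [LHS]fimfunE fsbig_finite//=.
    by apply: L2_closed_sum => // y _; apply: L2_closedZ; apply: Sind.
  apply: (@cvgL2_dominated _ _ f) => //.
  - move=> x; have := @cvg_nnsfun_approx _ _ _ _ measurableT _ mfE f0E x I.
    by move/fine_cvgP => [].
  - move=> n x; rewrite ger0_norm//.
    rewrite /a nnsfun_approxE -lee_fin; exact: le_approx.
move=> f fL.
have fp : S f^\+.
  apply: Snn => //.
  apply: (@ler_sqnorm _ _ _ mu _ f _ fL _).1.
    by apply: measurable_funrpos; exact: L2_measurable fL.
  move=> x; rewrite /funrpos /= /Num.max; case: ifP => _ //.
  by rewrite expr0n/= sqr_ge0.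
have fn : S f^\-.
  apply: Snn => //.
  apply: (@ler_sqnorm _ _ _ mu _ f _ fL _).1.
    by apply: measurable_funrneg; exact: L2_measurable fL.
  move=> x; rewrite /funrneg /= /Num.max; case: ifP => _; rewrite ?sqrrN//.
  by rewrite expr0n/= sqr_ge0.
apply: L2_closed_ext (L2_closedD fp (L2_closedZ (-1) fn)) => x.
rewrite /funrpos /funrneg /= /Num.max.
by case: (ltP (f x) 0) => h1; case: (ltP (- f x) 0) => h2; lra.
Qed.

End ClosedLinear.
End FiniteMeasure.

Lemma limn_einf_le_cst (R : realType) (u : nat -> \bar R) (c : \bar R) :
  (forall n, (u n <= c)%E) -> (limn_einf u <= c)%E.
Proof.
move=> uc; rewrite limn_einf_lim; apply: lime_le; first exact: is_cvg_einfs.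
apply: nearW => n; apply: le_trans (uc n); apply: ereal_inf_lbound.
by exists n => /=.
Qed.

Lemma bounded_nneseries (R : realType) (u : nat -> \bar R) (c : \bar R) :
  (forall n, (0 <= u n)%E) -> (forall n, (\sum_(k < n) u k <= c)%E) ->
  (\sum_(0 <= k <oo) u k <= c)%E.
Proof.
move=> u0 uc; apply: lime_le; first exact: is_cvg_nneseries.
by apply: nearW => n; rewrite big_mkord.
Qed.

(** * Completeness of L_2 and best approximation *)

Section Completeness.
Context d (E : measurableType d) (R : realType).
Variable mu : {finite_measure set E -> \bar R}.

(** By monotone convergence and the geometric bound, the series of absolute increments has finite
    integral and is therefore finite a.e.; there the sequence consists of the partial sums of an
    absolutely convergent telescoping series. *)
Lemma summable_increments_cvg (v : nat -> E -> R) (c : R) :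
  (forall k, L2 mu (v k)) ->
  (forall k, \int[mu]_x `|v k.+1 x - v k x| <= c * 2^-1 ^+ k) ->
  {ae mu, forall x, cvgn (fun k => v k x)}.
Proof.
move=> vL dle.
have dL k : L2 mu (fun x => v k.+1 x - v k x) by exact: L2B.
pose a k x := `|v k.+1 x - v k x|%:E : \bar R.
have ma k : measurable_fun setT (a k).
  by apply/measurable_EFinP/measurableT_comp => //; exact: L2_measurable (dL k).
have a0 k x : (0 <= a k x)%E by rewrite lee_fin.
have ai k : (\int[mu]_x a k x = (\int[mu]_x `|v k.+1 x - v k x|)%:E)%E.
  rewrite /Rintegral fineK//.
  have := integrable_abse (L2_integrable (dL k)).
  by move=> /(integrable_fin_num measurableT).
have c0 : 0 <= c.
  have := dle 0%N; rewrite expr0 mulr1; apply: le_trans.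
  exact: Rintegral_ge0.
have Slt : (\int[mu]_x (\sum_(0 <= k <oo) a k x) < +oo)%E.
  rewrite integral_nneseries//.
  apply: (@le_lt_trans _ _ (c * 2)%:E); last exact: ltry.
  apply: bounded_nneseries => [k|n]; first exact: integral_ge0.
  under eq_bigr do rewrite ai.
  rewrite sumEFin lee_fin.
  apply: (@le_trans _ _ (\sum_(k < n) c * 2^-1 ^+ k)); first exact: ler_sum.
  rewrite -mulr_sumr ler_wpM2l//.
  have := subrX1 (2^-1 : R) n.
  have : 0 <= (2^-1 : R) ^+ n by rewrite exprn_ge0.
  lra.
have Sm : measurable_fun setT (fun x => (\sum_(0 <= k <oo) a k x)%E).
  exact: (ge0_emeasurable_sum (P := xpredT)).
have Si : mu.-integrable setT (fun x => (\sum_(0 <= k <oo) a k x)%E).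
  apply/integrableP; split => //.
  under eq_integral do rewrite gee0_abs ?nneseries_ge0//.
  exact: Slt.
have := integrable_ae measurableT Si; apply: filterS => x /(_ I) Sx.
have : cvgn [normed series (fun k => v k.+1 x - v k x)].
  apply: nondecreasing_is_cvgn.
    by apply: nondecreasing_series => k _ _ /=.
  exists (fine (\sum_(0 <= k <oo) a k x)%E) => _ [n _ <-].
  rewrite -lee_fin fineK// /series /= -sumEFin.
  exact: nneseries_lim_ge.
move=> /normed_cvg /cvg_ex [l hl]; apply/cvg_ex; exists (l + v 0%N x).
rewrite (_ : (fun k => v k x) =
  fun k => series (fun k => v k.+1 x - v k x) k + v 0%N x).
  by apply: cvgD => //; exact: cvg_cst.
by apply/funext => k; rewrite /series /= telescope_sumr// subrK.
Qed.

(** Riesz-Fischer: a fast subsequence converges almost everywhere, and Fatou's lemma turns this into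
    mean-square convergence of the whole sequence. *)
Lemma L2_complete (u : nat -> E -> R) : (forall p, L2 mu (u p)) ->
  (forall e, 0 < e -> exists N, forall p q, (N <= p)%N -> (N <= q)%N ->
     sqnorm mu (fun x => u p x - u q x) <= e) ->
  exists f, cvgL2 mu u f.
Proof.
move=> uL uC.
(* A squared distance of [4^-1 ^+ k] makes the increments of the subsequence geometric of ratio 1/2
   in norm. *)
have /choice[phi phiP] k : exists N, forall p q, (N <= p)%N -> (N <= q)%N ->
    sqnorm mu (fun x => u p x - u q x) <= 4^-1 ^+ k.
  by apply: uC; rewrite exprn_gt0.
(* The running maximum dominates every earlier [phi k], so the chosen ranks need not be
   increasing. *)
pose psi k := (\max_(i < k.+1) phi i)%N.
have psi_ge k j : (k <= j)%N -> (phi k <= psi j)%N.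
  by move=> kj; exact: (leq_bigmax (Ordinal (kj : k < j.+1)%N)).
pose v k := u (psi k).
have vL k : L2 mu (v k) by exact: uL.
pose M := sqnorm mu (fun=> 1).
have vcvg : {ae mu, forall x, cvgn (fun k => v k x)}.
  apply: (@summable_increments_cvg v (Num.sqrt M)) => // k.
  rewrite -[leLHS]ger0_norm; last exact: Rintegral_ge0.
  rewrite -sqrtr_sqr -[2^-1 ^+ k]ger0_norm ?exprn_ge0// -sqrtr_sqr.
  rewrite -sqrtrM ?sqnorm_ge0// ler_wsqrtr//.
  apply: le_trans (sqr_Rintegral_le (L2B (vL k.+1) (vL k))) _.
  rewrite mulrC ler_wpM2l ?sqnorm_ge0//.
  apply: le_trans (phiP k _ _ _ _) _; [exact: psi_ge|exact: psi_ge|].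
  by rewrite exprAC lerXn2r ?nnegrE ?exprn_ge0//; lra.
(* The upper limit is measurable whether or not the subsequence converges at the point; [fine] makes
   it real-valued everywhere. *)
pose f x := fine (limn_esup (fun k => (v k x)%:E)).
have mf : measurable_fun setT f.
  apply: measurableT_comp; first exact: fine_measurable.
  apply: measurable_fun_limn_esup => k; apply/measurable_EFinP.
  exact: L2_measurable (vL k).
have vf : {ae mu, forall x, v k x @[k --> \oo] --> f x}.
  apply: filterS vcvg => x /cvg_ex[l vl].
  suff -> : f x = l by [].
  rewrite /f; have -> := cvg_limn_einf_sup (l := l%:E) _ => //.
  by apply: cvg_EFin => //; exact: nearW.
(* Fatou along the subsequence. That [u p - f] is in L_2 is a conclusion here, and [f] in L_2 is
   deduced from it afterwards. *)
have fat p K e : (forall k, (K <= k)%N ->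
     sqnorm mu (fun x => u p x - v k x) <= e) ->
   L2 mu (fun x => u p x - f x) /\ sqnorm mu (fun x => u p x - f x) <= e.
  move=> He.
  pose g k x := ((u p x - v (k + K)%N x) ^+ 2)%:E : \bar R.
  have mg k : measurable_fun setT (g k).
    apply/measurable_EFinP/measurable_funX/measurable_funB.
      exact: L2_measurable (uL p).
    exact: L2_measurable (vL _).
  have md : measurable_fun setT (fun x => u p x - f x).
    by apply: measurable_funB => //; exact: L2_measurable (uL p).
  have m2 : measurable_fun setT (fun x => ((u p x - f x) ^+ 2)%:E).
    exact/measurable_EFinP/measurable_funX.
  have le_e : (\int[mu]_x ((u p x - f x) ^+ 2)%:E <= e%:E)%E.
    rewrite (_ : (\int[mu]_x _ = \int[mu]_x limn_einf (g^~ x))%E); last first.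
      have mli : measurable_fun setT (fun x => limn_einf (g^~ x)).
        rewrite (_ : (fun x => _) =
            fun x => (- limn_esup (fun k => - g k x))%E); last first.
          apply/funext => x; rewrite -limn_einfN; congr limn_einf.
          by apply/funext => k; rewrite /comp oppeK.
        apply: measurableT_comp => //; apply: measurable_fun_limn_esup => k.
        exact: measurableT_comp.
      apply: ae_eq_integral => //.
      apply: filterS vf => x vfx _.
      apply/esym; have -> := cvg_limn_einf_sup (l := ((u p x - f x) ^+ 2)%:E) _ => //.
      apply: cvg_EFin; first exact: nearW.
      rewrite (_ : fine \o _ = fun k => (u p x - v (k + K)%N x) * (u p x - v (k + K)%N x)); last first.
        by apply/funext => k /=; rewrite expr2.
      rewrite expr2.
      have : v (k + K)%N x @[k --> \oo] --> f x by rewrite (cvg_shiftn K (fun k => v k x)).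
      by move=> h; apply: cvgM; (apply: cvgB; [exact: cvg_cst|exact: h]).
    apply: le_trans (fatou mu measurableT mg _) _.
      by move=> k x _; rewrite lee_fin sqr_ge0.
    apply: limn_einf_le_cst => k.
    rewrite -(@fineK _ (\int[mu]_x g k x)%E).
      by rewrite lee_fin; apply: He; rewrite leq_addl.
    have := L2_integrable_sqr (L2B (uL p) (vL (k + K)%N)).
    by move=> /(integrable_fin_num measurableT).
  have dL : L2 mu (fun x => u p x - f x).
    apply/L2P; split => //; apply/integrableP; split => //.
    under eq_integral do rewrite /= ger0_norm ?sqr_ge0//.
    by rewrite (le_lt_trans le_e)// ltry.
  split => //; rewrite -lee_fin (le_trans _ le_e)// /sqnorm /Rintegral fineK//.
  by have := integrable_fin_num measurableT (L2_integrable_sqr dL).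
have eK e : 0 < e -> exists N, forall p, (N <= p)%N ->
    L2 mu (fun x => u p x - f x) /\ sqnorm mu (fun x => u p x - f x) <= e.
  move=> e0.
  have [k0 /(_ k0 (leqnn _)) k0e] : exists N, forall n, (N <= n)%N -> 4^-1 ^+ n < e.
    apply: cvg0_eventually => //; apply: cvg_expr.
    by rewrite ger0_norm//; lra.
  exists (phi k0) => p pk; apply: (fat p k0) => k kk0.
  apply: le_trans (ltW k0e); apply: phiP => //; exact: psi_ge.
have [N0 /(_ N0 (leqnn _))[dL _]] := eK 1 ltr01.
have fL : L2 mu f.
  have -> : f = fun x => u N0 x - (u N0 x - f x).
    by apply/funext => x; rewrite subKr.
  exact: L2B.
exists f; apply/cvgL2P; split => //; apply: eventually_cvg0 => [n|e e0].
  exact: sqnorm_ge0.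
have [|N NP] := eK (e / 2); first by rewrite divr_gt0.
exists N => n /NP[_] /le_lt_trans; apply.
by rewrite gtr_pMr// invf_lt1 ?ltr1n.
Qed.

(** By orthonormality the squared error for coefficients [c] is [|f|^2 - 2 sum c_i a_i + sum c_i^2],
    with [a_i] the Fourier coefficients; the difference between [c = b] and [c = a] is
    [sum (b_i - a_i)^2]. *)
Lemma orthogonal_projection_le (I : finType) (e : I -> E -> R) (f : E -> R)
    (b : I -> R) :
  L2 mu f -> (forall i, L2 mu (e i)) ->
  (forall i j, \int[mu]_x (e i x * e j x) = (i == j)%:R) ->
  sqnorm mu (fun x => f x - \sum_i (\int[mu]_y (f y * e i y)) * e i x) <=
  sqnorm mu (fun x => f x - \sum_i b i * e i x).
Proof.
move=> fL eL eo.
pose a i := \int[mu]_y (f y * e i y).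
have SL (c : I -> R) : L2 mu (fun x => \sum_i c i * e i x).
  by apply: L2_sum => i _; exact: L2Z.
have Rsum (g : E -> R) (c : I -> R) : L2 mu g ->
    \int[mu]_x (g x * \sum_i c i * e i x) =
    \sum_i c i * \int[mu]_x (g x * e i x).
  move=> gL; rewrite /index_enum; elim: (Finite.enum I) => [|i r IH].
    rewrite big_nil; under eq_Rintegral do rewrite big_nil mulr0.
    by rewrite Rintegral_cst// mul0r.
  under eq_Rintegral do rewrite big_cons mulrDr.
  have rL : L2 mu (fun x => \sum_(j <- r) c j * e j x).
    by apply: L2_sum => j _; exact: L2Z.
  rewrite big_cons RintegralD//; last 2 first.
  - exact: L2M_integrable gL (L2Z (c i) (eL i)).
  - exact: L2M_integrable gL rL.
  rewrite IH; congr (_ + _).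
  under eq_Rintegral do rewrite mulrCA.
  by rewrite RintegralZl//; exact: L2M_integrable.
have nrm (c : I -> R) : sqnorm mu (fun x => f x - \sum_i c i * e i x) =
    sqnorm mu f - 2 * (\sum_i c i * a i) + \sum_i c i ^+ 2.
  transitivity (sqnorm mu (fun x => f x + (-1) * (\sum_i c i * e i x))).
    by apply: eq_sqnorm => x; rewrite mulN1r.
  rewrite sqnorm_expand// Rsum// mulrN1 mulNr; congr (_ + _).
  rewrite sqrrN expr1n mul1r /sqnorm; under eq_Rintegral do rewrite expr2.
  rewrite Rsum//; apply: eq_bigr => i _.
  under eq_Rintegral do rewrite mulrC.
  rewrite Rsum// (bigD1 i)//= eo eqxx mulr1 big1 ?addr0 ?expr2// => j ji.
  by rewrite eo eq_sym (negbTE ji) mulr0.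
rewrite [leLHS](nrm a) [leRHS](nrm b) -subr_ge0.
have -> : forall x y z y' z' : R, x - 2 * y + z - (x - 2 * y' + z') =
   z - 2 * y - (z' - 2 * y') by move=> *; ring.
rewrite !mulr_sumr -!sumrB sumr_ge0// => i _.
rewrite -/(a i) (_ : _ - _ = (b i - a i) ^+ 2) ?sqr_ge0//; ring.
Qed.

End Completeness.

(** * Tensor products and Fourier series on the cube *)

Section ProductIntegral.
Context d1 d2 (T1 : measurableType d1) (T2 : measurableType d2) (R : realType).
Variables (m1 : {finite_measure set T1 -> \bar R})
          (m2 : {finite_measure set T2 -> \bar R}).

Lemma integral_prod_mul (f : T1 -> R) (g : T2 -> R) :
  m1.-integrable setT (EFin \o f) -> m2.-integrable setT (EFin \o g) ->
  (m1 \x m2)%E.-integrable setT (EFin \o (fun z => f z.1 * g z.2)) /\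
  \int[(m1 \x m2)%E]_z (f z.1 * g z.2) = \int[m1]_x f x * \int[m2]_y g y.
Proof.
move=> fi gi.
have mf : measurable_fun setT f by apply/measurable_EFinP; exact: measurable_int fi.
have mg : measurable_fun setT g by apply/measurable_EFinP; exact: measurable_int gi.
have ff := integrable_fin_num measurableT fi.
have gf := integrable_fin_num measurableT gi.
have ai := integrable_abse gi.
have af := integrable_fin_num measurableT ai.
have mfg : measurable_fun setT (EFin \o (fun z : T1 * T2 => f z.1 * g z.2)).
  by apply/measurable_EFinP; apply: measurable_funM; exact: measurableT_comp.
have I : (m1 \x m2)%E.-integrable setT (EFin \o (fun z => f z.1 * g z.2)).
  apply/integrable12ltyP => //=.
  rewrite (eq_integral (fun x => ((fine (\int[m2]_y `|(g y)%:E|))%:E * `|(f x)%:E|)%E)).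
    rewrite ge0_integralZl//; last 2 first.
    - by apply: measurableT_comp => //; apply/measurable_EFinP.
    - by rewrite lee_fin fine_ge0// integral_ge0.
    rewrite lte_mul_pinfty ?lee_fin ?fine_ge0 ?integral_ge0//.
    by move/integrableP : fi => [].
  move=> x _; under eq_integral do rewrite normrM EFinM.
  rewrite ge0_integralZl//; last first.
    by apply/measurable_EFinP; exact: measurableT_comp.
  by rewrite muleC; congr (_ * _)%E; rewrite fineK.
split => //; rewrite /Rintegral -integral12_prod_meas1//=.
rewrite (eq_integral (fun x => ((fine (\int[m2]_y (g y)%:E))%:E * (f x)%:E)%E)).
  by rewrite integralZl// fineM//= mulrC.
move=> x _; rewrite /fubini_F/=; under eq_integral do rewrite EFinM.
by rewrite integralZl// muleC fineK.
Qed.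

End ProductIntegral.

Section Cube.
Context (R : realType).
Variables t T : R.
Local Notation mu1 := (interval_measure t T).
Local Notation Q n := (cube_measure t T n).

Lemma measurable_thead n :
  measurable_fun setT (fun x : n.+1.-tuple (measurableTypeR R) => thead x).
Proof. exact: measurable_tnth. Qed.

Lemma cube_integral_cons n (f : R -> R) (G : n.-tuple (measurableTypeR R) -> R) :
  mu1.-integrable setT (EFin \o f) -> (Q n).-integrable setT (EFin \o G) ->
  (Q n.+1).-integrable setT
    (EFin \o (fun x => f (thead x) * G [tuple of behead x])) /\
  \int[Q n.+1]_x (f (thead x) * G [tuple of behead x]) =
  \int[mu1]_x f x * \int[Q n]_y G y.
Proof.
move=> fi Gi; have [pi pE] := integral_prod_mul fi Gi.
have mf : measurable_fun setT (f : measurableTypeR R -> R).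
  by apply/measurable_EFinP; exact: measurable_int fi.
have mG : measurable_fun setT G by apply/measurable_EFinP; exact: measurable_int Gi.
pose F (x : n.+1.-tuple (measurableTypeR R)) := (f (thead x) * G [tuple of behead x])%:E.
have mF : measurable_fun setT F.
  apply/measurable_EFinP; apply: measurable_funM.
    by apply: (measurableT_comp mf); exact: measurable_thead.
  by apply: (measurableT_comp mG); exact: measurable_behead.
have FE : F \o @tuple_cons R n = EFin \o (fun z => f z.1 * G z.2).
  apply/funext => -[x y] /=; rewrite /F /tuple_cons /=; congr (_ * G _)%:E.
  by apply/val_inj.
have pF : (interval_measure t T \x Q n)%E.-integrable
    (@tuple_cons R n @^-1` setT) (F \o @tuple_cons R n).
  by rewrite preimage_setT FE.
split; last first.
  rewrite /Rintegral /= (integral_pushforward (@measurable_tuple_cons R n) mF pF)//.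
  by rewrite preimage_setT FE -pE.
apply/integrableP; split => //=.
rewrite ge0_integral_pushforward//; last 2 first.
- exact: measurable_tuple_cons.
- apply/measurable_EFinP; apply: measurableT_comp => //.
  by apply/measurable_EFinP.
by rewrite preimage_setT; move/integrableP : pF => [_].
Qed.

Definition tensor n (f : 'I_n -> R -> R) (x : n.-tuple (measurableTypeR R)) : R :=
  \prod_(l < n) f l (tnth x l).

Lemma tensorS n (f : 'I_n.+1 -> R -> R) x :
  tensor f x = f ord0 (thead x) * tensor (fun l => f (lift ord0 l)) [tuple of behead x].
Proof.
rewrite /tensor big_ord_recl; congr (_ * _); apply: eq_bigr => l _.
by rewrite [in LHS](tuple_eta x) tnthS.
Qed.

Lemma tensor0 (f : 'I_0 -> R -> R) x : tensor f x = 1.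
Proof. by rewrite /tensor big_ord0. Qed.

Lemma tensor_integral n (f : 'I_n -> R -> R) :
  (forall l, mu1.-integrable setT (EFin \o f l)) ->
  (Q n).-integrable setT (EFin \o tensor f) /\
  \int[Q n]_x tensor f x = \prod_(l < n) \int[mu1]_x f l x.
Proof.
elim: n f => [|n IH] f fi.
  rewrite big_ord0 (_ : tensor f = cst 1); last by apply/funext => x; rewrite tensor0.
  split; first exact: finite_measure_integrable_cst.
  by rewrite Rintegral_cst//= mul1r /dirac indicT.
have [Gi GE] := IH (fun l => f (lift ord0 l)) (fun l => fi _).
have [Fi FE] := cube_integral_cons (fi ord0) Gi.
rewrite (_ : tensor f = fun x => f ord0 (thead x) *
    tensor (fun l => f (lift ord0 l)) [tuple of behead x]); last first.
  by apply/funext => x; rewrite tensorS.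
by split => //; rewrite FE GE big_ord_recl.
Qed.

Lemma tensor_measurable n (f : 'I_n -> R -> R) :
  (forall l, measurable_fun setT (f l : measurableTypeR R -> R)) ->
  measurable_fun setT (tensor f).
Proof.
move=> mf; apply: measurable_prod => l _.
by apply: (measurableT_comp (mf l)); exact: measurable_tnth.
Qed.

Lemma tensorM n (f g : 'I_n -> R -> R) x :
  tensor f x * tensor g x = tensor (fun l y => f l y * g l y) x.
Proof. by rewrite /tensor big_split. Qed.

Lemma tensor_L2 n (f : 'I_n -> R -> R) : (forall l, L2 mu1 (f l)) ->
  L2 (Q n) (tensor f) /\ sqnorm (Q n) (tensor f) = \prod_(l < n) sqnorm mu1 (f l).
Proof.
move=> fL; have [] := tensor_integral (fun l => L2_integrable_sqr (fL l)).
have tE x : tensor (fun l x => f l x ^+ 2) x = tensor f x ^+ 2.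
  by rewrite /tensor prodrXl.
have -> : tensor (fun l x => f l x ^+ 2) = fun x => tensor f x ^+ 2 by apply/funext.
move=> i e; split; last exact: e.
apply/L2P; split => //; apply: tensor_measurable => l; exact: L2_measurable (fL l).
Qed.

Lemma tensor_inner n (f g : 'I_n -> R -> R) : (forall l, L2 mu1 (f l)) ->
  (forall l, L2 mu1 (g l)) ->
  \int[Q n]_x (tensor f x * tensor g x) =
  \prod_(l < n) \int[mu1]_x (f l x * g l x).
Proof.
move=> fL gL; under eq_Rintegral do rewrite tensorM.
by have [] := tensor_integral (fun l => L2M_integrable (fL l) (gL l)).
Qed.

Definition update n (f : 'I_n -> R -> R) (l0 : 'I_n) (g : R -> R) l :=
  if l == l0 then g else f l.

Lemma tensor_update n (f : 'I_n -> R -> R) l0 g x :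
  tensor (update f l0 g) x =
  g (tnth x l0) * \prod_(l < n | l != l0) f l (tnth x l).
Proof.
rewrite /tensor (bigD1 l0)//= /update eqxx; congr (_ * _).
by apply: eq_bigr => l /negbTE ->.
Qed.

Lemma update_L2 n (f : 'I_n -> R -> R) l0 g : (forall l, L2 mu1 (f l)) ->
  L2 mu1 g -> forall l, L2 mu1 (update f l0 g l).
Proof. by move=> fL gL l; rewrite /update; case: ifP. Qed.

Lemma sqnorm_tensor_update n (f : 'I_n -> R -> R) l0 g :
  (forall l, L2 mu1 (f l)) -> L2 mu1 g ->
  sqnorm (Q n) (tensor (update f l0 g)) =
  sqnorm mu1 g * \prod_(l < n | l != l0) sqnorm mu1 (f l).
Proof.
move=> fL gL; rewrite (tensor_L2 (update_L2 l0 fL gL)).2 (bigD1 l0)//=.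
rewrite /update eqxx; congr (_ * _).
by apply: eq_bigr => l /negbTE ->.
Qed.

(** With the other factors frozen, the tensor is linear in its [l0]-th factor and its norm is a
    constant times the norm of that factor; so [S] pulls back to a closed class of functions of one
    variable. *)
Lemma tensor_closed_linear n (S : (n.-tuple (measurableTypeR R) -> R) -> Prop)
    (f : 'I_n -> R -> R) l0 :
  L2_closed_linear (Q n) S -> (forall l, L2 mu1 (f l)) ->
  L2_closed_linear mu1 (fun g => L2 mu1 g /\ S (tensor (update f l0 g))).
Proof.
move=> [SL2 Slin Scl] fL; split.
- by move=> g [].
- move=> a g h [gL Sg] [hL Sh]; split; first by apply: L2D => //; exact: L2Z.
  apply: L2_closed_ext (Slin a _ _ Sg Sh) => x.
  by rewrite !tensor_update mulrDl mulrA.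
- move=> g gL gS; split => //; apply: Scl => [|e e0].
    by have [] := tensor_L2 (update_L2 l0 fL gL).
  pose C := \prod_(l < n | l != l0) sqnorm mu1 (f l).
  have C0 : 0 <= C by apply: prodr_ge0 => l _; exact: sqnorm_ge0.
  (* The divisor is [C + 1], since [C] vanishes when a frozen factor has norm zero. *)
  have [h [hL Sh] gh] := gS _ (divr_gt0 e0 (ltr_pwDr ltr01 C0)).
  exists (tensor (update f l0 h)) => //.
  rewrite (@eq_sqnorm _ _ _ _ _ (tensor (update f l0 (fun x => g x - h x)))).
    rewrite sqnorm_tensor_update//; last exact: L2B.
    rewrite -/C; apply: (@le_lt_trans _ _
       (sqnorm mu1 (fun x => g x - h x) * (C + 1))).
      by rewrite ler_wpM2l ?sqnorm_ge0// lerDl.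
    by rewrite -ltr_pdivlMr// ltr_wpDl.
  by move=> x; rewrite !tensor_update mulrBl.
Qed.

(** Totality rather than density: [D] may fail to be linear, as for an orthonormal system, and only
    its closed linear span has to be everything. *)
Definition L2_dense (D : (R -> R) -> Prop) := (forall f, D f -> L2 mu1 f) /\
  forall S, L2_closed_linear mu1 S -> (forall f, D f -> S f) ->
  forall f, L2 mu1 f -> S f.

Lemma tensor_closed_dense (D : (R -> R) -> Prop) n
    (S : (n.-tuple (measurableTypeR R) -> R) -> Prop) :
  L2_dense D -> L2_closed_linear (Q n) S ->
  (forall f : 'I_n -> R -> R, (forall l, D (f l)) -> S (tensor f)) ->
  forall f : 'I_n -> R -> R, (forall l, L2 mu1 (f l)) -> S (tensor f).
Proof.
move=> [DL2 Dd] HS SD.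
(* Induction on the number [m] of leading factors that are already arbitrary, the others still being
   in [D]. *)
suff H m : (m <= n)%N -> forall f : 'I_n -> R -> R,
    (forall l, L2 mu1 (f l)) ->
    (forall l : 'I_n, (m <= l)%N -> D (f l)) -> S (tensor f).
  move=> f fL; apply: (H n) => // l.
  by rewrite leqNgt ltn_ord.
elim: m => [|m IH] mn f fL fD; first by apply: SD => l; exact: fD.
pose l0 := Ordinal mn.
have := Dd _ (tensor_closed_linear l0 HS fL).
have upd g : f l0 = g -> update f l0 g = f.
  by move=> <-; apply/funext => l; rewrite /update; case: eqP => // ->.
move=> /(_ _ (f l0) (fL l0)); rewrite upd//; case => // g Dg.
have gL := DL2 _ Dg.
split => //; apply: IH; [exact: ltnW|exact: update_L2|].
move=> l ml; rewrite /update; case: eqP => // /eqP ll0; apply: fD.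
by rewrite ltn_neqAle ml andbT; apply: contra ll0 => /eqP mlE; apply/eqP/val_inj.
Qed.

(** Unlike the cylinders over one coordinate, boxes are stable under intersection, as the Dynkin
    argument on the cube requires. *)
Lemma box_generates n :
  @measurable _ (n.-tuple (measurableTypeR R)) = <<s [set A |
    exists2 B : 'I_n -> set (measurableTypeR R), (forall l, measurable (B l)) &
      A = [set x | forall l, B l (tnth x l)]] >>.
Proof.
set G := [set A | _]; rewrite eqEsubset; split => [A mA|]; last first.
  apply: smallest_sub; first exact: sigma_algebra_measurable.
  move=> _ [B mB ->].
  rewrite (_ : [set x | _] = \big[setI/setT]_(l < n) ((@tnth n (measurableTypeR R))^~ l @^-1` B l)).
    apply: bigsetI_measurable => l _; rewrite -[X in measurable X]setTI.
    exact: measurable_tnth.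
  apply/seteqP; split => x /=.
    by move=> Bx; rewrite -bigcap_seq => l /= _; exact: Bx.
  by rewrite -bigcap_seq => Bx l; apply: Bx => /=; rewrite mem_index_enum.
have : measurable_fun [set: g_sigma_algebraType G]
    (fun x : g_sigma_algebraType G => x : n.-tuple (measurableTypeR R)).
  apply/measurable_fun_tnthP => i _ B mB; rewrite setTI.
  apply: sub_sigma_algebra; exists (fun l => if l == i then B else setT).
    by move=> l; case: ifP.
  apply/seteqP; split => x /=.
    by move=> Bx l; case: eqP => // ->.
  by move=> /(_ i); rewrite eqxx.
by move=> /(_ measurableT _ mA); rewrite setTI.
Qed.

(** The induction principle on the cube: indicators of boxes are tensors of indicators, hence in
    [S], and boxes generate the sigma-algebra. *)
Lemma cube_total (D : (R -> R) -> Prop) n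
    (S : (n.-tuple (measurableTypeR R) -> R) -> Prop) :
  L2_dense D -> L2_closed_linear (Q n) S ->
  (forall f : 'I_n -> R -> R, (forall l, D (f l)) -> S (tensor f)) ->
  forall f, L2 (Q n) f -> S f.
Proof.
move=> Dd HS SD; have {}SD := tensor_closed_dense Dd HS SD.
have Sbox (B : 'I_n -> set (measurableTypeR R)) : (forall l, measurable (B l)) ->
    S \1_[set x | forall l, B l (tnth x l)].
  move=> mB.
  have := SD (fun l => \1_(B l)) (fun l => L2_indic mu1 (mB l)).
  apply: L2_closed_ext => x; rewrite /tensor indicE.
  case: (boolP (x \in _)) => [|]; rewrite ?inE ?notin_setE /= => Bx.
    by rewrite big1// => l _; rewrite indicE mem_set.
  have [l Bl] : exists l, ~ B l (tnth x l) by apply/existsNP.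
  by rewrite (bigD1 l)//= indicE memNset// mul0r.
apply: (L2_closed_total HS (@box_generates n)).
- move=> _ _ [B mB ->] [C mC ->]; exists (fun l => B l `&` C l).
    by move=> l; exact: measurableI.
  apply/seteqP; split => x /=; first by move=> [Bx Cx] l; split.
  by move=> BC; split=> l; have [] := BC l.
- rewrite (_ : setT = [set x : n.-tuple _ | forall l, [set: measurableTypeR R] (tnth x l)]).
    exact: (Sbox (fun=> setT) (fun=> measurableT)).
  by apply/seteqP; split.
- by move=> _ [B mB ->]; exact: Sbox.
Qed.

(* Replacing the factors one at a time. *)
Lemma cvgL2_tensor n (u : 'I_n -> nat -> R -> R) (f : 'I_n -> R -> R) :
  (forall l, cvgL2 mu1 (u l) (f l)) ->
  cvgL2 (Q n) (fun p => tensor (fun l => u l p)) (tensor f).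
Proof.
elim: n u f => [|n IH] u f uf.
  apply: (@cvgL2_ext _ _ _ _ (fun=> tensor f)).
    by move=> p x; rewrite !tensor0.
  by apply: cvgL2_cst; apply: (tensor_L2 _).1 => -[].
have /cvgL2P[vL gL vg] := IH (fun l => u (lift ord0 l)) (fun l => f (lift ord0 l))
   (fun l => uf _).
have ufL l : [/\ forall p, L2 mu1 (u l p), L2 mu1 (f l) &
      sqnorm mu1 (fun x => u l p x - f l x) @[p --> \oo] --> 0].
  exact/cvgL2P.
have consL (a : R -> R) (b : n.-tuple (measurableTypeR R) -> R) :
    L2 mu1 a -> L2 (Q n) b ->
    L2 (Q n.+1) (fun x => a (thead x) * b [tuple of behead x]) /\
    sqnorm (Q n.+1) (fun x => a (thead x) * b [tuple of behead x]) =
      sqnorm mu1 a * sqnorm (Q n) b.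
  move=> aL bL; have [i e] := cube_integral_cons (L2_integrable_sqr aL) (L2_integrable_sqr bL).
  have E : (fun x : n.+1.-tuple (measurableTypeR R) => a (thead x) ^+ 2 * b [tuple of behead x] ^+ 2) =
     (fun x => (a (thead x) * b [tuple of behead x]) ^+ 2).
    by apply/funext => x; rewrite exprMn.
  rewrite E in i e; split; last exact: e.
  apply/L2P; split => //; apply: measurable_funM.
    by apply: (measurableT_comp (L2_measurable aL)); exact: measurable_thead.
  by apply: (measurableT_comp (L2_measurable bL)); exact: measurable_behead.
have [u0L f0L u0f] := ufL ord0.
apply/cvgL2P; split.
- by move=> p; apply: (tensor_L2 _).1 => l; have [] := ufL l.
- by apply: (tensor_L2 _).1 => l; have [] := ufL l.
set g := tensor (fun l => f (lift ord0 l)).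
pose v p := tensor (fun l => u (lift ord0 l) p).
apply: (@squeeze_cvg0 _ _ (fun p =>
   2 * (sqnorm mu1 (fun x => u ord0 p x - f ord0 x) *
        (2 * sqnorm (Q n) (fun x => v p x - g x) + 2 * sqnorm (Q n) g)) +
   2 * (sqnorm mu1 (f ord0) * sqnorm (Q n) (fun x => v p x - g x)))).
  move=> p; rewrite sqnorm_ge0/=.
  have [a1 e1] := consL _ _ (L2B (u0L p) f0L) (vL p).
  have [a2 e2] := consL _ _ f0L (L2B (vL p) gL).
  have E x : tensor (fun l => u l p) x - tensor f x =
     (u ord0 p (thead x) - f ord0 (thead x)) * v p [tuple of behead x] +
     f ord0 (thead x) * (v p [tuple of behead x] - g [tuple of behead x]).
    by rewrite !tensorS /v /g; ring.
  rewrite (eq_sqnorm _ E).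
    apply: le_trans (sqnormD_le a1 a2) _.
    rewrite e1 e2 lerD2r ler_wpM2l// ler_wpM2l ?sqnorm_ge0//.
    have := sqnormD_le (L2B (vL p) gL) gL.
    by rewrite (@eq_sqnorm _ _ _ _ _ (v p))// => x; rewrite subrK.
rewrite (_ : 0 = 2 * (0 * (2 * 0 + 2 * sqnorm (Q n) g)) + 2 * (sqnorm mu1 (f ord0) * 0));
  last by ring.
apply: cvgD; last by apply: cvgMr; exact: cvgMr.
by apply: cvgMr; apply: cvgM => //; apply: cvgD; [exact: cvgMr|exact: cvg_cst].
Qed.

(* By Bessel, the functions whose partial Fourier sums converge form a closed
   subspace; it contains all tensor products of basis elements. *)
Lemma fourier_cvgL2 (phi : nat -> R -> R) n (Phi : n.-tuple (measurableTypeR R) -> R) :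
  complete_orthonormal_system t T phi -> L2 (Q n) Phi ->
  cvgL2 (Q n) (fun p x => \sum_(j : {ffun 'I_n -> 'I_p.+1})
     fourier_coef t T phi Phi (fun l => j l) * tensor (fun l => phi (j l)) x) Phi.
Proof.
move=> [phiL phio phid] PhiL.
have Dd : L2_dense (fun f => exists j, f = phi j).
  split=> [f [j ->]//|S HS Sphi f fL].
  have S0 : S (fun=> 0) by apply: (L2_closed0 HS (f := phi 0%N)); apply: Sphi; exists 0%N.
  have [SL2 Slin Scl] := HS; apply: Scl => // e e0.
  have se0 : 0 < Num.sqrt e by rewrite sqrtr_gt0.
  have [N [c]] := phid f _ fL se0.
  have E : (\sum_(j < N) c j \*o phi j) = fun x => \sum_(j < N) c j * phi j x.
    by apply/funext => x; rewrite fct_sumE.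
  have gL : L2 mu1 (fun x => \sum_(j < N) c j * phi j x).
    by apply: L2_sum => j _; exact: L2Z.
  rewrite E Lnorm_sqnorm; last exact: (L2B fL gL).
  rewrite lte_fin ltr_sqrt// => fe.
  exists (fun x => \sum_(j < N) c j * phi j x) => //.
  by apply: (L2_closed_sum HS) => // j _; apply: (L2_closedZ HS); apply: Sphi; exists j.
pose F p (f : n.-tuple (measurableTypeR R) -> R) x :=
  \sum_(j : {ffun 'I_n -> 'I_p.+1})
     fourier_coef t T phi f (fun l => j l) * tensor (fun l => phi (j l)) x.
have tL (j : 'I_n -> nat) : L2 (Q n) (tensor (fun l => phi (j l))).
  by apply: (tensor_L2 _).1.
have to (i j : 'I_n -> nat) : \int[Q n]_x (tensor (fun l => phi (i l)) x *
    tensor (fun l => phi (j l)) x) = [forall l, i l == j l]%:R.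
  rewrite tensor_inner//; case: (boolP [forall l, _]) => [/forallP ij|].
    by rewrite big1// => l _; rewrite phio ij.
  by move=> /forallPn[l ijl]; rewrite (bigD1 l)//= phio (negbTE ijl) mul0r.
have FL p f : L2 (Q n) (F p f).
  by apply: L2_sum => j _; apply: L2Z.
have too p (i j : {ffun 'I_n -> 'I_p.+1}) :
    \int[Q n]_x (tensor (fun l => phi (i l)) x *
    tensor (fun l => phi (j l)) x) = (i == j)%:R.
  rewrite to; congr (nat_of_bool _)%:R; apply/forallP/eqP => [ij|->//].
  by apply/ffunP => l; apply/val_inj/eqP; exact: ij.
(* Best approximation, for every [p] and every [b]. Taking [b = 0] shows that passing to the
   residual does not increase the norm, which gives closedness; a Kronecker [b] settles the basis
   tensors. *)
have bessel p f b : L2 (Q n) f -> sqnorm (Q n) (fun x => f x - F p f x) <=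
    sqnorm (Q n) (fun x => f x - \sum_(j : {ffun 'I_n -> 'I_p.+1}) b j *
       tensor (fun l => phi (j l)) x).
  move=> fL.
  exact: (@orthogonal_projection_le _ _ _ (Q n) _ (fun j : {ffun 'I_n -> 'I_p.+1} =>
     tensor (fun l => phi (j l))) f b fL (fun j => tL _) (@too p)).
have Flin p a f g : L2 (Q n) f -> L2 (Q n) g ->
    F p (fun x => a * f x + g x) = fun x => a * F p f x + F p g x.
  move=> fL gL; apply/funext => x; rewrite /F mulr_sumr -big_split/=.
  apply: eq_bigr => j _; rewrite mulrA -mulrDl; congr (_ * _).
  rewrite /fourier_coef -RintegralZl//; last exact: L2M_integrable fL (tL (fun l => j l)).
  rewrite -RintegralD//; last 2 first.
  - exact: (integrableZl measurableT a (L2M_integrable fL (tL (fun l => j l)))).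
  - exact: L2M_integrable gL (tL (fun l => j l)).
  by apply: eq_Rintegral => y _; rewrite mulrDl mulrA.
suff : L2 (Q n) Phi /\ cvgL2 (Q n) (F ^~ Phi) Phi by case.
apply: (cube_total Dd (S := fun f => L2 (Q n) f /\ cvgL2 (Q n) (F ^~ f) f)) => //.
  split=> [f []//|a f g [fL Ff] [gL Fg]|f fL fa].
    split; first by apply: L2D => //; exact: L2Z.
    apply: cvgL2_ext (cvgL2D (cvgL2Z a Ff) Fg) => p x.
    by rewrite Flin.
  split => //; apply/cvgL2P; split => //.
  apply: eventually_cvg0 => [p|e e0]; first exact: sqnorm_ge0.
  have [|g [gL Fg] fg] := fa (e / 4); first by rewrite divr_gt0.
  have /cvgL2P[_ _ Fg0] := Fg.
  have [|N NP] := cvg0_eventually Fg0 (e := e / 4); first by rewrite divr_gt0.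
  exists N => p /NP {}NP; rewrite sqnormBC.
  have hL := L2B fL gL.
  have b1 := bessel p _ (fun=> 0) hL.
  have := sqnormD_le (L2B hL (FL p (fun x => f x - g x))) (L2B gL (FL p g)).
  rewrite (@eq_sqnorm _ _ _ _ _ (fun x => f x - F p f x)); last first.
    move=> x; rewrite (_ : (fun x => f x - g x) = fun x => (-1) * g x + f x).
      by rewrite Flin//; ring.
    by apply/funext => y; ring.
  move=> /le_lt_trans; apply.
  have E0 x : f x - g x - \sum_(j : {ffun 'I_n -> 'I_p.+1}) 0 *
      tensor (fun l => phi (j l)) x = f x - g x.
    by rewrite big1 ?subr0// => j _; rewrite mul0r.
  have {}b1 : sqnorm (Q n) (fun x => f x - g x - F p (fun x => f x - g x) x) <=
      sqnorm (Q n) (fun x => f x - g x) by rewrite -[leRHS](eq_sqnorm _ E0).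
  have aux (a b c e' : R) : a <= b -> b < e' / 4 -> c < e' / 4 -> 2 * a + 2 * c < e'.
    by move=> *; lra.
  by rewrite sqnormBC in NP; exact: aux b1 fg NP.
move=> f /(_ _)/cid-/all_sig[j fE]; rewrite (_ : f = fun l => phi (j l)); last first.
  by apply/funext.
split => //; apply/cvgL2P; split => //.
apply: eventually_cvg0 => [p|e e0]; first exact: sqnorm_ge0.
(* From this rank on the span contains the basis tensor itself, so the best approximation has error
   zero. *)
exists (\max_l j l)%N => p jp; apply: le_lt_trans e0.
pose j' : {ffun 'I_n -> 'I_p.+1} := [ffun l => inord (j l)].
rewrite sqnormBC.
have := bessel p _ (fun i => (i == j')%:R) (tL j); move=> /le_trans; apply.
rewrite (@eq_sqnorm _ _ _ _ _ (fun=> 0)) ?sqnorm0// => x.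
rewrite (bigD1 j')//= eqxx mul1r big1 ?addr0; last by move=> i /negbTE ->; rewrite mul0r.
apply/eqP; rewrite subr_eq0; apply/eqP; apply: eq_bigr => l _.
rewrite ffunE inordK// ltnS; apply: leq_trans jp; exact: leq_bigmax.
Qed.

End Cube.

(** * Wiener increments *)

Section GaussianMoments.
Context (R : realType).
Implicit Types (s b x : R).
Local Notation lam := (@lebesgue_measure R).

(** Symmetric intervals, so that boundary values of even functions cancel; [n.+1] keeps them
    nondegenerate for the fundamental theorem of calculus. *)
Local Notation Iv n := ([set` (`[- (n.+1%:R : R), n.+1%:R])%R]%classic).

Let gs b (x : R) : R := expR (- (b * x ^+ 2)).

Let der_gs b x : is_derive x 1 (gs b) (- (2 * b * x) * gs b x).
Proof.
have d2 : is_derive x (1 : R) (fun y : R => - (b * y ^+ 2)) (- (2 * b * x)).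
  apply: is_derive_eq; rewrite /GRing.scale/=; ring.
have := is_derive1_comp (is_derive_expR _) d2.
by rewrite mulrC.
Qed.

Let der_pow b k x : is_derive x 1 (fun y => y ^+ k.+1 * gs b y)
  (k.+1%:R * x ^+ k * gs b x - 2 * b * (x ^+ k.+2 * gs b x)).
Proof.
have d1 : is_derive x (1 : R) (fun y : R => y ^+ k.+1) (k.+1%:R * x ^+ k).
  have -> : (fun y : R => y ^+ k.+1) = (id : R -> R) ^+ k.+1.
    by apply/funext => y; elim: k.+1 => [|m IH]; rewrite ?expr0// !exprS [in LHS]IH.
  by apply: is_derive_eq; rewrite /GRing.scale/= mulr1.
have := is_deriveM d1 (der_gs b x).
move=> h; apply: is_derive_eq; rewrite /GRing.scale/= !exprS; ring.
Qed.

Let continuous_of_derive (F f : R -> R) :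
  (forall x, is_derive x 1 F (f x)) -> continuous F.
Proof.
move=> dF x; apply: differentiable_continuous; apply/derivable1_diffP.
by have [] := dF x.
Qed.

Let ftc_itv (F f : R -> R) (n : nat) : (forall x, is_derive x 1 F (f x)) ->
  continuous f ->
  (\int[lam]_(x in Iv n) (f x)%:E = (F n.+1%:R - F (- n.+1%:R))%:E)%E.
Proof.
move=> dF cf; have cF := continuous_of_derive dF.
rewrite (@continuous_FTC2 _ f F)//.
- by rewrite (@lt_trans _ _ 0)// oppr_lt0.
- exact: continuous_subspaceT.
- split.
  + by move=> x _; have [] := dF x.
  + by apply: cvg_at_right_filter; exact: cF.
  + by apply: cvg_at_left_filter; exact: cF.
- by move=> x _; rewrite derive1E; have [_ ->] := dF x.
Qed.

Let itvT n : @measurable _ (measurableTypeR R) (Iv n).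
Proof. exact: measurable_itv. Qed.

Let itv_ub (x : R) : exists N : nat, forall n, (N <= n)%N -> x \in `[- n.+1%:R, n.+1%:R].
Proof.
exists (Num.truncn `|x|) => n Nn; rewrite in_itv/= -ler_norml.
apply: ltW; apply: (lt_le_trans (truncnS_gt _)).
by rewrite ler_nat ltnS.
Qed.

Let restrictE (h : R -> R) n x : ((EFin \o h) \_ (Iv n)) x =
  (if x \in `[- n.+1%:R, n.+1%:R] then h x else 0)%:E.
Proof. by rewrite patchE mem_setE; case: ifP. Qed.

Let restrict_cvg (h : R -> R) x :
  ((EFin \o h) \_ (Iv n)) x @[n --> \oo] --> (h x)%:E.
Proof.
have [N NP] := itv_ub x; apply: cvg_near_cst; exists N => // n /NP xn.
by rewrite restrictE xn.
Qed.

(** Fatou carries a uniform bound on the truncated integrals over to the full one before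
    integrability is known; [cvg_integral_itv] gives the value afterwards. *)
Let ge0_integral_itv_le (h : R -> R) (c : R) : measurable_fun setT h ->
  (forall x, 0 <= h x) ->
  (forall n : nat, (\int[lam]_(x in Iv n) (h x)%:E <= c%:E)%E) ->
  (\int[lam]_x (h x)%:E <= c%:E)%E.
Proof.
move=> mh h0 hc.
have -> : (\int[lam]_x (h x)%:E =
    \int[lam]_x limn_einf (fun n => ((EFin \o h) \_ (Iv n)) x))%E.
  apply: eq_integral => x _; apply/esym.
  by have -> := cvg_limn_einf_sup (@restrict_cvg h x).
apply: le_trans (fatou _ measurableT _ _) _.
- move=> n; apply/(measurable_restrictT _ (itvT n)).
  by apply/measurable_EFinP; exact: measurable_funTS.
- by move=> n x _; rewrite restrictE lee_fin; case: ifP.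
- by apply: limn_einf_le_cst => n; rewrite -integral_mkcond.
Qed.

Let cvg_integral_itv (h : R -> R) : lam.-integrable setT (EFin \o h) ->
  (\int[lam]_(x in Iv n) (h x)%:E)%E @[n --> \oo] -->
  (\int[lam]_x (h x)%:E)%E.
Proof.
move=> hi.
have [||||//|_ _] := @dominated_convergence _ _ _ lam setT measurableT
  (fun n => (EFin \o h) \_ (Iv n)) (EFin \o h) (abse \o (EFin \o h)).
- move=> n; apply/(measurable_restrictT _ (itvT n)).
  by apply: measurable_funTS; exact: measurable_int hi.
- exact: measurable_int hi.
- by apply: aeW => x _; exact: restrict_cvg.
- exact: integrable_abse.
- by apply: aeW => x n _; rewrite restrictE/= lee_fin; case: ifP => //; rewrite normr0.
- by under eq_fun do rewrite -integral_mkcond.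
Qed.

Section Pdf.
Variable s : R.
Hypothesis s0 : 0 < s.
Let N := normal_prob 0 s.
Let b : R := (s ^+ 2 *+ 2)^-1.
Let pk := normal_peak s.
Let P (x : R) : R := normal_pdf 0 s x.

Let P0 x : 0 <= P x. Proof. exact: normal_pdf_ge0. Qed.

Let PE x : P x = pk * gs b x.
Proof.
rewrite /P normal_pdfE ?gt_eqF//; congr (_ * expR _).
by rewrite subr0 mulNr mulrC.
Qed.

Let b0 : 0 < b. Proof. by rewrite invr_gt0 pmulrn_lgt0// exprn_gt0. Qed.

Let b2 : 2 * b * s ^+ 2 = 1.
Proof. by rewrite /b; field; rewrite gt_eqF. Qed.

Let cgs : continuous (gs b). Proof. exact: continuous_of_derive (der_gs b). Qed.

Let cpow k : continuous (fun x => x ^+ k * gs b x).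
Proof.
case: k => [|k].
  rewrite (_ : (fun x => _) = gs b); first exact: cgs.
  by apply/funext => x; rewrite expr0 mul1r.
exact: continuous_of_derive (der_pow b k).
Qed.

Let cPpow k : continuous (fun x => x ^+ k * P x).
Proof.
rewrite (_ : (fun x => _) = fun x => pk * (x ^+ k * gs b x)); last first.
  by apply/funext => x; rewrite PE; ring.
by move=> x; apply: cvgMr; exact: cpow.
Qed.

Let mPpow k : measurable_fun setT (fun x => x ^+ k * P x).
Proof. by apply: continuous_measurable_fun; exact: cPpow. Qed.

Let dP x : is_derive x 1 P (- (2 * b) * (x ^+ 1 * P x)).
Proof.
rewrite [X in is_derive _ _ X _](_ : _ = pk *: gs b); last first.
  by apply/funext => y; rewrite PE.
have := is_deriveZ pk (der_gs b x); congr is_derive.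
by rewrite /GRing.scale/= PE; ring.
Qed.

Let dPpow k x : is_derive x 1 (fun y => y ^+ k.+1 * P y)
  (k.+1%:R * (x ^+ k * P x) + (- (2 * b)) * (x ^+ k.+2 * P x)).
Proof.
rewrite [X in is_derive _ _ X _](_ : _ = pk *: (fun y => y ^+ k.+1 * gs b y)); last first.
  by apply/funext => y; rewrite PE mulrCA.
have := is_deriveZ pk (der_pow b k x); congr is_derive.
by rewrite /GRing.scale/= PE; ring.
Qed.

Let itv_int k n : lam.-integrable (Iv n)
  (EFin \o (fun x => x ^+ k * P x)).
Proof.
apply: continuous_compact_integrable; first exact: segment_compact.
by apply: continuous_subspaceT; exact: cPpow.
Qed.

Let A k n : R := \int[lam]_(x in Iv n) (x ^+ k * P x).

Let AE k n : (\int[lam]_(x in Iv n) (x ^+ k * P x)%:E = (A k n)%:E)%E.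
Proof.
rewrite /A /Rintegral fineK//.
by have := integrable_fin_num (itvT n) (itv_int k n).
Qed.

Let Psym x : P (- x) = P x. Proof. by rewrite !PE /gs sqrrN. Qed.

Let A1 n : A 1 n = 0.
Proof.
have := @ftc_itv P _ n dP; rewrite Psym subrr.
have cf : continuous (fun x => - (2 * b) * (x ^+ 1 * P x)).
  by move=> x; apply: cvgMr; exact: cPpow.
move=> /(_ cf) /(congr1 fine) /=.
rewrite -/(Rintegral _ _ _) RintegralZl//.
by move=> /eqP; rewrite mulf_eq0 oppr_eq0 mulf_eq0 pnatr_eq0 (gt_eqF b0)/= => /eqP.
Qed.

(** Integration by parts on a truncated interval. For even [k] the two boundary terms add up to a
    nonnegative number, whence the upper bounds on [A 2] and [A 4]: as [2 * b * s ^+ 2 = 1], each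
    step costs [k + 1] times the variance. *)
Let Arec k n : k.+1%:R * A k n - 2 * b * A k.+2 n =
  n.+1%:R ^+ k.+1 * P n.+1%:R - (- n.+1%:R) ^+ k.+1 * P n.+1%:R.
Proof.
have := @ftc_itv _ _ n (dPpow k); rewrite Psym.
have cf : continuous (fun x => k.+1%:R * (x ^+ k * P x) + - (2 * b) * (x ^+ k.+2 * P x)).
  by move=> x; apply: cvgD; apply: cvgMr; exact: cPpow.
move=> /(_ cf) /(congr1 fine) /= <-.
rewrite -/(Rintegral _ _ _) RintegralD// ?RintegralZl//; first by rewrite mulNr.
- exact: (integrableZl (itvT n) _ (itv_int k n)).
- exact: (integrableZl (itvT n) _ (itv_int k.+2 n)).
Qed.

Let A0_le n : A 0 n <= 1.
Proof.
rewrite -lee_fin -AE -(integral_normal_pdf 0 s).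
apply: le_trans (ge0_subset_integral _ (itvT n) measurableT _ _ (@subsetT _ _)) _ => //.
- by apply/measurable_EFinP; exact: mPpow 0.
- by move=> x _; rewrite lee_fin mulr_ge0 ?expr0.
- rewrite le_eqVlt; apply/orP; left; apply/eqP.
  by apply: eq_integral => x _; rewrite expr0 mul1r.
Qed.

Let A2_le n : A 2 n <= s ^+ 2.
Proof.
have := Arec 0 n; rewrite !expr1 mul1r mulNr opprK.
have : 0 <= n.+1%:R * P n.+1%:R by rewrite mulr_ge0.
have := A0_le n; have := exprn_gt0 2 s0; move: b2 => b2'.
move=> h1 h2 h3 h4.
have h5 : 2 * b * A 2 n <= 1 by lra.
rewrite -[A 2 n]mul1r -b2' [_ * s ^+ 2]mulrC -mulrA.
by rewrite -[leRHS]mulr1 ler_pM2l.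
Qed.

Let A4_le n : A 4 n <= 3 * s ^+ 4.
Proof.
have := Arec 2 n.
have -> : (- n.+1%:R : R) ^+ 3 = - (n.+1%:R ^+ 3) by ring.
rewrite mulNr opprK.
have : 0 <= n.+1%:R ^+ 3 * P n.+1%:R by rewrite mulr_ge0// exprn_ge0.
have := A2_le n; have := exprn_gt0 2 s0; move: b2 => b2'.
move=> h1 h2 h3 h4.
have h5 : 2 * b * A 4 n <= 3 * s ^+ 2 by lra.
have -> : A 4 n = s ^+ 2 * (2 * b * A 4 n).
  by rewrite mulrA [s ^+ 2 * _]mulrC b2' mul1r.
have -> : 3 * s ^+ 4 = s ^+ 2 * (3 * s ^+ 2) by ring.
by rewrite ler_pM2l.
Qed.

Let even_int k c : ~~ odd k -> (forall n, A k n <= c) ->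
  (\int[lam]_x (x ^+ k * P x)%:E <= c%:E)%E /\
  lam.-integrable setT (EFin \o (fun x => x ^+ k * P x)).
Proof.
move=> ok Ac; have p0 x : 0 <= x ^+ k * P x by rewrite mulr_ge0// exprn_even_ge0.
have le_c : (\int[lam]_x (x ^+ k * P x)%:E <= c%:E)%E.
  by apply: ge0_integral_itv_le => // n; rewrite AE lee_fin.
split => //; apply/integrableP; split.
  by apply/measurable_EFinP; exact: mPpow.
under eq_integral do rewrite /= ger0_norm//.
by rewrite (le_lt_trans le_c)// ltry.
Qed.

(** The Radon-Nikodym derivative of the normal law agrees a.e. with the density, both having the
    same integral over every measurable set. *)
Let int_N (f : R -> \bar R) : measurable_fun setT f -> (forall x, (0 <= f x)%E) ->
  (\int[N]_x f x = \int[lam]_x (f x * (P x)%:E))%E.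
Proof.
move=> mf f0.
have dom := normal_prob_dominates 0 s.
rewrite -(Radon_Nikodym_SigmaFinite.change_of_variables dom)//.
apply: ae_eq_integral => //.
- apply: emeasurable_funM => //; apply: (measurable_int lam).
  exact: Radon_Nikodym_SigmaFinite.f_integrable.
- apply: emeasurable_funM => //; apply/measurable_EFinP.
  exact: measurable_normal_pdf.
- apply: ae_eqe_mul2l; apply: integral_ae_eq => //.
  + exact: Radon_Nikodym_SigmaFinite.f_integrable.
  + by apply/measurable_EFinP; exact: measurable_normal_pdf.
  + by move=> E _ mE; rewrite -Radon_Nikodym_SigmaFinite.f_integral.
Qed.

Let mX k : measurable_fun setT (fun x : measurableTypeR R => x ^+ k).
Proof. by apply: measurable_funX. Qed.

Lemma normal_moment4 : N.-integrable setT (EFin \o (fun x : R => x ^+ 4)) /\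
  \int[N]_x (x ^+ 4) <= 3 * s ^+ 4.
Proof.
have [le_c hi] := even_int (isT : ~~ odd 4) A4_le.
have m4 : measurable_fun setT (EFin \o (fun x : measurableTypeR R => x ^+ 4)).
  by apply/measurable_EFinP; exact: mX.
have p4 (x : R) : (0 <= (EFin \o (fun x : R => x ^+ 4)%R) x)%E.
  by rewrite lee_fin exprn_even_ge0.
have le_c' : (\int[N]_x (x ^+ 4)%:E <= (3 * s ^+ 4)%:E)%E by rewrite int_N.
have I : N.-integrable setT (EFin \o (fun x : R => x ^+ 4)).
  apply/integrableP; split => //.
  under eq_integral do rewrite gee0_abs//.
  by rewrite (le_lt_trans le_c')// ltry.
split => //; rewrite -lee_fin /Rintegral fineK//.
by have := integrable_fin_num measurableT I.
Qed.

(** Here the exact value matters, since it compensates the squared increments; the boundary term of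
    the recursion therefore has to be shown to vanish. *)
Lemma normal_moment2 : \int[N]_x (x ^+ 2) = s ^+ 2.
Proof.
have [_ i0] := even_int (isT : ~~ odd 0) A0_le.
have [_ i2] := even_int (isT : ~~ odd 2) A2_le.
have E0 : (\int[lam]_x (x ^+ 0 * P x)%:E = 1%:E)%E.
  rewrite -(integral_normal_pdf 0 s).
  by apply: eq_integral => x _; rewrite expr0 mul1r.
have /fine_cvgP[_ c0] : (A 0 n)%:E @[n --> \oo] --> 1%:E.
  by rewrite -E0; under eq_fun do rewrite -AE; exact: cvg_integral_itv.
have c2 : A 2 n @[n --> \oo] --> s ^+ 2.
  have e2 n : A 2 n = s ^+ 2 * (A 0 n - 2 * (n.+1%:R * P n.+1%:R)).
    have := Arec 0 n; rewrite !expr1 mul1r mulNr opprK => h.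
    have {}h : 2 * b * A 2 n = A 0 n - 2 * (n.+1%:R * P n.+1%:R) by lra.
    by rewrite -h mulrA [_ * (2 * b)]mulrC b2 mul1r.
  (* From [expR y >= 1 + y] one gets [x P(x) <= (pk / b) / x] for positive [x]. *)
  have nP0 : n.+1%:R * P n.+1%:R @[n --> \oo] --> 0.
    apply: (@squeeze_cvg0 _ _ (fun n => (pk / b) * n.+1%:R^-1)).
      move=> n; rewrite mulr_ge0//= PE.
      rewrite -[leRHS]mulrA [n.+1%:R * _]mulrCA ler_wpM2l ?normal_peak_ge0//.
      rewrite /gs expRN -invfM ler_pdivrMr ?expR_gt0// mulrC ler_pdivlMr.
        have := expR_ge1Dx (b * n.+1%:R ^+ 2).
        set x := n.+1%:R; move=> h; rewrite (_ : x * (b * x) = b * x ^+ 2); last by ring.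
        by apply: le_trans h; rewrite lerDr.
      by rewrite mulr_gt0.
    rewrite -[X in _ --> X](mulr0 (pk / b)); apply: cvgMr.
    exact: cvg_harmonic.
  rewrite (_ : A 2 = fun n => s ^+ 2 * (A 0 n - 2 * (n.+1%:R * P n.+1%:R))); last exact/funext.
  rewrite -[X in _ --> X](_ : s ^+ 2 * (1 - 2 * 0) = s ^+ 2); last by ring.
  by apply: cvgMr; apply: cvgB; [exact: c0|exact: cvgMr].
have /fine_cvgP[_ c2'] : (A 2 n)%:E @[n --> \oo] --> (\int[lam]_x (x ^+ 2 * P x))%:E.
  rewrite /Rintegral fineK; last by have := integrable_fin_num measurableT i2.
  by under eq_fun do rewrite -AE; exact: cvg_integral_itv.
have -> : \int[N]_x (x ^+ 2) = \int[lam]_x (x ^+ 2 * P x).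
  rewrite /Rintegral int_N//; first by apply/measurable_EFinP; exact: mX.
  by move=> x; rewrite lee_fin sqr_ge0.
by apply: cvg_unique c2' c2.
Qed.

Lemma normal_moment1 : \int[N]_x x = 0.
Proof.
have [_ i0] := even_int (isT : ~~ odd 0) A0_le.
have [_ i2] := even_int (isT : ~~ odd 2) A2_le.
(* The bound [|x| <= 1 + x^2] reduces this to the moments of order 0 and 2. *)
have i1 : lam.-integrable setT (EFin \o (fun x => x ^+ 1 * P x)).
  have := integrableD measurableT i0 i2; apply: le_integrable => //.
    by apply/measurable_EFinP; exact: mPpow.
  move=> x _ /=; rewrite lee_fin -mulrDl normrM [leRHS]normrM ler_wpM2r//.
  rewrite expr0 expr1 [leRHS]ger0_norm ?addr_ge0 ?sqr_ge0//.
  rewrite -[x ^+ 2]real_normK ?num_real//.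
  have := sqr_ge0 (`|x| - 1); have := normr_ge0 x; nra.
have mid : measurable_fun setT (fun x : measurableTypeR R => x) by [].
have E : (\int[N]_x x%:E = \int[lam]_x (x ^+ 1 * P x)%:E)%E.
  rewrite integralE [RHS]integralE; congr (_ - _)%E.
    rewrite int_N//; last by apply: measurable_funepos; exact/measurable_EFinP.
    apply: eq_integral => x _; rewrite !funeposE -!EFin_max -EFinM.
    by rewrite maxr_pMl// mul0r expr1.
  rewrite int_N//; last by apply: measurable_funeneg; exact/measurable_EFinP.
  apply: eq_integral => x _; rewrite !funenegE -!EFin_max -EFinM.
  by rewrite maxr_pMl// mul0r expr1 mulNr.
have := cvg_integral_itv i1; under eq_fun do rewrite AE A1.
rewrite /Rintegral E => h.
by rewrite -(cvg_lim _ h)// lim_cst.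
Qed.

End Pdf.
End GaussianMoments.

(** * Independence and products of random variables *)

Section Independence.
Context d (Omega : measurableType d) (R : realType).
Variable P : probability Omega R.

Definition indep2 d1 d2 (E1 : measurableType d1) (E2 : measurableType d2)
    (U : Omega -> E1) (V : Omega -> E2) :=
  forall A B, measurable A -> measurable B ->
  P (U @^-1` A `&` V @^-1` B) = (P (U @^-1` A) * P (V @^-1` B))%E.

Lemma indep2_comp d1 d2 d3 d4 (E1 : measurableType d1) (E2 : measurableType d2)
    (E3 : measurableType d3) (E4 : measurableType d4)
    (U : Omega -> E1) (V : Omega -> E2) (f : E1 -> E3) (g : E2 -> E4) :
  measurable_fun setT f -> measurable_fun setT g ->
  indep2 U V -> indep2 (f \o U) (g \o V).
Proof.
move=> mf mg UV A B mA mB; apply: (UV (f @^-1` A) (g @^-1` B)).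
  by rewrite -[X in measurable X]setTI; exact: mf.
by rewrite -[X in measurable X]setTI; exact: mg.
Qed.

(** Rectangles generate the product sigma-algebra and are stable under intersection, so a Dynkin
    argument extends the factorisation. Independence of [X] and of [Y] from [V] separately would not
    make a product of the two independent of [V]. *)
Lemma indep2_pair d1 d2 d3 (E1 : measurableType d1) (E2 : measurableType d2)
    (E3 : measurableType d3) (X : Omega -> E1) (Y : Omega -> E2) (V : Omega -> E3) :
  measurable_fun setT X -> measurable_fun setT Y -> measurable_fun setT V ->
  (forall A B C, measurable A -> measurable B -> measurable C ->
    P (X @^-1` A `&` Y @^-1` B `&` V @^-1` C) =
    (P (X @^-1` A `&` Y @^-1` B) * P (V @^-1` C))%E) ->
  indep2 (fun w => (X w, Y w)) V.
Proof.
move=> mX mY mV H.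
have mU : measurable_fun setT (fun w => (X w, Y w)) by exact: measurable_fun_pair.
have UE A B : (fun w => (X w, Y w)) @^-1` (A `*` B) = X @^-1` A `&` Y @^-1` B by [].
move: (fun w => (X w, Y w)) mU UE => U mU UE A C mA mC.
have mUA S : measurable S -> measurable (U @^-1` S).
  by move=> mS; rewrite -[X in measurable X]setTI; exact: mU.
have mVC : measurable (V @^-1` C) by rewrite -[X in measurable X]setTI; exact: mV.
have : <<s [set A `*` B | A in measurable & B in measurable] >> A.
  by rewrite -measurable_prod_measurableType.
move: A {mA}; apply: dynkin_induction.
- by rewrite measurable_prod_measurableType.
- move=> _ _ [A1 mA1 [B1 mB1 <-]] [A2 mA2 [B2 mB2 <-]].
  exists (A1 `&` A2); first exact: measurableI.
  by exists (B1 `&` B2); [exact: measurableI|rewrite setXI].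
- by rewrite preimage_setT setTI probability_setT mul1e.
- by move=> _ [A mA [B mB <-]]; rewrite UE; exact: H.
- move=> S mS PS.
  have -> : U @^-1` (~` S) = ~` (U @^-1` S) by [].
  rewrite setIC -setDE measureD//; [|exact: mUA|].
    have {}PS : P (V @^-1` C `&` U @^-1` S) =
      (P (U @^-1` S) * P (V @^-1` C))%E by rewrite setIC.
    have fU := fin_num_measure P _ (mUA _ mS).
    have fV := fin_num_measure P _ mVC.
    rewrite [X in (_ - X)%E]PS probability_setC; last exact: mUA.
    by rewrite muleBl ?mul1e// fin_num_adde_defr.
  by rewrite (le_lt_trans (probability_le1 P mVC))// ltry.
- move=> S mS tS PS.
  rewrite preimage_bigcup setI_bigcupl.
  have tS' : trivIset setT (fun k => U @^-1` S k).
    move=> i j _ _ [w [Si Sj]]; apply: (tS i j) => //.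
    by exists (U w).
  rewrite measure_bigcup//; last 2 first.
  - by move=> k _; apply: measurableI => //; exact: mUA.
  - exact: trivIset_setIr.
  rewrite measure_bigcup//; last by move=> k _; exact: mUA.
  rewrite muleC -(fineK (fin_num_measure P _ mVC)) -nneseriesZl//.
  by apply: eq_eseriesr => k _; rewrite fineK ?fin_num_measure// muleC; exact: PS.
Qed.

(** The joint law agrees with the product of the marginal laws on rectangles, hence everywhere, and
    Fubini applies. *)
Lemma indep2_expectation (U V : Omega -> R) :
  measurable_fun setT U ->
  measurable_fun setT V ->
  indep2 U V ->
  P.-integrable setT (EFin \o U) -> P.-integrable setT (EFin \o V) ->
  P.-integrable setT (EFin \o (fun w => U w * V w)) /\
  \int[P]_w (U w * V w) = \int[P]_w U w * \int[P]_w V w.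
Proof.
move=> mU mV UV Ui Vi.
pose X : {mfun Omega >-> R} := mfun_Sub (mem_set mU).
pose Y : {mfun Omega >-> R} := mfun_Sub (mem_set mV).
have mXY : measurable_fun setT (fun w => (X w, Y w)) by exact: measurable_fun_pair.
pose Z : {mfun Omega >-> (R * R)%type} :=
  mfun_Sub (mem_set mXY).
have law S : measurable S ->
    (distribution P X \x distribution P Y)%E S = distribution P Z S.
  apply: product_measure_unique => A B mA mB; rewrite -UV//.
have mid : measurable_fun setT (EFin : R -> \bar R).
  exact/measurable_EFinP.
have int1 (W : {mfun Omega >-> R}) : P.-integrable setT (EFin \o W) ->
    (distribution P W).-integrable setT (EFin \o (fun x : R => x)) /\
    \int[distribution P W]_x x = \int[P]_w W w.
  move=> Wi; split; last first.
    by rewrite /Rintegral (@integral_distribution _ _ _ _ _ P W EFin).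
  apply/integrableP; split; first exact/measurable_EFinP.
  rewrite ge0_integral_distribution//; last first.
    by apply: measurableT_comp => //; exact/measurable_EFinP.
  by move/integrableP : Wi => [].
have [iX eX] := int1 X Ui; have [iY eY] := int1 Y Vi.
have [pi pe] := integral_prod_mul iX iY.
have mm : measurable_fun setT (fun z : R * R =>
    (z.1 * z.2)%:E).
  by apply/measurable_EFinP; apply: measurable_funM.
have eqi (f : R * R -> \bar R) :
    (\int[(distribution P X \x distribution P Y)%E]_z f z = \int[distribution P Z]_z f z)%E.
  by apply: eq_measure_integral => S mS _; exact: law.
have Zi : P.-integrable setT (EFin \o (fun w => U w * V w)).
  apply/integrableP; split; first by apply/measurable_EFinP; exact: measurable_funM.
  move/integrableP : pi => [_]; rewrite eqi ge0_integral_distribution//.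
  by apply: measurableT_comp.
split => //; rewrite -eX -eY -pe /Rintegral eqi.
by rewrite (@integral_distribution _ _ _ _ _ P Z (fun z => (z.1 * z.2)%:E)).
Qed.

End Independence.

(** * Adapted random variables *)

Section Filtration.
Context d (Omega : measurableType d) (R : realType).
Variables (T : R) (F : R -> set (set Omega)).
Hypothesis hF : is_filtration T F.
Implicit Types (Y Z : Omega -> R) (s : R).

Definition adapted s Y := forall B : set R, measurable B -> F s (Y @^-1` B).

(** Viewing [Omega] with the sigma-algebra [F s] makes the closure properties of measurable
    functions available for adapted variables. *)
Lemma adaptedP s Y : s \in `[0, T] -> adapted s Y <->
  measurable_fun [set: g_sigma_algebraType (F s)] (Y : g_sigma_algebraType (F s) -> R).
Proof.
move=> sT; have [sF _ _] := hF; have sE := sigma_algebra_id (sF _ sT); split.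
  by move=> aY _ B mB; rewrite setTI; apply: sub_sigma_algebra; exact: aY.
move=> mY B mB; have := mY measurableT B mB.
by rewrite setTI /measurable/= sE.
Qed.

Lemma adapted_measurable s Y : s \in `[0, T] -> adapted s Y -> measurable_fun setT Y.
Proof.
move=> sT aY _ B mB; rewrite setTI; have [_ Fm _] := hF.
by apply: (Fm _ sT); exact: aY.
Qed.

Lemma adapted_le s s' Y : 0 <= s -> s <= s' -> s' <= T -> adapted s Y -> adapted s' Y.
Proof.
move=> s0 ss' s'T aY B mB; have [_ _ Fle] := hF.
by apply: (Fle s s') => //; exact: aY.
Qed.

Lemma adapted_cst s c : s \in `[0, T] -> adapted s (fun=> c).
Proof. by move=> sT; apply/adaptedP. Qed.

Lemma adaptedD s Y Z : s \in `[0, T] -> adapted s Y -> adapted s Z ->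
  adapted s (fun w => Y w + Z w).
Proof.
by move=> sT /adaptedP-/(_ sT) mY /adaptedP-/(_ sT) mZ; apply/adaptedP => //; exact: measurable_funD.
Qed.

Lemma adaptedM s Y Z : s \in `[0, T] -> adapted s Y -> adapted s Z ->
  adapted s (fun w => Y w * Z w).
Proof.
by move=> sT /adaptedP-/(_ sT) mY /adaptedP-/(_ sT) mZ; apply/adaptedP => //; exact: measurable_funM.
Qed.

Lemma adapted_sum (I : Type) (r : seq I) (Q : pred I) s (Y : I -> Omega -> R) :
  s \in `[0, T] -> (forall i, Q i -> adapted s (Y i)) ->
  adapted s (fun w => \sum_(i <- r | Q i) Y i w).
Proof.
move=> sT aY; elim: r => [|i r IH].
  by under eq_fun do rewrite big_nil; exact: adapted_cst.
under eq_fun do rewrite big_cons; case: (boolP (Q i)) => // Qi.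
by apply: adaptedD => //; exact: aY.
Qed.

Lemma adapted_prod (I : Type) (r : seq I) (Q : pred I) s (Y : I -> Omega -> R) :
  s \in `[0, T] -> (forall i, Q i -> adapted s (Y i)) ->
  adapted s (fun w => \prod_(i <- r | Q i) Y i w).
Proof.
move=> sT aY; elim: r => [|i r IH].
  by under eq_fun do rewrite big_nil; exact: adapted_cst.
under eq_fun do rewrite big_cons; case: (boolP (Q i)) => // Qi.
by apply: adaptedM => //; exact: aY.
Qed.

End Filtration.

(** * Law and moments of Wiener increments *)

Section WienerIncrements.
Context d (Omega : measurableType d) (R : realType).
Variables (P : probability Omega R) (T : R) (F : R -> set (set Omega)) (m : nat).
Variable w : 'I_m -> R -> Omega -> R.
Hypotheses (hF : is_filtration T F) (hw : is_wiener P T F w).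

Let in0T s s' : 0 <= s -> s < s' -> s' <= T -> s \in `[0, T] /\ s' \in `[0, T].
Proof. by move=> s0 ss' sT; rewrite !in_itv/=; split; lra. Qed.

Definition increment (i : 'I_m) (s s' : R) (omega : Omega) : R := w i s' omega - w i s omega.

Lemma wiener_adapted i s : s \in `[0, T] -> adapted F s (w i s).
Proof. by move=> sT B mB; have [h _ _ _] := hw; exact: h. Qed.

Lemma increment_adapted i s s' : 0 <= s -> s < s' -> s' <= T ->
  adapted F s' (increment i s s').
Proof.
move=> s0 ss' s'T; have [h h'] := in0T s0 ss' s'T.
have aw := adapted_le hF s0 (ltW ss') s'T (wiener_adapted i h).
have := adaptedD hF h' (wiener_adapted i h') (adaptedM hF h' (adapted_cst hF (-1) h') aw).
by rewrite /increment; under [X in adapted _ _ X]eq_fun do rewrite mulN1r.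
Qed.

Lemma increment_measurable i s s' : 0 <= s -> s < s' -> s' <= T ->
  measurable_fun setT (increment i s s').
Proof.
move=> s0 ss' s'T; have [h h'] := in0T s0 ss' s'T.
exact: (adapted_measurable hF h' (increment_adapted i s0 ss' s'T)).
Qed.

Section Law.
Variables s s' : R.
Hypotheses (s0 : 0 <= s) (ss' : s < s') (s'T : s' <= T).
Let sd := Num.sqrt (s' - s).
Local Notation N := (normal_prob 0 sd).
Local Notation X i := (increment i s s').
Let sT : s \in `[0, T]. Proof. by have [] := in0T s0 ss' s'T. Qed.

Let mX i : measurable_fun setT (X i). Proof. exact: increment_measurable. Qed.

Lemma increment_law1 i (A : set Omega) (B : set R) : F s A -> measurable B ->
  P (A `&` X i @^-1` B) = (P A * N B)%E.
Proof.
move=> FA mB; have [_ _ _ h] := hw.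
have := h s s' s0 ss' s'T A (fun j => if j == i then B else setT) FA.
rewrite (_ : \bigcap_i0 _ = X i @^-1` B); last first.
  apply/seteqP; split => [x /(_ i I)|x Bx j _] /=; first by rewrite eqxx.
  by case: eqP => // ->.
move=> ->; last by move=> j; case: ifP.
rewrite (bigD1 i)//= eqxx big1 ?mule1//= => j /negbTE ->.
exact: probability_setT.
Qed.

Lemma increment_law2 i j (A : set Omega) (B C : set R) : i != j ->
  F s A -> measurable B -> measurable C ->
  P (A `&` X i @^-1` B `&` X j @^-1` C) = (P A * N B * N C)%E.
Proof.
move=> ij FA mB mC; have [_ _ _ h] := hw.
have := h s s' s0 ss' s'T A
  (fun l => if l == i then B else if l == j then C else setT) FA.
rewrite (_ : \bigcap_i0 _ = X i @^-1` B `&` X j @^-1` C); last first.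
  apply/seteqP; split => [x Hx|x [Bx Cx] l _] /=.
    split; first by have := Hx i I; rewrite eqxx.
    by have := Hx j I; rewrite eq_sym (negbTE ij) eqxx.
  by case: eqP => [->//|_]; case: eqP => // ->.
rewrite setIA => ->; last by move=> l; case: ifP => // _; case: ifP.
rewrite (bigD1 i)//= eqxx (bigD1 j)/=; last by rewrite eq_sym.
rewrite eq_sym (negbTE ij) eqxx big1 ?mule1 ?muleA//= => l /andP[/negbTE -> /negbTE ->].
exact: probability_setT.
Qed.

Let FT : F s setT.
Proof. by have := adapted_cst hF 0 sT measurableT; rewrite preimage_setT. Qed.

Let lawX i (B : set R) : measurable B -> P (X i @^-1` B) = N B.
Proof.
move=> mB; have := increment_law1 i FT mB.
by rewrite setTI probability_setT mul1e.
Qed.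
Let dl0 : 0 < s' - s. Proof. by rewrite subr_gt0. Qed.
Let sd0 : 0 < sd. Proof. by rewrite sqrtr_gt0. Qed.
Let sd2 : sd ^+ 2 = s' - s. Proof. by rewrite sqr_sqrtr ?ltW. Qed.
Let sd4 : sd ^+ 4 = (s' - s) ^+ 2. Proof. by rewrite -sd2 -exprM. Qed.

Let pushX i : {mfun Omega >-> measurableTypeR R} :=
  @mfun_Sub _ _ Omega (measurableTypeR R) (X i) (mem_set (mX i)).

Let distX i (f : R -> \bar R) :
  (\int[distribution P (pushX i)]_x f x = \int[N]_x f x)%E.
Proof. by apply: eq_measure_integral => B mB _; exact: lawX. Qed.

Let ge0_intX i (h : R -> \bar R) : measurable_fun setT h -> (forall x, (0 <= h x)%E) ->
  (\int[P]_w h (X i w) = \int[N]_x h x)%E.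
Proof.
move=> mh h0; rewrite -(distX i).
by rewrite (@ge0_integral_distribution _ _ _ _ _ P (pushX i) h mh h0).
Qed.

Let mpow k : measurable_fun setT (fun x : R => x ^+ k).
Proof. by apply: measurable_funX. Qed.

Lemma increment4 i : P.-integrable setT (EFin \o (fun w => X i w ^+ 4)) /\
  \int[P]_w (X i w ^+ 4) <= 3 * (s' - s) ^+ 2.
Proof.
have [i4 l4] := normal_moment4 sd0.
have E : (\int[P]_w (X i w ^+ 4)%:E = \int[N]_x (x ^+ 4)%:E)%E.
  apply: (@ge0_intX i (fun x => (x ^+ 4)%:E)).
    by apply/measurable_EFinP; exact: mpow.
  by move=> x; rewrite lee_fin exprn_even_ge0.
split; last by rewrite -sd4 /Rintegral E.
apply/integrableP; split.
  by apply/measurable_EFinP/measurable_funX; exact: mX.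
under eq_integral do rewrite /= ger0_norm ?exprn_even_ge0//.
rewrite E; have := integrable_lty measurableT i4; exact.
Qed.

Lemma increment_sqr_L2 i : L2 P (fun w => X i w ^+ 2).
Proof.
apply/L2P; split; first by apply: measurable_funX; exact: mX.
have [h _] := increment4 i; move: h.
by under eq_fun do rewrite (exprM _ 2 2).
Qed.

Lemma increment_L2 i : L2 P (X i).
Proof.
apply/L2P; split; first exact: mX.
exact: L2_integrable (increment_sqr_L2 i).
Qed.

Lemma increment_mean i : \int[P]_w X i w = 0.
Proof.
rewrite -(normal_moment1 sd0) /Rintegral -(distX i).
rewrite (@integral_distribution _ _ _ _ _ P (pushX i) EFin)//.
exact: L2_integrable (increment_L2 i).
Qed.

Lemma increment_variance i : \int[P]_w (X i w ^+ 2) = s' - s.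
Proof.
rewrite -sd2 -(normal_moment2 sd0) /Rintegral.
rewrite (@ge0_intX i (fun x => (x ^+ 2)%:E))//.
  by apply/measurable_EFinP; exact: mpow.
by move=> x; rewrite lee_fin sqr_ge0.
Qed.

Let indep_L2M (Y V : Omega -> R) : indep2 P Y V -> L2 P Y -> L2 P V ->
  L2 P (fun w => Y w * V w) /\
  sqnorm P (fun w => Y w * V w) = sqnorm P Y * sqnorm P V.
Proof.
move=> YV YL VL.
have YV2 : indep2 P ((fun x => x ^+ 2) \o Y) ((fun x => x ^+ 2) \o V).
  by apply: indep2_comp YV; exact: mpow.
have [|||| i e] := indep2_expectation _ _ YV2.
- exact: measurable_funX (L2_measurable YL).
- exact: measurable_funX (L2_measurable VL).
- exact: L2_integrable_sqr.
- exact: L2_integrable_sqr.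
split; last by rewrite /sqnorm -e; apply: eq_Rintegral => w0 _; rewrite exprMn.
apply/L2P; split.
  by apply: measurable_funM; [exact: L2_measurable YL|exact: L2_measurable VL].
have -> : (fun x => (Y x * V x) ^+ 2) = fun x => Y x ^+ 2 * V x ^+ 2.
  by apply/funext => x; rewrite exprMn.
exact: i.
Qed.

Let indepX i Y : adapted F s Y -> indep2 P Y (X i).
Proof. by move=> aY A B mA mB; rewrite (lawX i mB); apply: increment_law1 => //; exact: aY. Qed.

Let indepXX i j Y : i != j -> adapted F s Y -> indep2 P (fun w => Y w * X i w) (X j).
Proof.
move=> ij aY.
have mY := adapted_measurable hF sT aY.
have pr : indep2 P (fun w => (Y w, X i w)) (X j).
  apply: indep2_pair => // A B C mA mB mC.
  rewrite increment_law2//; last exact: aY.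
  by rewrite -(lawX j mC) increment_law1//; exact: aY.
have := @indep2_comp _ _ _ P _ _ _ _ _ _ _ _ _ _ (fun z : R * R => z.1 * z.2) id _ _ pr.
by apply => //; exact: measurable_funM.
Qed.

Lemma increment_mul_L2 i Y : adapted F s Y -> L2 P Y ->
  L2 P (fun w => Y w * X i w) /\
  sqnorm P (fun w => Y w * X i w) = (s' - s) * sqnorm P Y.
Proof.
move=> aY YL; have [h ->] := indep_L2M (indepX i aY) YL (increment_L2 i).
by split => //; rewrite mulrC /sqnorm increment_variance.
Qed.

Lemma increment_mul_mean i Y : adapted F s Y -> P.-integrable setT (EFin \o Y) ->
  P.-integrable setT (EFin \o (fun w => Y w * X i w)) /\
  \int[P]_w (Y w * X i w) = 0.
Proof.
move=> aY Yi.
have [||||h ->] := indep2_expectation _ _ (indepX i aY) => //.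
- exact: (adapted_measurable hF sT aY).
- exact: L2_integrable (increment_L2 i).
- by rewrite increment_mean mulr0.
Qed.

(** The compensated product of two increments, a martingale difference. *)
Definition increment2 i j (s s' : R) (omega : Omega) : R :=
  increment i s s' omega * increment j s s' omega - (i == j)%:R * (s' - s).

Let XX i omega : increment2 i i s s' omega = X i omega ^+ 2 - (s' - s).
Proof. by rewrite /increment2 eqxx mul1r -expr2. Qed.

Let XX_L2 i : L2 P (increment2 i i s s').
Proof.
rewrite (_ : increment2 i i s s' = fun w => X i w ^+ 2 - (s' - s)); last first.
  by apply/funext => w0; rewrite XX.
by apply: L2B; [exact: increment_sqr_L2|exact: L2_cst].
Qed.

Let XX_sq i : sqnorm P (increment2 i i s s') <= 3 * (s' - s) ^+ 2.
Proof.
have [_ l4] := increment4 i.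
have -> : sqnorm P (increment2 i i s s') =
    sqnorm P (fun w => X i w ^+ 2 + (- (s' - s)) * 1).
  by apply: eq_sqnorm => w0; rewrite XX mulr1.
rewrite sqnorm_expand; [|exact: increment_sqr_L2|exact: L2_cst].
have -> : sqnorm P (fun w => X i w ^+ 2) = \int[P]_w (X i w ^+ 4).
  by apply: eq_Rintegral => w0 _; rewrite -exprM.
under [Z in _ + _ * Z + _]eq_Rintegral do rewrite mulr1.
rewrite increment_variance /sqnorm.
under [Z in _ + _ * Z]eq_Rintegral do rewrite expr1n.
rewrite Rintegral_cst//= probability_setT !mulr1.
have := sqr_ge0 (s' - s); lra.
Qed.

Let indepXXsq i Y : adapted F s Y -> indep2 P Y (increment2 i i s s').
Proof.
move=> aY; have mh : measurable_fun setT (fun x : R => x ^+ 2 - (s' - s)).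
  by apply: measurable_funB => //; exact: mpow.
have := indep2_comp (f := id) _ mh (indepX i aY).
rewrite (_ : increment2 i i s s' = (fun x : R => x ^+ 2 - (s' - s)) \o X i).
  by apply.
by apply/funext => w0; rewrite XX.
Qed.

(** For equal indices the variance is at most [E X^4 - (s' - s)^2 <= 2 (s' - s)^2]; for distinct
    ones independence gives [(s' - s)^2]. The constant 3 covers both. *)
Lemma increment2_mul_L2 i j Y : adapted F s Y -> L2 P Y ->
  L2 P (fun w => Y w * increment2 i j s s' w) /\
  sqnorm P (fun w => Y w * increment2 i j s s' w) <= 3 * (s' - s) ^+ 2 * sqnorm P Y.
Proof.
move=> aY YL; have [->|ij] := eqVneq i j.
  have [h ->] := indep_L2M (indepXXsq j aY) YL (XX_L2 j).
  by split => //; rewrite mulrC ler_wpM2r ?sqnorm_ge0.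
have [h1 e1] := increment_mul_L2 i aY YL.
have [h2 e2] := indep_L2M (indepXX ij aY) h1 (increment_L2 j).
have E : (fun w => Y w * increment2 i j s s' w) = fun w => Y w * X i w * X j w.
  by apply/funext => w0; rewrite /increment2 (negbTE ij) mul0r subr0 mulrA.
rewrite E; split => //; rewrite e2 e1 [sqnorm P (X j)]increment_variance.
rewrite mulrAC -expr2 ler_wpM2r ?sqnorm_ge0//.
have := sqr_ge0 (s' - s); lra.
Qed.

Lemma increment2_mul_mean i j Y : adapted F s Y -> P.-integrable setT (EFin \o Y) ->
  P.-integrable setT (EFin \o (fun w => Y w * increment2 i j s s' w)) /\
  \int[P]_w (Y w * increment2 i j s s' w) = 0.
Proof.
move=> aY Yi; have mY := adapted_measurable hF sT aY; have [->|ij] := eqVneq i j.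
  have [||||h ->] := indep2_expectation _ _ (indepXXsq j aY) => //.
  - exact: L2_measurable (XX_L2 j).
  - exact: L2_integrable (XX_L2 j).
  split => //.
  rewrite (_ : \int[P]_w increment2 j j s s' w = 0) ?mulr0//.
  under eq_Rintegral do rewrite XX.
  rewrite RintegralB//; first last.
  - exact: L2_integrable (L2_cst _ _).
  - exact: L2_integrable (increment_sqr_L2 j).
  by rewrite increment_variance Rintegral_cst//= probability_setT mulr1 subrr.
have [h1 _] := increment_mul_mean i aY Yi.
have [||||h e] := indep2_expectation _ _ (indepXX ij aY) => //.
- by apply: measurable_funM => //; exact: mX.
- exact: L2_integrable (increment_L2 j).
have E : (fun w => Y w * increment2 i j s s' w) = fun w => Y w * X i w * X j w.
  by apply/funext => w0; rewrite /increment2 (negbTE ij) mul0r subr0 mulrA.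
by rewrite E; split => //; rewrite e increment_mean mulr0.
Qed.

Lemma increment2_adapted i j : adapted F s' (increment2 i j s s').
Proof.
have [_ h'] := in0T s0 ss' s'T.
have a1 := increment_adapted i s0 ss' s'T; have a2 := increment_adapted j s0 ss' s'T.
have := adaptedD hF h' (adaptedM hF h' a1 a2)
  (adapted_cst hF (- ((i == j)%:R * (s' - s))) h').
exact.
Qed.

End Law.
End WienerIncrements.

(** * Sums over cells with distinct indices *)

(** The weighted variance about the mean [L / S] is nonnegative; if the total weight is zero, so is
    every weight. *)
Lemma weighted_sqr_sum_le (R : realType) (I : finType) (p z : I -> R) :
  (forall i, 0 <= p i) ->
  (\sum_i p i * z i) ^+ 2 <= (\sum_i p i) * \sum_i p i * z i ^+ 2.
Proof.
move=> p0; set S := \sum_i p i; set L := \sum_i p i * z i.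
have S0 : 0 <= S by apply: sumr_ge0.
have [SE|SN] := eqVneq S 0.
  suff -> : L = 0 by rewrite SE mul0r expr0n.
  apply: big1 => i _; have := SE => /eqP.
  by rewrite psumr_eq0// => /allP/(_ i (mem_index_enum _))/= /eqP ->; rewrite mul0r.
have Sp : 0 < S by rewrite lt0r SN.
have : 0 <= \sum_i p i * (z i - L / S) ^+ 2.
  by apply: sumr_ge0 => i _; rewrite mulr_ge0 ?sqr_ge0.
have -> : \sum_i p i * (z i - L / S) ^+ 2 =
    \sum_i p i * z i ^+ 2 - 2 * (L / S) * L + (L / S) ^+ 2 * S.
  rewrite /L /S !mulr_sumr -sumrB -big_split/=; apply: eq_bigr => i _; ring.
move=> /(mulr_ge0 S0).
rewrite [X in 0 <= X -> _](_ : _ = S * (\sum_i p i * z i ^+ 2) - L ^+ 2).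
  by rewrite subr_ge0.
by field.
Qed.

Section SumNorms.
Context d (E : measurableType d) (R : realType).
Variable mu : {finite_measure set E -> \bar R}.

Lemma Rintegral_sum (I : Type) (r : seq I) (Q : pred I) (f : I -> E -> R) :
  (forall i, Q i -> mu.-integrable setT (EFin \o f i)) ->
  mu.-integrable setT (EFin \o (fun x => \sum_(i <- r | Q i) f i x)) /\
  \int[mu]_x (\sum_(i <- r | Q i) f i x) = \sum_(i <- r | Q i) \int[mu]_x f i x.
Proof.
move=> fi; elim: r => [|i r [IHi IHe]].
  under eq_fun do rewrite big_nil.
  rewrite big_nil; split; first exact: integrable0.
  by rewrite Rintegral_cst// mul0r.
under eq_fun do rewrite big_cons.
rewrite big_cons; case: (boolP (Q i)) => // Qi; split.
  exact: (integrableD measurableT (fi i Qi) IHi).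
by rewrite RintegralD ?IHe//; exact: fi.
Qed.

Lemma sqnorm_orthogonal (I : finType) (e : I -> E -> R) :
  (forall i, L2 mu (e i)) ->
  (forall i j, i != j -> \int[mu]_x (e i x * e j x) = 0) ->
  sqnorm mu (fun x => \sum_i e i x) = \sum_i sqnorm mu (e i).
Proof.
move=> eL eo; rewrite /sqnorm.
transitivity (\int[mu]_x (\sum_i \sum_j e i x * e j x)).
  apply: eq_Rintegral => x _; rewrite expr2 mulr_suml.
  by apply: eq_bigr => i _; rewrite mulr_sumr.
have ij i j : mu.-integrable setT (EFin \o (fun x => e i x * e j x)).
  exact: L2M_integrable.
rewrite (Rintegral_sum _ _).2; last first.
  by move=> i _; apply: (Rintegral_sum _ _).1 => j _.
apply: eq_bigr => i _; rewrite (Rintegral_sum _ _).2// (bigD1 i)//=.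
rewrite big1 ?addr0; first by apply: eq_Rintegral => x _; rewrite expr2.
by move=> j ji; rewrite eo// eq_sym.
Qed.

Lemma sqnorm_weighted_sum_le (I : finType) (p : I -> R) (f : I -> E -> R) :
  (forall i, 0 <= p i) -> (forall i, L2 mu (f i)) ->
  sqnorm mu (fun x => \sum_i p i * f i x) <=
  (\sum_i p i) * \sum_i p i * sqnorm mu (f i).
Proof.
move=> p0 fL.
have SL : L2 mu (fun x => \sum_i p i * f i x) by apply: L2_sum => i _; exact: L2Z.
have pfi i : mu.-integrable setT (EFin \o (fun x => p i * f i x ^+ 2)).
  exact: (integrableZl measurableT _ (L2_integrable_sqr (fL i))).
have [Si Se] := Rintegral_sum (index_enum I) (Q := predT) (f := fun i x => p i * f i x ^+ 2) (fun i _ => pfi i).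
apply: (@le_trans _ _ (\int[mu]_x ((\sum_i p i) * \sum_i p i * f i x ^+ 2))).
  apply: le_Rintegral => //; first exact: L2_integrable_sqr.
    exact: (integrableZl measurableT _ Si).
  by move=> x _; exact: weighted_sqr_sum_le.
rewrite RintegralZl// Se le_eqVlt; apply/orP; left; apply/eqP; congr (_ * _).
by apply: eq_bigr => i _; rewrite RintegralZl//; exact: L2_integrable_sqr.
Qed.

Lemma sqnorm_sum_le (I : finType) (f : I -> E -> R) : (forall i, L2 mu (f i)) ->
  sqnorm mu (fun x => \sum_i f i x) <= #|I|%:R * \sum_i sqnorm mu (f i).
Proof.
move=> fL; have := sqnorm_weighted_sum_le (p := fun=> 1) (fun=> ler01) fL.
rewrite sumr_const.
under [X in _ <= _ * X]eq_bigr do rewrite mul1r.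
by under eq_sqnorm do under eq_bigr do rewrite mul1r.
Qed.

End SumNorms.

Section InsertPosition.
Variables n N : nat.

Definition insert (l : 'I_n.+1) (e : 'I_N) (c : {ffun 'I_n -> 'I_N}) :
    {ffun 'I_n.+1 -> 'I_N} :=
  [ffun i => if unlift l i is Some j then c j else e].

Lemma insert_at l e c : insert l e c l = e.
Proof. by rewrite ffunE unlift_none. Qed.

Lemma insert_lift l e c i : insert l e c (lift l i) = c i.
Proof. by rewrite ffunE liftK. Qed.

Lemma insertK (l : 'I_n.+1) (c : {ffun 'I_n.+1 -> 'I_N}) :
  insert l (c l) [ffun i => c (lift l i)] = c.
Proof.
apply/ffunP => i; rewrite ffunE; case: unliftP => [j ->|->] //.
by rewrite ffunE.
Qed.

Lemma reindex_insert (R : nmodType) l (Q : pred {ffun 'I_n.+1 -> 'I_N})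
    (G : {ffun 'I_n.+1 -> 'I_N} -> R) :
  \sum_(c | Q c) G c = \sum_e \sum_(c | Q (insert l e c)) G (insert l e c).
Proof.
rewrite pair_big_dep/= (reindex (fun p : 'I_N * {ffun 'I_n -> 'I_N} => insert l p.1 p.2))//.
exists (fun c : {ffun 'I_n.+1 -> 'I_N} => (c l, [ffun i => c (lift l i)])) => [[e c] _|c _] /=.
  rewrite insert_at; congr pair; apply/ffunP => i.
  by rewrite ffunE insert_lift.
exact: insertK.
Qed.

Lemma injective_insert l e c : injectiveb (insert l e c) =
  injectiveb c && [forall i, c i != e].
Proof.
apply/injectiveP/andP => [inj|[/injectiveP inj /forallP ne] i j].
  split.
    by apply/injectiveP => i j ij; apply: (@lift_inj _ l); apply: inj; rewrite !insert_lift.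
  apply/forallP => i; apply/eqP => ce.
  have /inj/eqP : insert l e c (lift l i) = insert l e c l.
    by rewrite insert_lift insert_at.
  by rewrite eq_sym (negbTE (neq_lift _ _)).
case: (unliftP l i) => [i' ->|->]; case: (unliftP l j) => [j' ->|->];
  rewrite ?insert_lift ?insert_at//.
- by move=> /inj ->.
- by move=> ce; have := ne i'; rewrite ce eqxx.
- by move=> ce; have := ne j'; rewrite -ce eqxx.
Qed.

(* Splitting at the largest entry leaves a factor that is independent of the past,
   to which all the other factors belong. *)
Lemma sum_injective_max (R : nmodType) (G : {ffun 'I_n.+1 -> 'I_N} -> R) :
  \sum_(c : {ffun 'I_n.+1 -> 'I_N} | injectiveb c) G c =
  \sum_(l < n.+1) \sum_(e < N) \sum_(c : {ffun 'I_n -> 'I_N} |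
     injectiveb c && [forall i, (c i < e)%N]) G (insert l e c).
Proof.
pose pos (c : {ffun 'I_n.+1 -> 'I_N}) := [arg max_(i > ord0) (c i : nat)].
rewrite (partition_big pos predT)//; apply: eq_bigr => l _.
rewrite (reindex_insert l); apply: eq_bigr => e _; apply: eq_bigl => c.
rewrite injective_insert -andbA; congr andb.
apply/andP/forallP => [[/forallP ne /eqP posl] i|lt].
  rewrite ltn_neqAle; apply/andP; split; first exact: ne i.
  move: posl; rewrite /pos; case: arg_maxnP => //= j _ jmax jl.
  by have := jmax (lift l i) isT; rewrite jl insert_lift insert_at.
split; first by apply/forallP => i; rewrite -val_eqE neq_ltn lt.
rewrite /pos; case: arg_maxnP => //= j _ jmax.
case: (unliftP l j) jmax => [i ->|->//] jmax.
have := jmax l isT; rewrite insert_lift insert_at /= => le.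
by have := lt i; rewrite ltnNge le.
Qed.

End InsertPosition.

(** * Mean-square bounds for sums of noises over distinct cells *)

Section StepBound.
Context d (Omega : measurableType d) (R : realType).
Variables (P : probability Omega R) (T : R) (F : R -> set (set Omega)).
Hypothesis hF : is_filtration T F.
Variables (N : nat) (r : nat -> R).
Hypotheses (r0 : 0 <= r 0%N) (rN : r N <= T)
  (rlt : forall c, (c < N)%N -> r c < r c.+1).

Lemma knots_le a b : (a <= b)%N -> (b <= N)%N -> r a <= r b.
Proof.
elim: b => [|b IH]; first by rewrite leqn0 => /eqP ->.
rewrite leq_eqVlt => /predU1P[->//|ab bN].
by rewrite (le_trans (IH ab (ltnW bN)))// ltW// rlt.
Qed.

Lemma knots_in a : (a <= N)%N -> 0 <= r a /\ r a <= T.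
Proof.
move=> aN; split; first exact: le_trans r0 (knots_le _ aN).
exact: le_trans (knots_le aN (leqnn N)) rN.
Qed.

Lemma knots_inT a : (a <= N)%N -> r a \in `[0, T].
Proof. by move=> /knots_in[h1 h2]; rewrite in_itv/= h1. Qed.

Definition mesh (c : 'I_N) : R := r c.+1 - r c.

Lemma mesh_gt0 c : 0 < mesh c.
Proof. by rewrite subr_gt0 rlt. Qed.

Lemma sum_mesh_le : \sum_c mesh c <= T.
Proof.
rewrite /mesh -(big_mkord xpredT (fun c => r c.+1 - r c)) telescope_sumr//.
by rewrite lerBlDr (le_trans rN)// lerDl.
Qed.

(** All that the estimates ask of an integrator, be it time, a Wiener component or a compensated
    product. The coefficients are predictable: known at the left end [r c] of the cell, the noise
    itself only at [r c.+1]. *)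
Definition is_noise (K : R) (xi : 'I_N -> Omega -> R) : Prop :=
  [/\ 0 <= K, forall c : 'I_N, adapted F (r c.+1) (xi c) &
      forall Y : 'I_N -> Omega -> R,
        (forall c : 'I_N, adapted F (r c) (Y c)) -> (forall c, L2 P (Y c)) ->
        L2 P (fun w => \sum_c Y c w * xi c w) /\
        sqnorm P (fun w => \sum_c Y c w * xi c w) <=
          K * \sum_c mesh c * sqnorm P (Y c)].

(** Terms of different cells are orthogonal: all factors but the later noise are known at the start
    of the later cell, and that noise has mean zero against the past. *)
Lemma martingale_noise K xi : 0 <= K ->
  (forall c : 'I_N, adapted F (r c.+1) (xi c)) ->
  (forall (c : 'I_N) Y, adapted F (r c) Y -> L2 P Y ->
     L2 P (fun w => Y w * xi c w) /\
     sqnorm P (fun w => Y w * xi c w) <= K * mesh c * sqnorm P Y) ->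
  (forall (c : 'I_N) Y, adapted F (r c) Y -> P.-integrable setT (EFin \o Y) ->
     \int[P]_w (Y w * xi c w) = 0) ->
  is_noise K xi.
Proof.
move=> K0 axi bxi mxi; split => // Y aY YL.
have YxL c := (bxi c _ (aY c) (YL c)).1.
split; first by apply: L2_sum => c _; exact: YxL.
rewrite sqnorm_orthogonal//.
  rewrite mulr_sumr; apply: ler_sum => c _; rewrite mulrA.
  exact: (bxi c _ (aY c) (YL c)).2.
have lt (c c' : 'I_N) : (c < c')%N -> \int[P]_w (Y c w * xi c w * (Y c' w * xi c' w)) = 0.
  move=> cc'; under eq_Rintegral do rewrite mulrA.
  have iT : r c' \in `[0, T] by apply: knots_inT; exact: ltnW.
  apply: mxi; last exact: L2M_integrable.
  apply: (adaptedM hF iT) => //; apply: (adaptedM hF iT) => //.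
    apply: (adapted_le hF _ _ _ (aY c)).
    - by have [] := @knots_in c (ltnW (ltn_ord c)).
    - by apply: knots_le; exact: ltnW.
    - by have [] := @knots_in c' (ltnW (ltn_ord c')).
  apply: (adapted_le hF _ _ _ (axi c)).
  - by have [] := @knots_in c.+1 (ltn_ord c).
  - by apply: knots_le => //; exact: ltnW.
  - by have [] := @knots_in c' (ltnW (ltn_ord c')).
move=> c c'; rewrite -val_eqE neq_ltn => /orP[|] /lt//.
by under eq_Rintegral do rewrite mulrC.
Qed.

(** Time increments are not centred, so orthogonality gives way to Cauchy-Schwarz with the cell
    lengths as weights, whose total is at most [T]. *)
Lemma time_noise : is_noise T (fun c _ => mesh c).
Proof.
split.
- by have [h1 h2] := knots_in (leqnn N); exact: le_trans h1 h2.
- by move=> c; apply: (adapted_cst hF); exact: knots_inT.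
move=> Y _ YL.
have -> : (fun w => \sum_c Y c w * mesh c) = fun w => \sum_c mesh c * Y c w.
  by apply/funext => w; apply: eq_bigr => c _; rewrite mulrC.
split; first by apply: L2_sum => c _; exact: L2Z.
apply: le_trans (sqnorm_weighted_sum_le _ _) _ => //.
  by move=> c; exact/ltW/mesh_gt0.
rewrite ler_wpM2r ?sum_mesh_le// sumr_ge0// => c _.
by rewrite mulr_ge0 ?sqnorm_ge0// ltW// mesh_gt0.
Qed.

Lemma scale_noise K a xi : is_noise K xi -> is_noise (a ^+ 2 * K) (fun c w => a * xi c w).
Proof.
move=> [K0 axi H]; split; first by rewrite mulr_ge0 ?sqr_ge0.
  move=> c; have iT := knots_inT (ltn_ord c).
  apply: (adaptedM hF iT) => //; exact: (adapted_cst hF).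
move=> Y aY YL; have [HL Hb] := H Y aY YL.
have -> : (fun w => \sum_c Y c w * (a * xi c w)) =
    fun w => a * \sum_c Y c w * xi c w.
  by apply/funext => w; rewrite mulr_sumr; apply: eq_bigr => c _; ring.
split; first exact: L2Z.
by rewrite sqnormZ// -mulrA ler_wpM2l ?sqr_ge0.
Qed.

(** Induction on [n]: after splitting at the largest cell, the inner sum is known at the start of
    that cell, so the noise bound applies to it and the induction hypothesis controls its norm. The
    largest entry has [n + 1] possible positions, and adding that many terms costs a factor [n + 1],
    whence the factorial. *)
Lemma step_bound n (K : 'I_n -> R) (xi : 'I_n -> 'I_N -> Omega -> R)
    (A : {ffun 'I_n -> 'I_N} -> R) : (forall l, is_noise (K l) (xi l)) ->
  L2 P (fun w => \sum_(c : {ffun 'I_n -> 'I_N} | injectiveb c)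
      A c * \prod_l xi l (c l) w) /\
  sqnorm P (fun w => \sum_(c : {ffun 'I_n -> 'I_N} | injectiveb c)
      A c * \prod_l xi l (c l) w) <=
  n`!%:R * (\prod_l K l) * \sum_(c : {ffun 'I_n -> 'I_N} | injectiveb c)
      A c ^+ 2 * \prod_l mesh (c l).
Proof.
elim: n K xi A => [|n IH] K xi A noise.
  have inj0 (c : {ffun 'I_0 -> 'I_N}) : injectiveb c by apply/injectiveP => -[].
  pose c0 : {ffun 'I_0 -> 'I_N} := [ffun i : 'I_0 => match i with Ordinal k h => False_rect _ (notF h) end].
  have c0E c : c = c0 by apply/ffunP => -[].
  have bE (f : {ffun 'I_0 -> 'I_N} -> R) :
      \sum_(c : {ffun 'I_0 -> 'I_N} | injectiveb c) f c = f c0.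
    by rewrite (big_pred1 c0)// => c; rewrite inj0 /= [c]c0E eqxx.
  have -> : (fun w => \sum_(c : {ffun 'I_0 -> 'I_N} | injectiveb c)
      A c * \prod_l xi l (c l) w) = fun=> A c0.
    by apply/funext => w; rewrite bE big_ord0 mulr1.
  split; first exact: L2_cst.
  rewrite bE !big_ord0 !mulr1 mul1r /sqnorm Rintegral_cst//.
  by rewrite [fine _](_ : _ = fine 1%E) ?mulr1//; congr fine; exact: probability_setT.
(* The constraint that the remaining cells precede [e] is put into the coefficients, so that the
   induction hypothesis applies as it stands; it is also what makes [Y l e] adapted at time
   [r e]. *)
pose Y l (e : 'I_N) w := \sum_(c : {ffun 'I_n -> 'I_N} | injectiveb c)
  (A (insert l e c) * [forall i, (c i < e)%N]%:R) * \prod_i xi (lift l i) (c i) w.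
have SE w : \sum_(c : {ffun 'I_n.+1 -> 'I_N} | injectiveb c) A c * \prod_l xi l (c l) w =
    \sum_l \sum_e Y l e w * xi l e w.
  rewrite sum_injective_max; apply: eq_bigr => l _; apply: eq_bigr => e _.
  rewrite big_mkcondr mulr_suml; apply: eq_bigr => c _.
  rewrite (bigD1_ord l)//= insert_at.
  under eq_bigr do rewrite insert_lift.
  by case: ifP => _ /=; rewrite ?mulr0 ?mul0r ?mulr1//; ring.
pose C := n`!%:R * \prod_i K i.
have YL l e : L2 P (Y l e).
  exact: (IH (fun i => K (lift l i)) _ _ (fun i => noise _)).1.
have aY l (e : 'I_N) : adapted F (r e) (Y l e).
  have eT : r e \in `[0, T] by apply: knots_inT; exact: ltnW.
  apply: (@adapted_sum _ _ _ _ _ hF _ _ _ _ (fun (c : {ffun 'I_n -> 'I_N}) w =>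
    A (insert l e c) * [forall i, (c i < e)%N]%:R *
    \prod_i xi (lift l i) (c i) w) eT) => c _.
  case: (boolP [forall i, _]) => [/forallP lt|_].
    apply: (adaptedM hF eT); first exact: (adapted_cst hF).
    apply: (@adapted_prod _ _ _ _ _ hF _ _ _ _
      (fun i w => xi (lift l i) (c i) w) eT) => i _; have [_ axi _] := noise (lift l i).
    apply: (adapted_le hF _ _ _ (axi (c i))).
    - by have [] := @knots_in (c i).+1 (ltn_ord (c i)).
    - by apply: knots_le => //; exact: ltnW.
    - by have [] := @knots_in e (ltnW (ltn_ord e)).
  rewrite (_ : (fun w => _) = fun=> 0); first exact: (adapted_cst hF).
  by apply/funext => w; rewrite mulr0 mul0r.
pose B l (e : 'I_N) := \sum_(c : {ffun 'I_n -> 'I_N} | injectiveb c && [forall i, (c i < e)%N])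
  A (insert l e c) ^+ 2 * \prod_i mesh (insert l e c i).
have noiseb l : L2 P (fun w => \sum_e Y l e w * xi l e w) /\
    sqnorm P (fun w => \sum_e Y l e w * xi l e w) <= C * \sum_e B l e.
  have [Kl _ H] := noise l; have [HL Hb] := H _ (aY l) (YL l).
  split => //; apply: le_trans Hb _.
  rewrite mulr_sumr mulr_sumr; apply: ler_sum => e _.
  have [_ h] := IH (fun i => K (lift l i)) _
    (fun c => A (insert l e c) * [forall i, (c i < e)%N]%:R) (fun i => noise _).
  apply: (le_trans (ler_wpM2l Kl (ler_wpM2l (ltW (mesh_gt0 e)) h))).
  rewrite /C (bigD1_ord l)//= /B.
  rewrite [X in _ <= _ * X]big_mkcondr/=.
  rewrite !mulr_sumr le_eqVlt; apply/orP; left; apply/eqP.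
  apply: eq_bigr => c _.
  have -> : \prod_i mesh (insert l e c i) = mesh e * \prod_i mesh (c i).
    rewrite (bigD1_ord l)//= insert_at; congr (_ * _).
    by apply: eq_bigr => i _; rewrite insert_lift.
  by case: ifP => _ /=; rewrite ?mulr0 ?mul0r ?expr0n/= ?mulr0 ?mul0r ?mulr0 ?mulr1//; ring.
have -> : (fun w => \sum_(c : {ffun 'I_n.+1 -> 'I_N} | injectiveb c)
   A c * \prod_l xi l (c l) w) = fun w => \sum_l \sum_e Y l e w * xi l e w.
  exact/funext.
split; first by apply: L2_sum => l _; exact: (noiseb l).1.
apply: le_trans (sqnorm_sum_le _) _; first by move=> l; exact: (noiseb l).1.
rewrite card_ord sum_injective_max factS natrM -!mulrA ler_wpM2l//.
rewrite mulrA -/C mulr_sumr; apply: ler_sum => l _; exact: (noiseb l).2.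
Qed.

End StepBound.

(** * Step functions *)

Section Grids.
Context (R : realType).

(** Cells are selected by the position of their left endpoint and not by their index, to match the
    indicator of a coarse half-open cell in [gstep_refine]. *)
Lemma telescope_between (V : nmodType) (W : zmodType) (r : nat -> R) (g : nat -> W) N p q :
  (forall a b, (a <= b)%N -> (b <= N)%N -> r a <= r b) ->
  (forall a b, (a < b)%N -> (b <= N)%N -> r a < r b) ->
  (p <= q)%N -> (q <= N)%N ->
  \sum_(c < N) (if r p <= r c < r q then g c.+1 - g c else 0) = g q - g p.
Proof.
move=> rle rlt pq qN.
rewrite -(big_mkord xpredT (fun c => if r p <= r c < r q then g c.+1 - g c else 0)).
rewrite (big_cat_nat (leq0n p) (leq_trans pq qN))/= (big_cat_nat pq qN)/=.
rewrite big_nat big1 ?add0r; last first.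
  move=> c /andP[_ cp]; case: ifP => // /andP[le _].
  by have := rlt _ _ cp (leq_trans pq qN); rewrite ltNge le.
rewrite [X in _ + X]big_nat [X in _ + X]big1 ?addr0; last first.
  move=> c /andP[qc cN]; case: ifP => // /andP[_ lt].
  by have := rle _ _ qc (ltnW cN); rewrite leNgt lt.
rewrite -telescope_sumr// big_nat [RHS]big_nat; apply: eq_bigr => c /andP[pc cq].
by rewrite rle ?rlt//; exact: leq_trans (ltnW cq) qN.
Qed.

Lemma grid_of_seq (t T : R) (L : seq R) : t < T ->
  (forall x, x \in L -> t <= x <= T) -> t \in L -> T \in L ->
  exists N (r : nat -> R), [/\ r 0%N = t, r N = T,
    forall c, (c < N)%N -> r c < r c.+1 &
    forall x, x \in L -> exists2 q, (q <= N)%N & r q = x].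
Proof.
move=> tT Lb tL TL; pose K := sort <=%R (undup L).
have memK x : (x \in K) = (x \in L) by rewrite mem_sort mem_undup.
have sK : sorted <%R K.
  by rewrite lt_sorted_uniq_le sort_uniq undup_uniq sort_sorted//; exact: le_total.
have K0 : (0 < size K)%N.
  by rewrite lt0n size_eq0; apply/eqP => KE; have := memK t; rewrite KE tL.
exists (size K).-1, (nth 0 K).
have lt a b : (a < b)%N -> (b <= (size K).-1)%N -> nth 0 K a < nth 0 K b.
  move=> ab bN; have bK : (b < size K)%N by rewrite -(prednK K0) ltnS.
  by rewrite (lt_sorted_ltn_nth 0 sK)// inE// (ltn_trans ab).
have idx x : x \in L -> exists2 q, (q <= (size K).-1)%N & nth 0 K q = x.
  move=> xL; exists (index x K); last by rewrite nth_index// memK.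
  by rewrite -ltnS prednK// index_mem memK.
split => //; last by move=> c cN; apply: lt.
- have [q qN qt] := idx t tL; case: q qN qt => [//|q] qN qt.
  have := lt 0%N q.+1 isT qN; rewrite qt => h.
  have := Lb (nth 0 K 0); rewrite -memK mem_nth// => /(_ isT) /andP[h' _].
  by have := lt_le_trans h h'; rewrite ltxx.
- have [q qN qT] := idx T TL; have [<-//|ne] := eqVneq q (size K).-1.
  have qlt : (q < (size K).-1)%N by rewrite ltn_neqAle ne.
  have := lt q _ qlt (leqnn _); rewrite qT => h.
  have := Lb (nth 0 K (size K).-1); rewrite -memK mem_nth; last by rewrite prednK.
  by move=> /(_ isT) /andP[_ h']; have := lt_le_trans h h'; rewrite ltxx.
Qed.

End Grids.

Section StepData.
Context (R : realType).
Variables (t T : R) (n : nat).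
Hypothesis htT : t < T.
Implicit Types (s : step_data R n).

Definition coef_fun s (c : {ffun 'I_n -> 'I_(step_size s)}) : R :=
  @coefs R n s [tuple c l | l < n].

(* The integral of a step function against the product of arbitrary additive
   interval functions; both [step_fun] and [step_integral] are instances. *)
Definition gstep N (r : nat -> R) (A : {ffun 'I_n -> 'I_N} -> R) (W : 'I_n -> R -> R) : R :=
  \sum_(c : {ffun 'I_n -> 'I_N}) A c * \prod_l (W l (r (c l).+1) - W l (r (c l))).

Lemma sum_tuple_ffun N (f : n.-tuple 'I_N -> R) :
  \sum_j f j = \sum_(c : {ffun 'I_n -> 'I_N}) f [tuple c l | l < n].
Proof.
rewrite (reindex (fun c : {ffun 'I_n -> 'I_N} => [tuple c l | l < n]))//.
exists (fun j => [ffun l => tnth j l]) => [c _|j _].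
  by apply/ffunP => l; rewrite ffunE tnth_mktuple.
by apply: eq_from_tnth => l; rewrite tnth_mktuple ffunE.
Qed.

Lemma uniq_mktuple N (c : {ffun 'I_n -> 'I_N}) : uniq [tuple c l | l < n] = injectiveb c.
Proof. by []. Qed.

Lemma step_integralE d (Omega : measurableType d) m (w : 'I_m -> R -> Omega -> R)
    (i : 'I_n -> 'I_m.+1) s omega :
  step_integral w i s omega =
  gstep (knots s) (@coef_fun s) (fun l u => with_time w (i l) u omega).
Proof.
rewrite /step_integral sum_tuple_ffun; apply: eq_bigr => c _; congr (_ * _).
by apply: eq_bigr => l _; rewrite tnth_mktuple.
Qed.

Lemma indic_itvE (a b x : R) : a <= b ->
  \1_(`[a, b[ : set R) x = (x < b)%R%:R - (x < a)%R%:R :> R.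
Proof.
move=> ab; rewrite indicE mem_setE in_itv/=.
case: (ltP x a) => [xa|ax] /=; first by rewrite (lt_le_trans xa ab) subrr.
by rewrite subr0.
Qed.

Lemma step_funE s x : is_step t T s -> step_fun s x =
  gstep (knots s) (@coef_fun s) (fun l u => (tnth x l < u)%R%:R).
Proof.
move=> [_ _ lt _]; rewrite /step_fun sum_tuple_ffun; apply: eq_bigr => c _.
congr (_ * _); apply: eq_bigr => l _.
by rewrite tnth_mktuple indic_itvE// ltW// lt.
Qed.

Lemma coef_fun_diag s (c : {ffun 'I_n -> 'I_(step_size s)}) : is_step t T s -> ~~ injectiveb c -> coef_fun (s := s) c = 0.
Proof. by move=> [_ _ _ h] nc; apply: h; rewrite uniq_mktuple. Qed.

Lemma knots_mono s : is_step t T s -> forall a b, (a <= b)%N -> (b <= step_size s)%N ->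
  knots s a <= knots s b.
Proof.
move=> [_ _ slt _] a; elim=> [|b IH]; first by rewrite leqn0 => /eqP ->.
rewrite leq_eqVlt => /predU1P[->//|ab bN].
by rewrite (le_trans (IH ab (ltnW bN)))// ltW// slt.
Qed.

Section Refine.
Variables (N : nat) (r : nat -> R).
Hypothesis rlt : forall c, (c < N)%N -> r c < r c.+1.

Let rl a b : (a <= b)%N -> (b <= N)%N -> r a <= r b.
Proof.
elim: b => [|b IH]; first by rewrite leqn0 => /eqP ->.
rewrite leq_eqVlt => /predU1P[->//|ab bN].
by rewrite (le_trans (IH ab (ltnW bN)))// ltW// rlt.
Qed.

Let rs a b : (a < b)%N -> (b <= N)%N -> r a < r b.
Proof. by move=> ab bN; apply: lt_le_trans (rl ab bN); apply: rlt; exact: leq_trans bN. Qed.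

(** On a grid containing the knots of [s], the step function is constant on the fine boxes, so its
    value at the lower corner is the refined coefficient. *)
Definition left_value s (c : {ffun 'I_n -> 'I_N}) : R :=
  step_fun s [tuple r (c l) : measurableTypeR R | l < n].

(** A coarse increment is the sum of the fine increments it contains; multiplying out and exchanging
    sums collects the fine coefficients. As [W] is arbitrary, step functions and their stochastic
    integrals are refined at once. *)
Lemma gstep_refine s W : is_step t T s ->
  (forall j, (j <= step_size s)%N -> exists2 q, (q <= N)%N & r q = knots s j) ->
  gstep (knots s) (@coef_fun s) W = gstep r (left_value s) W.
Proof.
move=> [_ _ slt _] sub; rewrite /gstep.
have cell l (j : 'I_(step_size s)) : W l (knots s j.+1) - W l (knots s j) =
   \sum_(c < N) \1_(`[knots s j, knots s j.+1[ : set R) (r c) * (W l (r c.+1) - W l (r c)).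
  have [q qN qE] := sub j.+1 (ltn_ord j).
  have [p pN pE] := sub j (ltnW (ltn_ord j)).
  have pq : (p <= q)%N.
    rewrite leqNgt; apply/negP => qp; have := rs qp pN.
    by rewrite pE qE ltNge ltW// slt.
  have := telescope_between (nat : nmodType) (fun c => W l (r c)) rl rs pq qN.
  rewrite pE qE => <-; apply: eq_bigr => c _.
  rewrite indicE mem_setE in_itv/=.
  by case: ifP => _; rewrite ?mul1r ?mul0r.
transitivity (\sum_(j : {ffun 'I_n -> 'I_(step_size s)}) \sum_(c : {ffun 'I_n -> 'I_N})
   coef_fun (s := s) j * (\prod_l \1_(`[knots s (j l), knots s (j l).+1[ : set R) (r (c l))) *
   \prod_l (W l (r (c l).+1) - W l (r (c l)))).
  apply: eq_bigr => j _; under eq_bigr do rewrite cell.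
  rewrite bigA_distr_bigA mulr_sumr; apply: eq_bigr => c _.
  by rewrite big_split/= mulrA.
rewrite exchange_big; apply: eq_bigr => c _; rewrite -mulr_suml; congr (_ * _).
rewrite /left_value /step_fun sum_tuple_ffun; apply: eq_bigr => j _.
by congr (_ * _); apply: eq_bigr => l _; rewrite !tnth_mktuple.
Qed.

(** Two variables in one fine cell lie in one coarse cell, where the coefficient of [s] vanishes:
    refinement creates no diagonal terms. *)
Lemma left_value_diag s (c : {ffun 'I_n -> 'I_N}) : is_step t T s -> ~~ injectiveb c -> left_value s c = 0.
Proof.
move=> hs nc; have [_ _ _ h] := hs; rewrite /left_value /step_fun big1// => j _.
have [/h ->|uj] := boolP (~~ uniq j); first by rewrite mul0r.
rewrite negbK in uj.
have [a [b [ab cab]]] : exists a b, a != b /\ c a = c b.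
  move: nc => /injectivePn[a [b ab cab]]; by exists a, b.
suff -> : \prod_(l < n) \1_(`[knots s (tnth j l), knots s (tnth j l).+1[ : set R)
   (tnth [tuple r (c l) : measurableTypeR R | l < n] l) = 0 :> R by rewrite mulr0.
have disj (x y : 'I_(step_size s)) z : (x < y)%N ->
    \1_(`[knots s x, knots s x.+1[ : set R) z * \1_(`[knots s y, knots s y.+1[ : set R) z = 0 :> R.
  move=> xy; rewrite !indicE !mem_setE !in_itv/=.
  case: (ltP z (knots s x.+1)) => zx; last by rewrite andbF mul0r.
  case: (leP (knots s y) z) => yz; last by rewrite mulr0.
  exfalso.
  suff : knots s x.+1 <= knots s y by move=> /(lt_le_trans zx)/lt_le_trans/(_ yz); rewrite ltxx.
  by apply: (knots_mono hs) => //; exact: ltnW.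
rewrite (bigD1 a)//= (bigD1 b)/=; last by rewrite eq_sym.
rewrite mulrA !tnth_mktuple cab.
have jab : tnth j a != tnth j b.
  by apply: contra ab => /eqP jab; apply/eqP; move/tuple_uniqP : uj => /(_ _ _ jab).
move: jab; rewrite -val_eqE neq_ltn => /orP[] lt.
  by rewrite disj// mul0r.
by rewrite [X in X * _]mulrC disj// mul0r.
Qed.

End Refine.

Definition step_of N (r : nat -> R) (A : {ffun 'I_n -> 'I_N} -> R) : step_data R n :=
  @StepData R n N r (fun j => if uniq j then A [ffun l => tnth j l] else 0).

Lemma step_of_is_step N (r : nat -> R) A : r 0%N = t -> r N = T ->
  (forall c, (c < N)%N -> r c < r c.+1) -> is_step t T (@step_of N r A).
Proof. by move=> r0 rN rlt; split => //= j /negbTE ->. Qed.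

Lemma coef_fun_step_of N (r : nat -> R) A (c : {ffun 'I_n -> 'I_N}) :
  coef_fun (s := @step_of N r A) c = if injectiveb c then A c else 0.
Proof.
rewrite /coef_fun/= uniq_mktuple; case: ifP => // _; congr A.
by apply/ffunP => l; rewrite ffunE tnth_mktuple.
Qed.

Lemma common_refinement s1 s2 : is_step t T s1 -> is_step t T s2 ->
  exists N (r : nat -> R), [/\ r 0%N = t, r N = T,
    forall c, (c < N)%N -> r c < r c.+1,
    forall j, (j <= step_size s1)%N -> exists2 q, (q <= N)%N & r q = knots s1 j &
    forall j, (j <= step_size s2)%N -> exists2 q, (q <= N)%N & r q = knots s2 j].
Proof.
move=> h1 h2; pose L s := [seq knots s j | j <- iota 0 (step_size s).+1].
have inL s j : (j <= step_size s)%N -> knots s j \in L s.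
  by move=> js; apply/mapP; exists j => //; rewrite mem_iota.
have Lb s : is_step t T s -> forall x, x \in L s -> t <= x <= T.
  move=> hs x /mapP[j]; rewrite mem_iota/= add0n ltnS => js ->.
  have [k0 kN _ _] := hs; rewrite -{1}k0 -kN.
  by rewrite !(knots_mono hs).
have [|||N [r [r0 rN rlt sub]]] := @grid_of_seq _ t T (L s1 ++ L s2) htT.
- by move=> x; rewrite mem_cat => /orP[] /Lb; apply.
- by have [k0 _ _ _] := h1; rewrite mem_cat -k0 inL.
- by have [_ kN _ _] := h1; rewrite mem_cat -kN inL.
exists N, r; split => // j js; apply: sub; rewrite mem_cat inL// ?orbT//.
Qed.

(** Both are rewritten on a common refinement. One [s3] serves function and integral together, which
    gives linearity of the integral without comparing different representations of one step
    function. *)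
Lemma step_comb s1 s2 (a b : R) : is_step t T s1 -> is_step t T s2 ->
  exists s3, [/\ is_step t T s3,
    forall x, step_fun s3 x = a * step_fun s1 x + b * step_fun s2 x &
    forall d (Omega : measurableType d) m (w : 'I_m -> R -> Omega -> R)
      (i : 'I_n -> 'I_m.+1) omega,
      step_integral w i s3 omega =
      a * step_integral w i s1 omega + b * step_integral w i s2 omega].
Proof.
move=> h1 h2; have [N [r [r0 rN rlt sub1 sub2]]] := common_refinement h1 h2.
pose s3 := @step_of N r (fun c : {ffun 'I_n -> 'I_N} => a * left_value r s1 c + b * left_value r s2 c).
have h3 : is_step t T s3 by exact: step_of_is_step.
have key W : gstep (knots s3) (@coef_fun s3) W =
    a * gstep (knots s1) (@coef_fun s1) W + b * gstep (knots s2) (@coef_fun s2) W.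
  rewrite (gstep_refine rlt _ h1 sub1) (gstep_refine rlt _ h2 sub2).
  rewrite /gstep !mulr_sumr -big_split; apply: eq_bigr => c _.
  rewrite (coef_fun_step_of r _ c); case: ifPn => ic; first by rewrite mulrDl !mulrA.
  by rewrite !left_value_diag// !mul0r !mulr0 /= addr0.
exists s3; split => // [x|d Omega m w i omega].
  by rewrite !step_funE.
by rewrite !step_integralE.
Qed.

End StepData.

(** * Norms of tensors of cell indicators *)

Section CellNorms.
Context (R : realType).
Variables (t T : R) (N : nat) (r : nat -> R).
Hypotheses (r0 : r 0%N = t) (rN : r N = T) (rlt : forall c, (c < N)%N -> r c < r c.+1).
Local Notation mu1 := (interval_measure t T).
Local Notation Q n := (cube_measure t T n).

Let rle := knots_le rlt.

Definition cell_indic (c : 'I_N) : R -> R := \1_(`[r c, r c.+1[ : set R).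

Lemma cell_indicE (c : 'I_N) x : cell_indic c x = (r c <= x < r c.+1)%R%:R.
Proof. by rewrite /cell_indic indicE mem_setE in_itv. Qed.

Lemma interval_measure_co (a b : R) : t <= a -> a <= b -> b <= T ->
  mu1 (`[a, b[ : set R) = (b - a)%:E.
Proof.
move=> ta ab bT; rewrite /interval_measure /mrestr.
rewrite (_ : _ `&` _ = `[a, b[%classic); last first.
  apply/seteqP; split => [x []//|x]; rewrite /= !in_itv/= => /andP[ax xb].
  by split; apply/andP; split => //; lra.
rewrite lebesgue_measure_itv/= lte_fin; case: ltP => [_|ba]; first by rewrite EFinB.
by have -> : a = b by [apply/eqP; rewrite eq_le ab ba]; rewrite subrr.
Qed.

Lemma cell_indic_L2 c : L2 mu1 (cell_indic c).
Proof. by apply: L2_indic; exact: measurable_itv. Qed.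

Lemma cell_sqnorm c : sqnorm mu1 (cell_indic c) = mesh r c.
Proof.
transitivity (\int[mu1]_x cell_indic c x).
  apply: eq_Rintegral => x _; rewrite cell_indicE.
  by case: (_ && _); rewrite ?expr1n ?expr0n.
rewrite /Rintegral integral_indic// setIT [X in fine X]interval_measure_co//.
- by rewrite -r0; apply: rle => //; exact: ltnW.
- by apply: ltW; exact: rlt.
- by rewrite -rN; apply: rle => //; exact: ltn_ord.
Qed.

Lemma cell_disjoint (c c' : 'I_N) x : c != c' -> cell_indic c x * cell_indic c' x = 0.
Proof.
have lt (a b : 'I_N) : (a < b)%N -> cell_indic a x * cell_indic b x = 0.
  move=> ab; rewrite !cell_indicE.
  have h : r a.+1 <= r b by apply: rle => //; exact: ltnW.
  case: (ltP x (r a.+1)) => xa; last by rewrite andbF mul0r.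
  by rewrite [r b <= x]leNgt (lt_le_trans xa h) /= mulr0.
by rewrite -val_eqE neq_ltn => /orP[/lt//|/lt]; rewrite mulrC.
Qed.

Lemma cell_collapse (c0 : 'I_N) (g : 'I_N -> R) x : r c0 <= x < r c0.+1 ->
  \sum_c g c * cell_indic c x = g c0.
Proof.
move=> xc; have x1 : cell_indic c0 x = 1 by rewrite cell_indicE xc.
rewrite (bigD1 c0)//= x1 mulr1 big1 ?addr0// => c cc0.
by have := cell_disjoint x cc0; rewrite x1 mulr1 => ->; rewrite mulr0.
Qed.

Lemma cell_exists x : t <= x < T -> exists c0 : 'I_N, r c0 <= x < r c0.+1.
Proof.
move=> /andP[]; rewrite -r0 -rN => x0 xN.
have [k [kN xk]] : exists k, (k <= N)%N /\ x < r k by exists N.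
elim: k kN xk => [|k IH] kN xk; first by move: xk; rewrite ltNge x0.
case: (ltP x (r k)) => [h|h]; first by apply: IH => //; exact: ltnW.
by exists (Ordinal kN); rewrite h xk.
Qed.

Section Multi.
Variable n : nat.
Implicit Type A : {ffun 'I_n -> 'I_N} -> R.

Definition cell_tensor A (x : n.-tuple (measurableTypeR R)) : R :=
  \sum_c A c * tensor (fun l => cell_indic (c l)) x.

(** Distinct multi-indices give tensors with disjoint supports, so Pythagoras applies. *)
Lemma cell_tensor_L2 A : L2 (Q n) (cell_tensor A) /\
  sqnorm (Q n) (cell_tensor A) = \sum_c A c ^+ 2 * \prod_l mesh r (c l).
Proof.
have tL (c : {ffun 'I_n -> 'I_N}) : L2 (Q n) (tensor (fun l => cell_indic (c l))) /\
   sqnorm (Q n) (tensor (fun l => cell_indic (c l))) = \prod_l mesh r (c l).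
  have [h ->] := @tensor_L2 _ t T n (fun l => cell_indic (c l)) (fun l => cell_indic_L2 _).
  by split => //; apply: eq_bigr => l _; exact: cell_sqnorm.
split; first by apply: L2_sum => c _; apply: L2Z; exact: (tL c).1.
rewrite sqnorm_orthogonal.
- apply: eq_bigr => c _; rewrite sqnormZ; last exact: (tL c).1.
  by rewrite (tL c).2.
- by move=> c; apply: L2Z; exact: (tL c).1.
- move=> c c' cc'; rewrite /Rintegral integral0_eq// => x _.
  rewrite mulrACA tensorM.
  have [l ccl] : exists l, c l != c' l.
    apply/existsP; apply: contraR cc'; rewrite negb_exists => /forallP h.
    by apply/eqP/ffunP => l; have := h l; rewrite negbK => /eqP.
  by rewrite /tensor (bigD1 l)//= cell_disjoint// mul0r mulr0.
Qed.

Lemma gstep_cell_tensor A x :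
  gstep r A (fun l u => (tnth x l < u)%R%:R) = cell_tensor A x.
Proof.
apply: eq_bigr => c _; congr (_ * _); apply: eq_bigr => l _.
by rewrite /cell_indic indic_itvE// ltW// rlt.
Qed.

End Multi.
End CellNorms.

(** * Step integrals against time and the Wiener process *)

Section StepIntegral.
Context d (Omega : measurableType d) (R : realType).
Variables (P : probability Omega R) (t T : R).
Hypotheses (ht : 0 <= t) (htT : t < T).
Variables (F : R -> set (set Omega)) (m : nat) (w : 'I_m -> R -> Omega -> R).
Hypotheses (hF : is_filtration T F) (hw : is_wiener P T F w).
Local Notation Q n := (cube_measure t T n).

Section Noise.
Variables (N : nat) (r : nat -> R).
Hypotheses (r0 : r 0%N = t) (rN : r N = T) (rlt : forall c, (c < N)%N -> r c < r c.+1).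

Let r00 : 0 <= r 0%N. Proof. by rewrite r0. Qed.
Let rNT : r N <= T. Proof. by rewrite rN. Qed.
Let rin := knots_in r00 rNT rlt.

Definition time_increment (i : 'I_m.+1) (c : 'I_N) (omega : Omega) : R :=
  with_time w i (r c.+1) omega - with_time w i (r c) omega.

Lemma noise_le K K' xi : K <= K' -> is_noise P F r K xi -> @is_noise _ _ _ P F N r K' xi.
Proof.
move=> KK' [K0 axi H]; split => //; first exact: le_trans KK'.
move=> Y aY YL; have [HL Hb] := H Y aY YL; split => //.
apply: le_trans Hb _; rewrite ler_wpM2r// sumr_ge0// => c _.
by rewrite mulr_ge0 ?sqnorm_ge0// ltW// mesh_gt0.
Qed.

Lemma increment_noise i :
  @is_noise _ _ _ P F N r 1 (fun c => increment w i (r c) (r c.+1)).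
Proof.
apply: (martingale_noise hF r00 rNT rlt) => // c.
- apply: (increment_adapted hF hw) => //; first exact: (rin (ltnW (ltn_ord c))).1.
    exact: rlt.
  exact: (rin (ltn_ord c)).2.
- move=> Y aY YL.
  have [h ->] := increment_mul_L2 hF hw (rin (ltnW (ltn_ord c))).1 (rlt (ltn_ord c))
    (rin (ltn_ord c)).2 i aY YL.
  by rewrite mul1r.
- move=> Y aY Yi.
  by have [] := increment_mul_mean hF hw (rin (ltnW (ltn_ord c))).1 (rlt (ltn_ord c))
    (rin (ltn_ord c)).2 i aY Yi.
Qed.

(** The sum [1 + T] dominates both the constant 1 of a Wiener component and the constant [T] of
    time. *)
Lemma time_increment_noise i : @is_noise _ _ _ P F N r (1 + T) (time_increment i).
Proof.
have T0 : 0 <= T by rewrite (le_trans ht)// ltW.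
rewrite /time_increment /with_time; case: unlift => [i'|].
  by apply: noise_le (increment_noise i'); rewrite lerDl.
by apply: noise_le (time_noise P hF r00 rNT rlt); rewrite lerDr.
Qed.

(* The quadratic covariation of the two integrators over a cell is subtracted;
   what is left is a noise whose constant vanishes with the mesh. *)
Definition covariation_noise (i j : 'I_m.+1) (c : 'I_N) (omega : Omega) : R :=
  time_increment i c omega * time_increment j c omega -
  ((i == j) && (i != ord0))%:R * mesh r c.

(** If one integrator is time, its increment is the number [h], and [h] times a noise has constant
    [h^2 (1 + T)]; two Wiener components give a compensated product with constant [3 h]. The common
    cell length lets [h] be pulled out. *)
Lemma covariation_is_noise (h : R) i j : (forall c : 'I_N, mesh r c = h) ->
  @is_noise _ _ _ P F N r (3 * h + h ^+ 2 * (1 + T)) (covariation_noise i j).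
Proof.
move=> hh.
have [N0|N0] := leqP N 0.
  have T0 : 0 <= T by rewrite (le_trans ht)// ltW.
  by exfalso; move: htT; rewrite -r0 -rN; move: N0; rewrite leqn0 => /eqP ->; rewrite ltxx.
have h0 : 0 < h by rewrite -(hh (Ordinal N0)) mesh_gt0.
have T0 : 0 <= T by rewrite (le_trans ht)// ltW.
have le1 : h ^+ 2 * (1 + T) <= 3 * h + h ^+ 2 * (1 + T).
  by rewrite lerDr mulr_ge0// ltW.
have scaled k : @is_noise _ _ _ P F N r (3 * h + h ^+ 2 * (1 + T))
    (fun c omega => h * time_increment k c omega).
  exact: noise_le le1 (scale_noise hF r00 rNT rlt h (time_increment_noise k)).
have timeE (k : 'I_m.+1) c omega : unlift ord0 k = None -> time_increment k c omega = h.
  by move=> kN; rewrite /time_increment /with_time kN -(hh c).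
case ui : (unlift ord0 i) => [i'|]; last first.
  have := scaled j; congr is_noise; apply/funext => c; apply/funext => omega.
  rewrite /covariation_noise (timeE i)//.
  have -> : i = ord0 by case: unliftP ui.
  by rewrite eqxx andbF mul0r subr0.
case uj : (unlift ord0 j) => [j'|]; last first.
  have := scaled i; congr is_noise; apply/funext => c; apply/funext => omega.
  rewrite /covariation_noise (timeE j)// mulrC.
  have -> : j = ord0 by case: unliftP uj.
  by case: eqP => //=; rewrite mul0r subr0.
have iE : i = lift ord0 i' by move: ui; case: unliftP => // k -> [->].
have jE : j = lift ord0 j' by move: uj; case: unliftP => // k -> [->].
have -> : covariation_noise i j = fun c => increment2 w i' j' (r c) (r c.+1).
  apply/funext => c; apply/funext => omega.
  rewrite /covariation_noise /time_increment /with_time ui uj /increment2.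
  by rewrite iE jE (inj_eq (@lift_inj _ ord0)) andb_idr.
apply: (@noise_le (3 * h)); first by rewrite lerDl mulr_ge0 ?sqr_ge0// addr_ge0.
apply: (martingale_noise hF r00 rNT rlt) => [|c|c Y aY YL|c Y aY Yi].
- by rewrite mulr_ge0// ltW.
- apply: (increment2_adapted hF hw); first exact: (rin (ltnW (ltn_ord c))).1.
    exact: rlt.
  exact: (rin (ltn_ord c)).2.
- have [HL Hb] := increment2_mul_L2 hF hw (rin (ltnW (ltn_ord c))).1 (rlt (ltn_ord c))
    (rin (ltn_ord c)).2 i' j' aY YL.
  split => //; apply: le_trans Hb _.
  by rewrite -[r c.+1 - r c]/(mesh r c) !hh expr2 mulrA.
- by have [] := increment2_mul_mean hF hw (rin (ltnW (ltn_ord c))).1 (rlt (ltn_ord c))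
    (rin (ltn_ord c)).2 i' j' aY Yi.
Qed.

End Noise.

Definition step_constant n : R := n`!%:R * (1 + T) ^+ n.

Lemma step_constant_ge0 n : 0 <= step_constant n.
Proof.
by rewrite mulr_ge0// exprn_ge0// addr_ge0// (le_trans ht)// ltW.
Qed.

(** Both sides reduce to the same sum of squared coefficients times cell volumes. It is an
    inequality, since permuted multi-indices can give correlated terms. *)
Lemma step_isometry n (i : 'I_n -> 'I_m.+1) (s : step_data R n) : is_step t T s ->
  [/\ L2 (Q n) (step_fun s), L2 P (step_integral w i s) &
    sqnorm P (step_integral w i s) <= step_constant n * sqnorm (Q n) (step_fun s)].
Proof.
move=> hs; have [k0 kN klt _] := hs.
have fE : step_fun s = cell_tensor (knots s) (@coef_fun _ _ s).
  apply/funext => x; rewrite (step_funE _ hs) gstep_cell_tensor//.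
have [fL fn] := @cell_tensor_L2 _ t T _ _ k0 kN klt n (@coef_fun _ _ s).
have IE : step_integral w i s = fun omega =>
    \sum_(c : {ffun 'I_n -> 'I_(step_size s)} | injectiveb c)
       coef_fun c * \prod_l time_increment (knots s) (i l) (c l) omega.
  apply/funext => omega; rewrite step_integralE /gstep [RHS]big_mkcond.
  apply: eq_bigr => c _; case: ifPn => // ic.
  by rewrite (coef_fun_diag hs ic) mul0r.
have [IL In] := @step_bound _ _ _ P T F hF (step_size s) (knots s)
  (eq_ind_r (fun x => 0 <= x) ht k0) (eq_ind_r (fun x => x <= T) (lexx T) kN) klt n
  (fun=> 1 + T) (fun l => time_increment (knots s) (i l)) (@coef_fun _ _ s)
  (fun l => time_increment_noise k0 kN klt (i l)).
rewrite IE fE; split => //; apply: le_trans In _.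
rewrite fn prodr_const card_ord ler_wpM2l ?step_constant_ge0//.
rewrite big_mkcond; apply: ler_sum => c _; case: ifP => // _.
by rewrite mulr_ge0 ?sqr_ge0// prodr_ge0// => l _; rewrite ltW// mesh_gt0.
Qed.

End StepIntegral.

(** The ratio is the share of multi-indices with distinct entries; its limit makes the diagonal
    cells of the cube negligible. *)
Lemma ffact_ratio_cvg (R : realType) n :
  ((N.+1 ^_ n)%:R / N.+1%:R ^+ n : R) @[N --> \oo] --> (1 : R).
Proof.
elim: n => [|n IH].
  under eq_fun do rewrite ffactn0 expr0 divr1.
  exact: cvg_cst.
have E N : (N.+1 ^_ n.+1)%:R / N.+1%:R ^+ n.+1 =
    ((N.+1 ^_ n)%:R / N.+1%:R ^+ n) * ((N.+1 - n)%:R / N.+1%:R) :> R.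
  rewrite ffactnSr natrM exprSr; field.
  by rewrite nat1r expf_neq0 pnatr_eq0.
rewrite (funext E) -[X in _ --> X](mulr1 (1 : R)); apply: cvgM => //.
apply: (@squeeze_cvgr _ _ _ _ (fun N => 1 - n%:R * N.+1%:R^-1) (fun=> 1)).
- apply: nearW => N; apply/andP; split; last first.
    by rewrite ler_pdivrMr// mul1r ler_nat leq_subr.
  rewrite -[X in X - _](@divff _ N.+1%:R) ?pnatr_eq0// -mulrBl ler_pM2r ?invr_gt0//.
  have [nN|Nn] := leqP n N.+1; first by rewrite natrB.
  by rewrite (@le_trans _ _ 0)// subr_le0 ler_nat ltnW.
- rewrite -[X in _ --> X](_ : 1 - n%:R * 0 = 1); last by rewrite mulr0 subr0.
  by apply: cvgB; [exact: cvg_cst|apply: cvgMr; exact: cvg_harmonic].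
- exact: cvg_cst.
Qed.

(** * Approximation by values at the left endpoints of a uniform grid *)

Section LeftPoint.
Context (R : realType).
Variables (t T : R).
Hypothesis htT : t < T.
Local Notation mu1 := (interval_measure t T).
Local Notation Q n := (cube_measure t T n).

Definition grid_mesh (N : nat) : R := (T - t) / N.+1%:R.
Definition grid (N c : nat) : R := t + c%:R * grid_mesh N.

Lemma grid_mesh_gt0 N : 0 < grid_mesh N.
Proof. by rewrite divr_gt0// subr_gt0. Qed.

Lemma grid0 N : grid N 0 = t.
Proof. by rewrite /grid mul0r addr0. Qed.

Lemma gridN N : grid N N.+1 = T.
Proof. by rewrite /grid /grid_mesh mulrC divfK ?pnatr_eq0// subrKC. Qed.

Lemma gridS N c : grid N c.+1 = grid N c + grid_mesh N.
Proof. by rewrite /grid -natr1 mulrDl mul1r addrA. Qed.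

Lemma grid_lt N c : (c < N.+1)%N -> grid N c < grid N c.+1.
Proof. by move=> _; rewrite gridS ltrDl grid_mesh_gt0. Qed.

Lemma mesh_grid N (c : 'I_N.+1) : mesh (grid N) c = grid_mesh N.
Proof. by rewrite /mesh gridS addrAC subrr add0r. Qed.

Lemma grid_mesh_cvg0 : grid_mesh N @[N --> \oo] --> (0 : R).
Proof.
rewrite -[X in _ --> X](mulr0 (T - t)); apply: cvgMr; exact: cvg_harmonic.
Qed.

Definition left_step (N : nat) (f : R -> R) (x : R) : R :=
  \sum_(c < N.+1) f (grid N c) * cell_indic (grid N) c x.

Lemma left_step_cell N f (c : 'I_N.+1) x : grid N c <= x < grid N c.+1 ->
  left_step N f x = f (grid N c).
Proof.
exact: (@cell_collapse _ _ (grid N) (@grid_lt N) c (fun c => f (grid N c))).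
Qed.

Lemma left_step_out N f x : (forall c : 'I_N.+1, ~~ (grid N c <= x < grid N c.+1)) ->
  left_step N f x = 0.
Proof.
by move=> nc; apply: big1 => c _; rewrite cell_indicE (negbTE (nc c)) mulr0.
Qed.

Lemma left_stepP N x :
  (exists c : 'I_N.+1, forall f, left_step N f x = f (grid N c)) \/
  (forall f, left_step N f x = 0).
Proof.
have [[c xc]|nc] := pselect (exists c : 'I_N.+1, grid N c <= x < grid N c.+1).
  by left; exists c => f; exact: left_step_cell.
right => f; apply: left_step_out => c; apply/negP => xc; apply: nc; by exists c.
Qed.

Lemma left_step_L2 N f : L2 mu1 (left_step N f).
Proof. by apply: L2_sum => c _; apply: L2Z; exact: cell_indic_L2. Qed.

(* Unlike L_2, this class is closed under products (see [left_approxM]), so that the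
   diagonal terms of a product of grid sums are again grid sums of such functions. *)
Definition left_approx (f : R -> R) : Prop :=
  [/\ measurable_fun setT (f : measurableTypeR R -> R),
      exists2 M, 0 <= M & forall x, `|f x| <= M &
      cvgL2 mu1 (fun N => left_step N f) f].

Lemma left_approx_L2 f : left_approx f -> L2 mu1 f.
Proof. by move=> [_ _ /cvgL2P[]]. Qed.

(** Sampling commutes with products, and [f_N g_N - f g = f_N (g_N - g) + g (f_N - f)], where the
    sup bounds on [f_N] and [g] control the products in L_2. *)
Lemma left_approxM f g : left_approx f -> left_approx g ->
  left_approx (fun x => f x * g x).
Proof.
move=> [mf [M M0 fM] fa] [mg [K K0 gK] ga].
have stepM N x : left_step N (fun x => f x * g x) x = left_step N f x * left_step N g x.
  case: (left_stepP N x) => [[c h]|h]; first by rewrite !h.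
  by rewrite !h mulr0.
have stepb N x : `|left_step N f x| <= M.
  by case: (left_stepP N x) => [[c h]|h]; rewrite h// normr0.
have mfg : measurable_fun setT (fun x : measurableTypeR R => f x * g x) by exact: measurable_funM.
split => //.
  by exists (M * K); [rewrite mulr_ge0|move=> x; rewrite normrM ler_pM].
have /cvgL2P[fNL fL f0] := fa; have /cvgL2P[gNL gL g0] := ga.
have fgL : L2 mu1 (fun x => f x * g x) by exact: (L2_bounded_mul mf fM gL).
apply/cvgL2P; split => [N||] //; first exact: left_step_L2.
apply: (@squeeze_cvg0 _ _ (fun N =>
  2 * (M ^+ 2 * sqnorm mu1 (fun x => left_step N g x - g x)) +
  2 * (K ^+ 2 * sqnorm mu1 (fun x => left_step N f x - f x)))); last first.
  rewrite -[X in _ --> X](_ : 2 * (M ^+ 2 * 0) + 2 * (K ^+ 2 * 0) = 0); last by ring.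
  by apply: cvgD; apply: cvgMr; apply: cvgMr.
move=> N; rewrite sqnorm_ge0/=.
have bnd (a b : R -> R) C : measurable_fun setT (a : measurableTypeR R -> R) ->
    (forall x, `|a x| <= C) -> L2 mu1 b ->
    L2 mu1 (fun x => a x * b x) /\ sqnorm mu1 (fun x => a x * b x) <= C ^+ 2 * sqnorm mu1 b.
  move=> ma aC bL; have abL := L2_bounded_mul ma aC bL; split => //.
  rewrite -sqnormZ//; apply: (@ler_sqnorm _ _ _ mu1 (fun x => a x * b x) (fun x => C * b x) _ _ _).2.
  - exact: L2_measurable abL.
  - exact: L2Z.
  - move=> x; rewrite !exprMn ler_wpM2r ?sqr_ge0// -[leLHS]real_normK ?num_real//.
    by rewrite lerXn2r ?nnegrE// (le_trans _ (aC x)).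
have [l1 b1] := bnd _ _ _ (L2_measurable (fNL N)) (stepb N) (L2B (gNL N) gL).
have [l2 b2] := bnd _ _ _ mg gK (L2B (fNL N) fL).
have E (x : measurableTypeR R) : left_step N (fun x => f x * g x) x - f x * g x =
   left_step N f x * (left_step N g x - g x) + g x * (left_step N f x - f x).
  by rewrite stepM; ring.
apply: le_trans (_ : sqnorm mu1 (fun x : measurableTypeR R =>
  left_step N f x * (left_step N g x - g x) + g x * (left_step N f x - f x)) <= _).
  by rewrite le_eqVlt; apply/orP; left; apply/eqP; exact: eq_sqnorm.
apply: le_trans (sqnormD_le l1 l2) _.
by rewrite lerD// ler_wpM2l.
Qed.

(** Sampling alters the indicator only in the cell where it jumps, of length one mesh, and possibly
    at [T], which lies in no half-open cell. *)
Lemma left_approx_ray a : left_approx (\1_(`]a, +oo[ : set R)).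
Proof.
have fE x : \1_(`]a, +oo[ : set R) x = (a < x)%R%:R :> R.
  by rewrite indicE mem_setE in_itv/= andbT.
have mf : measurable_fun setT (\1_(`]a, +oo[ : set R) : measurableTypeR R -> R).
  by apply: measurable_indic; exact: measurable_itv.
have fL : L2 mu1 (\1_(`]a, +oo[ : set R)).
  by apply: L2_indic; exact: measurable_itv.
split => //.
  exists 1 => // x; rewrite fE; by case: (a < x); rewrite ?normr1 ?normr0.
apply/cvgL2P; split => [N||] //; first exact: left_step_L2.
apply: (@squeeze_cvg0 _ _ grid_mesh); last exact: grid_mesh_cvg0.
move=> N; rewrite sqnorm_ge0/=.
(* [A] contains the part of that cell beyond [a]; [B] meets [[t, T]] only in the point [T] and is
   null. *)
pose A : set R := `]a, a + grid_mesh N[%classic; pose B : set R := ~` `[t, T[%classic.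
have mA : measurable (A : set (measurableTypeR R)) by exact: measurable_itv.
have mB : measurable (B : set (measurableTypeR R)) by apply: measurableC; exact: measurable_itv.
have iA := L2_integrable (L2_indic mu1 mA).
have iB := L2_integrable (L2_indic mu1 mB).
apply: (@le_trans _ _ (\int[mu1]_x (\1_A x + \1_B x))).
  apply: le_Rintegral => //.
  - exact: L2_integrable_sqr (L2B (left_step_L2 N _) fL).
  - exact: (integrableD measurableT iA iB).
  move=> x _; have [Bx|nB] := pselect (B x).
    rewrite [\1_B x]indicE mem_set//= (@le_trans _ _ 1)//; last first.
      by rewrite lerDr indicE; case: (_ \in _).
    case: (left_stepP N x) => [[c ->]|->]; rewrite ?fE;
      by do 2?case: (a < _) => /=; rewrite ?subrr ?subr0 ?sub0r ?sqrrN ?expr1n ?expr0n.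
  have xT : t <= x < T by move: nB => /contrapT; rewrite /= in_itv.
  have [c xc] := cell_exists (grid0 N) (gridN N) xT.
  rewrite (left_step_cell _ xc) !fE.
  have Ax : (grid N c <= a) -> a < x -> \1_A x = 1 :> R.
    move=> ca ax; rewrite indicE mem_set// /A/= in_itv/= ax/=.
    by move/andP : xc => [_]; rewrite gridS => /lt_le_trans; apply; rewrite lerD2r.
  have p1 : 0 <= \1_A x + \1_B x :> R by rewrite !indicE; do 2!case: (_ \in _) => /=; lra.
  case: (ltP a x) => ax; case: (ltP a (grid N c)) => ac /=;
    rewrite ?subrr ?expr0n//=.
    by rewrite sub0r sqrrN expr1n Ax// lerDl indicE; case: (_ \in _).
  by move/andP : xc => [/(lt_le_trans ac)]; rewrite ltNge ax.
rewrite RintegralD// /Rintegral !integral_indic// !setIT.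
have muB : mu1 B = 0%E.
  rewrite /interval_measure /mrestr (_ : _ `&` _ = [set T]) ?lebesgue_measure_set1//.
  apply/seteqP; split => [x|x ->] /=; rewrite /B /= !in_itv/=.
    move=> [/negP nT /andP[tx xT]]; move: nT; rewrite tx/= -leNgt => Tx.
    by apply/eqP; rewrite eq_le xT Tx.
  by rewrite ltxx andbF lexx (ltW htT).
rewrite [X in _ + X](_ : _ = 0); last exact: (congr1 fine muB).
rewrite addr0 -lee_fin fineK; last exact: fin_num_measure.
apply: (@le_trans _ _ (lebesgue_measure (A : set (measurableTypeR R)))).
  by apply: le_measure; rewrite ?inE//; apply: measurableI => //; exact: measurable_itv.
rewrite /A lebesgue_measure_itv/= lte_fin ltrDl grid_mesh_gt0.
by rewrite -EFinB addrAC subrr add0r.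
Qed.

(** Open rays generate the Borel sets and are stable under intersection. *)
Lemma left_approx_dense : L2_dense t T left_approx.
Proof.
split=> [f|S HS SD f fL]; first exact: left_approx_L2.
apply: (L2_closed_total HS (G := [set A | exists a, A = `]a, +oo[%classic])) => //.
- exact: RGenOInfty.measurableE.
- move=> _ _ [a ->] [b ->]; exists (Num.max a b).
  apply/seteqP; split => [x []|x]; rewrite /= !in_itv/= !andbT gt_max.
    by move=> -> ->.
  by move=> /andP[].
- have [SL2 Slin Scl] := HS; apply: Scl; first exact: L2_indic.
  (* The whole line is not a ray, but on [[t, T]] its indicator agrees with that of a ray starting
     left of [t]. *)
  move=> e e0; exists (\1_(`]t - 1, +oo[ : set R)); first by apply: SD; exact: left_approx_ray.
  apply: le_lt_trans e0; rewrite le_eqVlt; apply/orP; left; apply/eqP; apply: ae_sqdist0.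
  - exact: measurable_indic.
  - by apply: measurable_indic; exact: measurable_itv.
  exists (~` `[t, T]%classic); split => [||x /= nx].
  - by apply: measurableC; exact: measurable_itv.
  - transitivity (lebesgue_measure (~` `[t, T]%classic `&` `[t, T]%classic : set R)) => //.
    by rewrite setICl measure0.
  move=> /= xt; apply: nx; rewrite !indicE in_setT mem_set//= in_itv/= andbT.
  by move: xt; rewrite in_itv/= => /andP[tx _]; lra.
- by move=> _ [a ->]; apply: SD; exact: left_approx_ray.
Qed.

Definition grid_step n N (f : 'I_n -> R -> R) : step_data R n :=
  @step_of R n N.+1 (grid N) (fun c => \prod_l f l (grid N (c l))).

Lemma grid_step_is_step n N (f : 'I_n -> R -> R) : is_step t T (grid_step N f).
Proof. by apply: step_of_is_step; [exact: grid0|exact: gridN|exact: grid_lt]. Qed.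

(** The tensor of the sampled factors is a step function but for its diagonal cells. These carry
    bounded coefficients, and their share of the cube is that of the multi-indices with a repeated
    entry, which tends to 0. *)
Lemma cvgL2_grid_step n (f : 'I_n -> R -> R) : (forall l, left_approx (f l)) ->
  cvgL2 (Q n) (fun N => step_fun (grid_step N f)) (tensor f).
Proof.
move=> fD.
have /choice[M MP] l : exists M, 0 <= M /\ forall x, `|f l x| <= M.
  by have [_ [M M0 fM] _] := fD l; exists M.
have ten : cvgL2 (Q n) (fun N => tensor (fun l => left_step N (f l))) (tensor f).
  by apply: cvgL2_tensor => l; have [] := fD l.
pose A N (c : {ffun 'I_n -> 'I_N.+1}) := \prod_l f l (grid N (c l)).
have tenE N : tensor (fun l => left_step N (f l)) = cell_tensor (grid N) (A N).
  apply/funext => x; rewrite /tensor /left_step bigA_distr_bigA.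
  by apply: eq_bigr => c _; rewrite big_split.
pose dg N (c : {ffun 'I_n -> 'I_N.+1}) := if injectiveb c then 0 else A N c.
have stE N x : step_fun (grid_step N f) x =
    tensor (fun l => left_step N (f l)) x - cell_tensor (grid N) (dg N) x.
  rewrite (step_funE x (grid_step_is_step N f)) gstep_cell_tensor; last exact: grid_lt.
  rewrite tenE /cell_tensor -sumrB; apply: eq_bigr => c _.
  rewrite (coef_fun_step_of _ _ c) -mulrBl; congr (_ * _); rewrite /dg.
  by case: ifP => _; rewrite ?subr0 ?subrr.
have /cvgL2P[tenL fL ten0] := ten.
have [dL dn] : (forall N, L2 (Q n) (cell_tensor (grid N) (dg N))) /\
   (forall N, sqnorm (Q n) (cell_tensor (grid N) (dg N)) =
     \sum_(c : {ffun 'I_n -> 'I_N.+1}) dg N c ^+ 2 * grid_mesh N ^+ n).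
  split=> N; have [h1 h2] := @cell_tensor_L2 _ t T _ _ (grid0 N) (gridN N) (@grid_lt N) n (dg N) => //.
  rewrite h2; apply: eq_bigr => c _; congr (_ * _).
  rewrite (eq_bigr (fun=> grid_mesh N)) => [|l _]; last exact: mesh_grid.
  by rewrite prodr_const card_ord.
pose C := (\prod_l M l) ^+ 2.
have C0 : 0 <= C by exact: sqr_ge0.
have db N : sqnorm (Q n) (cell_tensor (grid N) (dg N)) <=
    C * (T - t) ^+ n * (1 - (N.+1 ^_ n)%:R / N.+1%:R ^+ n).
  rewrite dn; apply: (@le_trans _ _ (\sum_(c : {ffun 'I_n -> 'I_N.+1} | ~~ injectiveb c)
      C * grid_mesh N ^+ n)).
    rewrite [leRHS]big_mkcond; apply: ler_sum => c _; rewrite /dg.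
    case: ifPn => _; first by rewrite expr0n/= mul0r.
    apply: ler_wpM2r; first by rewrite exprn_ge0// ltW// grid_mesh_gt0.
    rewrite -[leLHS]real_normK ?num_real// lerXn2r ?nnegrE//.
      by apply: prodr_ge0 => l _; have [] := MP l.
    rewrite /A normr_prod; apply: ler_prod => l _; rewrite normr_ge0/=.
    by have [] := MP l.
  have cardE : #|[pred c : {ffun 'I_n -> 'I_N.+1} | ~~ injectiveb c]|%:R =
     N.+1%:R ^+ n - (N.+1 ^_ n)%:R :> R.
    have := cardC (pred_of_simpl [pred c : {ffun 'I_n -> 'I_N.+1} | injectiveb c]).
    rewrite card_ffun !card_ord.
    have := card_inj_ffuns 'I_n 'I_N.+1; rewrite !card_ord cardsE => ->.
    move=> /(congr1 (fun k => k%:R : R)); rewrite natrD natrX => <-.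
    by rewrite addrAC subrr add0r; congr (_%:R); apply: eq_card.
  rewrite sumr_const -[X in X <= _]mulr_natr cardE le_eqVlt; apply/orP; left; apply/eqP.
  rewrite /grid_mesh exprMn exprVn; field.
  by rewrite expf_neq0// pnatr_eq0.
have d0 : sqnorm (Q n) (cell_tensor (grid N) (dg N)) @[N --> \oo] --> 0.
  apply: squeeze_cvg0 => [N|]; first by rewrite sqnorm_ge0; exact: db.
  rewrite -[X in _ --> X](_ : C * (T - t) ^+ n * (1 - 1) = 0); last by ring.
  by apply: cvgMr; apply: cvgB; [exact: cvg_cst|exact: ffact_ratio_cvg].
have dc : cvgL2 (Q n) (fun N => cell_tensor (grid N) (dg N)) (fun=> 0).
  apply/cvgL2P; split => //; first exact: L2_0.
  by under eq_fun => N do under eq_sqnorm do rewrite subr0.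
have := cvgL2D ten (cvgL2Z (-1) dc).
rewrite (_ : (fun x => tensor f x + -1 * 0) = tensor f); last first.
  by apply/funext => x; rewrite mulr0 addr0.
by apply: cvgL2_ext => N x; rewrite stE mulN1r.
Qed.

(** By [step_comb] the closure of the step functions is a closed linear class, and it contains all
    tensors of [left_approx] functions. *)
Lemma step_dense n (f : n.-tuple (measurableTypeR R) -> R) : L2 (Q n) f ->
  exists2 s : nat -> step_data R n, (forall N, is_step t T (s N)) &
    cvgL2 (Q n) (fun N => step_fun (s N)) f.
Proof.
move=> fL.
have stepL s : is_step t T s -> L2 (Q n) (step_fun s).
  move=> hs; have [k0 kN klt _] := hs.
  rewrite (_ : step_fun s = cell_tensor (knots s) (@coef_fun _ _ s)).
    by have [] := @cell_tensor_L2 _ t T _ _ k0 kN klt n (@coef_fun _ _ s).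
  by apply/funext => x; rewrite (step_funE _ hs) gstep_cell_tensor.
pose D (g : n.-tuple (measurableTypeR R) -> R) := exists2 s, is_step t T s & g = step_fun s.
have DL g : D g -> L2 (Q n) g by move=> [s hs ->]; exact: stepL.
suff /(L2_closure_sequence DL)[u uD uf] : L2_closure (Q n) D f.
  have /choice[s sP] N : exists s, is_step t T s /\ u N = step_fun s.
    by have [s] := uD N; exists s.
  exists s; first by move=> N; have [] := sP N.
  by apply: cvgL2_ext uf => N x; have [_ ->] := sP N.
have clo : L2_closed_linear (Q n) (L2_closure (Q n) D).
  apply: (L2_closure_closed_linear DL) => a _ _ [s1 h1 ->] [s2 h2 ->].
  have [s3 [h3 s3E _]] := step_comb htT a 1 h1 h2.
  by exists s3 => //; apply/funext => x; rewrite s3E mul1r.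
apply: (cube_total left_approx_dense clo) => // g gD.
apply: (L2_closed_cvg clo) (cvgL2_grid_step gD) => N; apply: (sub_L2_closure DL).
by exists (grid_step N g); first exact: grid_step_is_step.
Qed.

End LeftPoint.

(** * The multiple Wiener integral *)

Section WienerIntegral.
Context d (Omega : measurableType d) (R : realType).
Variables (P : probability Omega R) (t T : R).
Hypotheses (ht : 0 <= t) (htT : t < T).
Variables (F : R -> set (set Omega)) (m : nat) (w : 'I_m -> R -> Omega -> R).
Hypotheses (hF : is_filtration T F) (hw : is_wiener P T F w).
Local Notation Q n := (cube_measure t T n).
Local Notation is_integral := (is_multiple_wiener P t T w).
Local Notation J := (multiple_wiener P t T w).
Local Notation Cn n := (step_constant T n).

Lemma is_multiple_wiener_L2 n (i : 'I_n -> 'I_m.+1) f X :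
  is_integral i f X -> L2 (Q n) f /\ L2 P X.
Proof. by move=> [s [_ /cvgL2P[_ fL _] /cvgL2P[_ XL _]]]. Qed.

Lemma is_multiple_wienerD n (i : 'I_n -> 'I_m.+1) a b f g X Y :
  is_integral i f X -> is_integral i g Y ->
  is_integral i (fun x => a * f x + b * g x) (fun omega => a * X omega + b * Y omega).
Proof.
move=> [s1 [h1 f1 X1]] [s2 [h2 g2 Y2]].
have /choice[s3 s3P] N := step_comb htT a b (h1 N) (h2 N).
exists s3; split => [N||]; first by have [] := s3P N.
- apply: cvgL2_ext (cvgL2D (cvgL2Z a f1) (cvgL2Z b g2)) => N x.
  by have [_ -> _] := s3P N.
- apply: cvgL2_ext (cvgL2D (cvgL2Z a X1) (cvgL2Z b Y2)) => N omega.
  by have [_ _ ->] := s3P N.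
Qed.

(** One factor 2 comes from [sqnorm_lim_le], the other from bounding the norms of the step functions
    by that of [f]. *)
Lemma is_multiple_wiener_bound n (i : 'I_n -> 'I_m.+1) f X :
  is_integral i f X -> sqnorm P X <= 4 * Cn n * sqnorm (Q n) f.
Proof.
move=> [s [hs /cvgL2P[sL fL sf] IX]].
have C0 := step_constant_ge0 ht htT n.
have -> : 4 * Cn n * sqnorm (Q n) f = 2 * Cn n * (2 * 0 + 2 * sqnorm (Q n) f) by ring.
apply: (sqnorm_lim_le C0 IX (b := fun N =>
  2 * sqnorm (Q n) (fun x => step_fun (s N) x - f x) + 2 * sqnorm (Q n) f)); last first.
  by apply: cvgD; [exact: cvgMr|exact: cvg_cst].
move=> N; have [_ _ b] := step_isometry ht htT hF hw i (hs N).
apply: le_trans b _; rewrite ler_wpM2l//.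
have E x : step_fun (s N) x = (step_fun (s N) x - f x) + f x by rewrite subrK.
by rewrite (eq_sqnorm _ E); exact: sqnormD_le (L2B (sL N) fL) fL.
Qed.

Lemma is_multiple_wiener_dist n (i : 'I_n -> 'I_m.+1) f g X Y :
  is_integral i f X -> is_integral i g Y ->
  sqnorm P (fun omega => X omega - Y omega) <=
  4 * Cn n * sqnorm (Q n) (fun x => f x - g x).
Proof.
move=> fX gY; have := is_multiple_wiener_bound (is_multiple_wienerD 1 (-1) fX gY).
have E1 omega : 1 * X omega + -1 * Y omega = X omega - Y omega by ring.
have E2 x : 1 * f x + -1 * g x = f x - g x by ring.
by rewrite (eq_sqnorm _ E1) (eq_sqnorm _ E2).
Qed.

Lemma is_multiple_wiener_unique n (i : 'I_n -> 'I_m.+1) f X Y :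
  is_integral i f X -> is_integral i f Y -> {ae P, forall omega, X omega = Y omega}.
Proof.
move=> fX fY; have [_ XL] := is_multiple_wiener_L2 fX.
have [_ YL] := is_multiple_wiener_L2 fY.
apply: sqdist_eq0_ae => //; apply/eqP; rewrite eq_le sqnorm_ge0 andbT.
apply: le_trans (is_multiple_wiener_dist fX fY) _.
have E x : f x - f x = 0 by rewrite subrr.
by rewrite (eq_sqnorm _ E) sqnorm0 mulr0.
Qed.

(** The difference of two approximants is a step function by [step_comb], so the step bound makes
    the integrals a Cauchy sequence. *)
Lemma is_multiple_wiener_exists n (i : 'I_n -> 'I_m.+1) f : L2 (Q n) f ->
  exists X, is_integral i f X.
Proof.
move=> fL; have [s hs sf] := step_dense htT fL.
have C0 := step_constant_ge0 ht htT n.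
have /cvgL2P[sL _ s0] := sf.
have iso N := step_isometry ht htT hF hw i (hs N).
suff [X XP] : exists X, cvgL2 P (fun N => step_integral w i (s N)) X by exists X, s.
apply: L2_complete => [N|e e0]; first by have [] := iso N.
(* The 4 accounts for two distances to [f], each with the factor 2 of [sqdist_le]; the 1 keeps the
   divisor positive. *)
pose K := 4 * Cn n + 1.
have K0 : 0 < K by rewrite /K; lra.
have [N NP] := cvg0_eventually s0 (divr_gt0 e0 K0).
exists N => p q pN qN.
have [s3 [h3 s3E I3]] := step_comb htT 1 (-1) (hs p) (hs q).
have [_ _ b3] := step_isometry ht htT hF hw i h3.
have E omega : step_integral w i (s p) omega - step_integral w i (s q) omega =
   step_integral w i s3 omega by rewrite I3; ring.
have E' x : step_fun s3 x = step_fun (s p) x - step_fun (s q) x by rewrite s3E; ring.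
rewrite (eq_sqnorm _ E); apply: le_trans b3 _; rewrite (eq_sqnorm _ E').
have zb := sqdist_le (sL p) fL (sL q); rewrite [X in _ + 2 * X]sqnormBC in zb.
have aux (c x y z : R) : 0 <= c -> 0 <= x -> 0 <= y -> x * (4 * c + 1) < e ->
    y * (4 * c + 1) < e -> z <= 2 * x + 2 * y -> c * z <= e.
  move=> c0 x0 y0 hx hy hz; apply: (@le_trans _ _ (c * (2 * x + 2 * y))).
    by rewrite ler_wpM2l.
  have -> : c * (2 * x + 2 * y) = 2 * (c * x) + 2 * (c * y) by ring.
  have ex : x * (4 * c + 1) = 4 * (c * x) + x by ring.
  have ey : y * (4 * c + 1) = 4 * (c * y) + y by ring.
  lra.
apply: aux zb; rewrite ?sqnorm_ge0// -?ltr_pdivlMr//.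
- exact: NP.
- exact: NP.
Qed.

Lemma multiple_wienerP n (i : 'I_n -> 'I_m.+1) f : L2 (Q n) f -> is_integral i f (J i f).
Proof.
case: n i f => [|n] i f fL; last first.
  have [X XP] := is_multiple_wiener_exists i fL.
  exact: (@xgetPex _ (cst 0) [set X | is_integral i f X] (ex_intro _ X XP)).
(* For [n = 0] the integral is defined apart; one cell and the empty multi-index, which has no
   repeated entry, realise the constant as a step integral. *)
pose s := @step_of R 0 1 (grid t T 0) (fun=> f [tuple]).
have hs : is_step t T s by apply: step_of_is_step; [exact: grid0|exact: gridN|exact: grid_lt].
have one (G : 0.-tuple 'I_1 -> R) : \sum_j G j = G [tuple].
  by rewrite (big_pred1 [tuple])// => j; apply/esym/eqP; exact: tuple0.
exists (fun=> s); split => //.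
- apply: (@cvgL2_ext _ _ _ _ (fun=> f)); last exact: cvgL2_cst.
  by move=> N x; rewrite /step_fun one big_ord0 mulr1/= [x]tuple0.
- apply: (@cvgL2_ext _ _ _ _ (fun=> fun=> f [tuple])); last exact: cvgL2_cst (L2_cst _ _).
  by move=> N omega; rewrite /step_integral one big_ord0 mulr1.
Qed.

Lemma multiple_wiener_L2 n (i : 'I_n -> 'I_m.+1) f : L2 (Q n) f -> L2 P (J i f).
Proof. by move=> fL; have [] := is_multiple_wiener_L2 (multiple_wienerP i fL). Qed.

(** Representatives are chosen, so linearity comes from uniqueness of the limit and holds almost
    surely. *)
Lemma multiple_wiener_comb n (i : 'I_n -> 'I_m.+1) a b f g : L2 (Q n) f -> L2 (Q n) g ->
  {ae P, forall omega, J i (fun x => a * f x + b * g x) omega = a * J i f omega + b * J i g omega}.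
Proof.
move=> fL gL; apply: is_multiple_wiener_unique; last first.
  by apply: is_multiple_wienerD; exact: multiple_wienerP.
by apply: multiple_wienerP; apply: L2D; exact: L2Z.
Qed.

Lemma multiple_wiener_sum n (i : 'I_n -> 'I_m.+1) (I : Type) (r : seq I) (S : pred I)
    (a : I -> R) (f : I -> n.-tuple (measurableTypeR R) -> R) :
  (forall j, L2 (Q n) (f j)) ->
  {ae P, forall omega, J i (fun x => \sum_(j <- r | S j) a j * f j x) omega =
     \sum_(j <- r | S j) a j * J i (f j) omega}.
Proof.
move=> fL; elim: r => [|j r IH].
  have := multiple_wiener_comb i 0 0 (L2_0 (Q n)) (L2_0 (Q n)).
  apply: filterS => omega; rewrite big_nil.
  rewrite (_ : (fun x => _) = (fun x => \sum_(j <- [::] | S j) a j * f j x)); last first.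
    by apply/funext => x; rewrite big_nil mul0r addr0.
  by move=> ->; rewrite !mul0r addr0.
case: (boolP (S j)) => Sj; last first.
  apply: filterS IH => omega; rewrite big_cons (negbTE Sj) => <-.
  by congr (J i _ omega); apply/funext => x; rewrite big_cons (negbTE Sj).
have sL : L2 (Q n) (fun x => \sum_(j <- r | S j) a j * f j x).
  by apply: L2_sum => j' _; exact: L2Z.
apply: filterS2 IH (multiple_wiener_comb i (a j) 1 (fL j) sL) => omega IH.
rewrite big_cons Sj mul1r -IH => <-.
by congr (J i _ omega); apply/funext => x; rewrite big_cons Sj mul1r.
Qed.

Lemma cvgL2_multiple_wiener n (i : 'I_n -> 'I_m.+1) u f : cvgL2 (Q n) u f ->
  cvgL2 P (fun p => J i (u p)) (J i f).
Proof.
move=> /cvgL2P[uL fL uf]; apply/cvgL2P; split => [p||].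
- exact: multiple_wiener_L2.
- exact: multiple_wiener_L2.
apply: (@squeeze_cvg0 _ _ (fun p => 4 * Cn n * sqnorm (Q n) (fun x => u p x - f x))).
  move=> p; rewrite sqnorm_ge0/=.
  by apply: is_multiple_wiener_dist; exact: multiple_wienerP.
by rewrite -[X in _ --> X](mulr0 (4 * Cn n)); exact: cvgMr.
Qed.

(** The chosen value of J' comes with an approximating sequence of its own; this frees the choice,
    so that grid sums may be used. *)
Lemma cvgL2_multiple_wiener_step n (i : 'I_n -> 'I_m.+1) s f : (forall N, is_step t T (s N)) ->
  cvgL2 (Q n) (fun N => step_fun (s N)) f ->
  cvgL2 P (fun N => step_integral w i (s N)) (J i f).
Proof.
move=> hs sf; have /cvgL2P[sL fL s0] := sf.
have iso N := step_isometry ht htT hF hw i (hs N).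
have isI N : is_integral i (step_fun (s N)) (step_integral w i (s N)).
  exists (fun=> s N); split => //; apply: cvgL2_cst => //; by have [] := iso N.
apply/cvgL2P; split => [N||]; first by have [] := iso N.
  exact: multiple_wiener_L2.
apply: (@squeeze_cvg0 _ _ (fun p => 4 * Cn n * sqnorm (Q n) (fun x => step_fun (s p) x - f x))).
  move=> p; rewrite sqnorm_ge0/=.
  by apply: is_multiple_wiener_dist (isI p) _; exact: multiple_wienerP.
by rewrite -[X in _ --> X](mulr0 (4 * Cn n)); exact: cvgMr.
Qed.

End WienerIntegral.

Section InnerProductLimits.
Context d (E : measurableType d) (R : realType).
Variable mu : {finite_measure set E -> \bar R}.
Implicit Types (f g : E -> R) (u v : nat -> E -> R).

Lemma sqr_cvg (a : nat -> R) (l : R) : (a p - l) ^+ 2 @[p --> \oo] --> 0 ->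
  a p @[p --> \oo] --> l.
Proof.
move=> h; apply/cvgrPdist_lt => e e0; have [N NP] := cvg0_eventually h (exprn_gt0 2 e0).
exists N => // p /NP /= hp.
by move: hp; rewrite distrC -(ltr_sqrt _ (exprn_gt0 2 e0)) !sqrtr_sqr (gtr0_norm e0).
Qed.

Lemma RintegralM_sub f g h : L2 mu f -> L2 mu g -> L2 mu h ->
  \int[mu]_x ((f x - g x) * h x) = \int[mu]_x (f x * h x) - \int[mu]_x (g x * h x).
Proof.
move=> fL gL hL; rewrite -RintegralB//; [|exact: L2M_integrable..].
by apply: eq_Rintegral => x _; rewrite mulrBl.
Qed.

Lemma cvg_inner u v f g : cvgL2 mu u f -> cvgL2 mu v g ->
  \int[mu]_x (u p x * v p x) @[p --> \oo] --> \int[mu]_x (f x * g x).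
Proof.
move=> /cvgL2P[uL fL uf] /cvgL2P[vL gL vg]; apply: sqr_cvg.
apply: (@squeeze_cvg0 _ _ (fun p =>
  2 * (sqnorm mu (fun x => u p x - f x) *
       (2 * sqnorm mu (fun x => v p x - g x) + 2 * sqnorm mu g)) +
  2 * (sqnorm mu (fun x => v p x - g x) * sqnorm mu f))); last first.
  rewrite -[X in _ --> X](_ : 2 * (0 * (2 * 0 + 2 * sqnorm mu g)) + 2 * (0 * sqnorm mu f) = 0);
    last by ring.
  apply: cvgD; apply: cvgMr; apply: cvgM => //; last exact: cvg_cst.
  by apply: cvgD; [exact: cvgMr|exact: cvg_cst].
move=> p; rewrite sqr_ge0/=.
have e1 := RintegralM_sub (uL p) fL (vL p).
have e2 := RintegralM_sub (vL p) gL fL.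
have c1 := Cauchy_Schwarz (L2B (uL p) fL) (vL p).
have c2 := Cauchy_Schwarz (L2B (vL p) gL) fL.
have vb : sqnorm mu (v p) <= 2 * sqnorm mu (fun x => v p x - g x) + 2 * sqnorm mu g.
  have h x : v p x = (v p x - g x) + g x by rewrite subrK.
  by rewrite (eq_sqnorm _ h); exact: sqnormD_le (L2B (vL p) gL) gL.
rewrite e1 in c1; rewrite e2 in c2.
have s1 : \int[mu]_x (v p x * f x) = \int[mu]_x (f x * v p x).
  by apply: eq_Rintegral => x _; rewrite mulrC.
have s2 : \int[mu]_x (g x * f x) = \int[mu]_x (f x * g x).
  by apply: eq_Rintegral => x _; rewrite mulrC.
rewrite s1 s2 in c2.
have n0 := sqnorm_ge0 mu (fun x => u p x - f x).
have c1' := le_trans c1 (ler_wpM2l n0 vb).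
have aux (a b c x y : R) : (a - b) ^+ 2 <= x -> (b - c) ^+ 2 <= y ->
    (a - c) ^+ 2 <= 2 * x + 2 * y.
  move=> h1 h2; have := sqr_ge0 ((a - b) - (b - c)).
  have -> : (a - b - (b - c)) ^+ 2 = 2 * (a - b) ^+ 2 + 2 * (b - c) ^+ 2 - (a - c) ^+ 2 by ring.
  lra.
exact: aux c1' c2.
Qed.

Lemma cvgL2_scale (a : nat -> R) (l : R) u f : a p @[p --> \oo] --> l -> cvgL2 mu u f ->
  cvgL2 mu (fun p x => a p * u p x) (fun x => l * f x).
Proof.
move=> al /cvgL2P[uL fL uf]; apply/cvgL2P; split => [p||]; [exact: L2Z..|].
apply: (@squeeze_cvg0 _ _ (fun p => 2 * (a p ^+ 2 * sqnorm mu (fun x => u p x - f x)) +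
   2 * ((a p - l) ^+ 2 * sqnorm mu f))); last first.
  rewrite -[X in _ --> X](_ : 2 * (l ^+ 2 * 0) + 2 * ((l - l) ^+ 2 * sqnorm mu f) = 0); last by ring.
  have sq (b : nat -> R) (c : R) : b p @[p --> \oo] --> c -> b p ^+ 2 @[p --> \oo] --> c ^+ 2.
    by move=> bc; exact: (cvgM bc bc).
  apply: cvgD; apply: cvgMr; apply: cvgM => //.
  - exact: sq.
  - by apply: sq; apply: cvgB => //; exact: cvg_cst.
  - exact: cvg_cst.
move=> p; rewrite sqnorm_ge0/= -!sqnormZ//; last exact: L2B.
have h x : a p * u p x - l * f x = a p * (u p x - f x) + (a p - l) * f x by ring.
by rewrite (eq_sqnorm _ h); apply: sqnormD_le; [apply: L2Z; exact: L2B|exact: L2Z].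
Qed.

End InnerProductLimits.

Section LeftApproxSequences.
Context (R : realType) (t T : R).
Hypothesis htT : t < T.
Local Notation mu1 := (interval_measure t T).
Implicit Types f g : R -> R.

Lemma left_stepD N a f g x :
  left_step t T N (fun y => a * f y + g y) x = a * left_step t T N f x + left_step t T N g x.
Proof. by case: (left_stepP htT N x) => [[c h]|h]; rewrite !h ?mulr0 ?addr0. Qed.

Lemma left_approxD a f g : left_approx t T f -> left_approx t T g ->
  left_approx t T (fun x => a * f x + g x).
Proof.
move=> [mf [M M0 fM] fa] [mg [K K0 gK] ga]; split.
- by apply: measurable_funD => //; exact: measurable_funM.
- exists (`|a| * M + K) => [|x]; first by rewrite addr_ge0// mulr_ge0.
  rewrite (le_trans (ler_normD _ _))// lerD//.
  by rewrite normrM ler_wpM2l.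
- by apply: cvgL2_ext (cvgL2D (cvgL2Z a fa) ga) => N x; rewrite left_stepD.
Qed.

Lemma left_approx_sequence f : L2 mu1 f ->
  exists2 u : nat -> R -> R, (forall p, left_approx t T (u p)) & cvgL2 mu1 u f.
Proof.
move=> fL; pose DL := @left_approx_L2 R t T.
suff : L2_closure mu1 (left_approx t T) f.
  exact: (@L2_closure_sequence _ (measurableTypeR R) R mu1 (left_approx t T) DL f).
have [_] := left_approx_dense htT; apply => //.
- apply: (@L2_closure_closed_linear _ (measurableTypeR R) R mu1 _ DL) => a g h.
  exact: left_approxD.
- by move=> g; exact: (@sub_L2_closure _ (measurableTypeR R) R mu1 _ DL).
Qed.

Lemma left_step_integral N f :
  \int[mu1]_x left_step t T N f x = \sum_(c < N.+1) f (grid t T N c) * grid_mesh t T N.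
Proof.
have ci (c : 'I_N.+1) : true -> mu1.-integrable setT
    (EFin \o (fun x => f (grid t T N c) * cell_indic (grid t T N) c x)).
  by move=> _; apply: L2_integrable; apply: L2Z; exact: cell_indic_L2.
rewrite /left_step (Rintegral_sum (index_enum 'I_N.+1) ci).2; apply: eq_bigr => c _.
have iL := cell_indic_L2 t T (grid t T N) c.
rewrite RintegralZl//; last exact: L2_integrable.
congr (_ * _); rewrite -(mesh_grid t T c).
rewrite -(@cell_sqnorm _ t T _ _ (grid0 t T N) (gridN t T N) (@grid_lt _ _ _ htT N) c).
by apply: eq_Rintegral => x _; rewrite cell_indicE -natrX; case: (_ && _).
Qed.

End LeftApproxSequences.

(** * The product formula *)

(** The extra cell [e] either avoids all entries of [c], and inserting it at [l0] gives an injective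
    multi-index, or equals exactly one entry, by injectivity. *)
Lemma injective_sum_mul (R : comPzRingType) n N (l0 : 'I_n.+1) (x : 'I_n.+1 -> 'I_N -> R) :
  (\sum_e x l0 e) *
  (\sum_(c : {ffun 'I_n -> 'I_N} | injectiveb c) \prod_l x (lift l0 l) (c l)) =
  \sum_(c : {ffun 'I_n.+1 -> 'I_N} | injectiveb c) \prod_l x l (c l) +
  \sum_(l < n) \sum_(c : {ffun 'I_n -> 'I_N} | injectiveb c)
    x l0 (c l) * \prod_j x (lift l0 j) (c j).
Proof.
have insE e (c : {ffun 'I_n -> 'I_N}) : \prod_l x l (insert l0 e c l) =
    x l0 e * \prod_j x (lift l0 j) (c j).
  rewrite (bigD1_ord l0)//= insert_at; congr (_ * _).
  by apply: eq_bigr => j _; rewrite insert_lift.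
have -> : \sum_(c : {ffun 'I_n.+1 -> 'I_N} | injectiveb c) \prod_l x l (c l) =
    \sum_(c : {ffun 'I_n -> 'I_N} | injectiveb c) \sum_(e | [forall i, c i != e])
      x l0 e * \prod_j x (lift l0 j) (c j).
  rewrite (reindex_insert l0) (exchange_big_dep (fun c : {ffun 'I_n -> 'I_N} => injectiveb c))/=.
    apply: eq_bigr => c ic; apply: eq_big => [e|e _]; last exact: insE.
    by rewrite injective_insert ic.
  by move=> e c _; rewrite injective_insert => /andP[].
rewrite exchange_big -big_split mulr_sumr; apply: eq_bigr => c /injectiveP ic /=.
rewrite mulr_suml (bigID (fun e => [forall i, c i != e]))/=; congr (_ + _).
rewrite -(big_imset (h := c) (A := 'I_n) (fun e => x l0 e * \prod_j x (lift l0 j) (c j)))/=.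
  apply: eq_bigl => e; rewrite negb_forall; apply/existsP/imsetP.
    by move=> [i]; rewrite negbK => /eqP <-; exists i.
  by move=> [i _ ->]; exists i; rewrite negbK.
by move=> i j _ _; exact: ic.
Qed.

(** * Products of sums over a uniform grid *)

Section GridProducts.
Context d (Omega : measurableType d) (R : realType).
Variables (P : probability Omega R) (t T : R).
Hypotheses (ht : 0 <= t) (htT : t < T).
Variables (F : R -> set (set Omega)) (m : nat) (w : 'I_m -> R -> Omega -> R).
Hypotheses (hF : is_filtration T F) (hw : is_wiener P T F w).
Local Notation J := (multiple_wiener P t T w).
Local Notation gr := (grid t T).
Local Notation dw N := (@time_increment _ _ _ _ w N.+1 (gr N)).
Local Notation cov i j := ((i == j) && (i != ord0))%:R.

Definition grid_sum n (i : 'I_n -> 'I_m.+1) (f : 'I_n -> R -> R) N (omega : Omega) : R :=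
  \sum_(c : {ffun 'I_n -> 'I_N.+1} | injectiveb c)
    \prod_l (f l (gr N (c l)) * dw N (i l) (c l) omega).

Lemma grid_sum_cvg n (i : 'I_n -> 'I_m.+1) f : (forall l, left_approx t T (f l)) ->
  cvgL2 P (grid_sum i f) (J i (tensor f)).
Proof.
move=> fD.
have := cvgL2_multiple_wiener_step ht htT hF hw i (fun N => grid_step_is_step htT N f)
  (cvgL2_grid_step htT fD).
apply: cvgL2_ext => N omega; rewrite step_integralE /gstep /grid_sum [RHS]big_mkcond.
apply: eq_bigr => c _; rewrite (coef_fun_step_of _ _ c); case: ifP => _; last by rewrite mul0r.
by rewrite big_split.
Qed.

Lemma grid_sum1 (i : 'I_m.+1) (f : R -> R) N omega :
  grid_sum (fun _ : 'I_1 => i) (fun=> f) N omega =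
  \sum_(e < N.+1) f (gr N e) * dw N i e omega.
Proof.
rewrite /grid_sum (reindex (fun e : 'I_N.+1 => [ffun _ : 'I_1 => e])); last first.
  exists (fun c : {ffun 'I_1 -> 'I_N.+1} => c ord0) => [e _|c _]; first by rewrite ffunE.
  by apply/ffunP => l; rewrite ffunE (ord1 l).
apply: eq_big => [e|e _]; last by rewrite big_ord1 ffunE.
by apply/injectiveP => a b _; rewrite (ord1 a) (ord1 b).
Qed.

(* What remains of the diagonal terms c_l = c_{l0} once the quadratic covariation of
   the two integrators has been replaced by its mean. *)
Definition covariation_sum n (i : 'I_n.+1 -> 'I_m.+1) (f : 'I_n.+1 -> R -> R) (l0 : 'I_n.+1) (l : 'I_n)
    N (omega : Omega) : R :=
  \sum_(c : {ffun 'I_n -> 'I_N.+1} | injectiveb c)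
    (\prod_j (if j == l then f l0 (gr N (c j)) * f (lift l0 j) (gr N (c j))
              else f (lift l0 j) (gr N (c j)))) *
    \prod_j (if j == l then covariation_noise w (gr N) (i l0) (i (lift l0 j)) (c j) omega
             else dw N (i (lift l0 j)) (c j) omega).

(** Replacing two increments by the mean of their product leaves the cell length: the merged
    variable at [l] runs against time, index [ord0]. The contracted integral thus keeps [n]
    variables until [time_factor] splits this one off. *)
Definition contract_index n (i : 'I_n.+1 -> 'I_m.+1) (l0 : 'I_n.+1) (l j : 'I_n) : 'I_m.+1 :=
  if j == l then ord0 else i (lift l0 j).

Definition contract_fun n (f : 'I_n.+1 -> R -> R) (l0 : 'I_n.+1) (l j : 'I_n) : R -> R :=
  if j == l then fun x => f l0 x * f (lift l0 j) x else f (lift l0 j).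

(** Pathwise algebra: in a diagonal cell the product of the two increments is [covariation_noise]
    plus the index indicator times the cell length, and the latter is the increment of time. *)
Lemma grid_sum_mul n (i : 'I_n.+1 -> 'I_m.+1) (f : 'I_n.+1 -> R -> R) (l0 : 'I_n.+1) N omega :
  grid_sum (fun _ : 'I_1 => i l0) (fun=> f l0) N omega *
  grid_sum (fun l => i (lift l0 l)) (fun l => f (lift l0 l)) N omega =
  grid_sum i f N omega + \sum_(l < n) (covariation_sum i f l0 l N omega +
    cov (i l0) (i (lift l0 l)) *
    grid_sum (contract_index i l0 l) (contract_fun f l0 l) N omega).
Proof.
rewrite grid_sum1 (injective_sum_mul l0 (fun l e => f l (gr N e) * dw N (i l) e omega)).
congr (_ + _); apply: eq_bigr => l _.
rewrite /covariation_sum /grid_sum mulr_sumr -big_split; apply: eq_bigr => c _ /=.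
pose G j := f (lift l0 j) (gr N (c j)); pose D j := dw N (i (lift l0 j)) (c j) omega.
have rest (H K : 'I_n -> R) : \prod_j (if j == l then H j else K j) =
    H l * \prod_(j | j != l) K j.
  by rewrite (bigD1 l)// eqxx; congr (_ * _); apply: eq_bigr => j /negbTE ->.
have -> : \prod_(j < n) (contract_fun f l0 l j (gr N (c j)) *
      dw N (contract_index i l0 l j) (c j) omega) =
    \prod_j (if j == l then f l0 (gr N (c j)) * G j * dw N ord0 (c j) omega else G j * D j).
  by apply: eq_bigr => j _; rewrite /contract_fun /contract_index; case: (j == l).
have -> : \prod_(j < n) (f (lift l0 j) (gr N (c j)) * dw N (i (lift l0 j)) (c j) omega) =
    G l * D l * \prod_(j | j != l) (G j * D j) by rewrite (bigD1 l).
rewrite !rest big_split/= /covariation_noise -/(G l) -/(D l).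
have -> : dw N ord0 (c l) omega = mesh (gr N) (c l) by rewrite /time_increment /with_time unlift_none.
move: (\prod_(j | j != l) G j) (\prod_(j | j != l) D j) => p1 p2.
rewrite /D; ring.
Qed.

(** In [step_bound] the coefficients are uniformly bounded, one noise constant is of the order of
    the mesh, and the others stay fixed. *)
Lemma covariation_sum_cvg0 n (i : 'I_n.+1 -> 'I_m.+1) (f : 'I_n.+1 -> R -> R) (l0 : 'I_n.+1) (l : 'I_n) :
  (forall j, left_approx t T (f j)) -> cvgL2 P (covariation_sum i f l0 l) (fun=> 0).
Proof.
move=> fD; have T0 : 0 <= T by rewrite (le_trans ht)// ltW.
have /choice[M MP] j : exists M, 0 <= M /\ forall x, `|f j x| <= M.
  by have [_ [M M0 fM] _] := fD j; exists M.
pose K N (j : 'I_n) := if j == l then 3 * grid_mesh t T N + grid_mesh t T N ^+ 2 * (1 + T) else 1 + T.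
pose A N (c : {ffun 'I_n -> 'I_N.+1}) :=
  \prod_j (if j == l then f l0 (gr N (c j)) * f (lift l0 j) (gr N (c j))
              else f (lift l0 j) (gr N (c j))).
pose xi N (j : 'I_n) (c : 'I_N.+1) (omega : Omega) :=
  if j == l then covariation_noise w (gr N) (i l0) (i (lift l0 j)) c omega
  else dw N (i (lift l0 j)) c omega.
have g00 N : 0 <= gr N 0%N by rewrite grid0.
have gNT N : gr N N.+1 <= T by rewrite gridN.
have noise N j : is_noise P F (gr N) (K N j) (xi N j).
  rewrite /K /xi; case: (j == l).
    apply: (covariation_is_noise ht htT hF hw (grid0 t T N) (gridN t T N) (@grid_lt _ _ _ htT N)).
    by move=> c; exact: mesh_grid.
  exact: (time_increment_noise ht htT hF hw (grid0 t T N) (gridN t T N) (@grid_lt _ _ _ htT N)).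
have bound N := step_bound hF (g00 N) (gNT N) (@grid_lt _ _ _ htT N) (A N) (noise N).
pose C := \prod_j (if j == l then M l0 * M (lift l0 j) else M (lift l0 j)).
have C0 : 0 <= C.
  apply: prodr_ge0 => j _; case: (j == l); last by have [] := MP (lift l0 j).
  by rewrite mulr_ge0//; [have [] := MP l0|have [] := MP (lift l0 j)].
have AC N c : A N c ^+ 2 <= C ^+ 2.
  rewrite -[leLHS]real_normK ?num_real// lerXn2r ?nnegrE//.
  rewrite /A normr_prod; apply: ler_prod => j _; rewrite normr_ge0/=.
  have [_ h1] := MP l0; have [_ h2] := MP (lift l0 j).
  by case: (j == l) => //; rewrite normrM ler_pM.
pose D := \prod_(j < n | j != l) (1 + T).
have D0 : 0 <= D by apply: prodr_ge0 => j _; rewrite addr_ge0.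
have KE N : \prod_j K N j = (3 * grid_mesh t T N + grid_mesh t T N ^+ 2 * (1 + T)) * D.
  by rewrite (bigD1 l)//= /K eqxx; congr (_ * _); apply: eq_bigr => j /negbTE ->.
have SA N : \sum_(c : {ffun 'I_n -> 'I_N.+1} | injectiveb c) A N c ^+ 2 * \prod_j mesh (gr N) (c j) <=
    C ^+ 2 * T ^+ n.
  have m0 (c : {ffun 'I_n -> 'I_N.+1}) : 0 <= \prod_j mesh (gr N) (c j).
    by apply: prodr_ge0 => j _; rewrite mesh_grid ltW// grid_mesh_gt0.
  apply: (@le_trans _ _ (\sum_(c : {ffun 'I_n -> 'I_N.+1}) C ^+ 2 * \prod_j mesh (gr N) (c j))).
    rewrite big_mkcond; apply: ler_sum => c _; case: ifP => _.
      by rewrite ler_wpM2r.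
    by rewrite mulr_ge0// sqr_ge0.
  rewrite -mulr_sumr ler_wpM2l ?sqr_ge0// -(bigA_distr_bigA (fun _ e => mesh (gr N) e)).
  rewrite prodr_const card_ord lerXn2r ?nnegrE//.
    by apply: sumr_ge0 => e _; rewrite mesh_grid ltW// grid_mesh_gt0.
  exact: (sum_mesh_le (g00 N) (gNT N)).
have sumE N omega : covariation_sum i f l0 l N omega =
  \sum_(c : {ffun 'I_n -> 'I_N.+1} | injectiveb c) A N c * \prod_j xi N j (c j) omega by [].
apply/cvgL2P; split => [N||]; [by have [] := bound N|exact: L2_0|].
apply: (@squeeze_cvg0 _ _ (fun N => n`!%:R *
  ((3 * grid_mesh t T N + grid_mesh t T N ^+ 2 * (1 + T)) * D) * (C ^+ 2 * T ^+ n))).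
  move=> N; rewrite sqnorm_ge0/=.
  have E omega : covariation_sum i f l0 l N omega - 0 = covariation_sum i f l0 l N omega by rewrite subr0.
  rewrite (eq_sqnorm _ E) -KE; have [_ b] := bound N; apply: le_trans b _.
  apply: ler_wpM2l (SA N); rewrite mulr_ge0//; apply: prodr_ge0 => j _.
  by have [] := noise N j.
have h0 := grid_mesh_cvg0 t T.
rewrite -[X in _ --> X](_ : n`!%:R * ((3 * 0 + 0 * 0 * (1 + T)) * D) * (C ^+ 2 * T ^+ n) = 0); last by ring.
apply: cvgM; last exact: cvg_cst.
apply: cvgMr; apply: cvgM; last exact: cvg_cst.
by apply: cvgD; [exact: cvgMr|apply: cvgM; [exact: cvgM|exact: cvg_cst]].
Qed.

End GridProducts.

Section ProductFormula.
Context d (Omega : measurableType d) (R : realType).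
Variables (P : probability Omega R) (t T : R).
Hypotheses (ht : 0 <= t) (htT : t < T).
Variables (F : R -> set (set Omega)) (m : nat) (w : 'I_m -> R -> Omega -> R).
Hypotheses (hF : is_filtration T F) (hw : is_wiener P T F w).
Local Notation mu1 := (interval_measure t T).
Local Notation J := (multiple_wiener P t T w).
Local Notation cov i j := ((i == j) && (i != ord0))%:R.
Implicit Types f g : R -> R.

(** A form uniform in the index, as the product formula requires; [single_integral] treats time
    apart, and [single_integralE] reconciles the two. *)
Definition line_integral (i : 'I_m.+1) (f : R -> R) : Omega -> R :=
  J (fun _ : 'I_1 => i) (tensor (fun=> f)).

Lemma cvgL2_tensor_integral n (i : 'I_n -> 'I_m.+1) u (f : 'I_n -> R -> R) :
  (forall l, cvgL2 mu1 (u l) (f l)) ->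
  cvgL2 P (fun p => J i (tensor (fun l => u l p))) (J i (tensor f)).
Proof.
by move=> uf; apply: (cvgL2_multiple_wiener ht htT hF hw); exact: cvgL2_tensor.
Qed.

Lemma tensor_integral_L2 n (i : 'I_n -> 'I_m.+1) (f : 'I_n -> R -> R) :
  (forall l, L2 mu1 (f l)) -> L2 P (J i (tensor f)).
Proof.
move=> fL; apply: (multiple_wiener_L2 ht htT hF hw).
exact: (tensor_L2 fL).1.
Qed.

Lemma contract_fun_left_approx n (f : 'I_n.+1 -> R -> R) (l0 : 'I_n.+1) (l : 'I_n) :
  (forall j, left_approx t T (f j)) -> forall j, left_approx t T (contract_fun f l0 l j).
Proof.
by move=> fD j; rewrite /contract_fun; case: (j == l) => //; exact: left_approxM.
Qed.

(** The identity [grid_sum_mul] passes to the limit through [cvgL2_mul_unique], the covariation sums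
    disappearing. *)
Lemma product_formula_grid n (i : 'I_n.+1 -> 'I_m.+1) (f : 'I_n.+1 -> R -> R) (l0 : 'I_n.+1) :
  (forall l, left_approx t T (f l)) ->
  {ae P, forall omega, line_integral (i l0) (f l0) omega *
    J (fun l => i (lift l0 l)) (tensor (fun l => f (lift l0 l))) omega =
    J i (tensor f) omega + \sum_(l < n) cov (i l0) (i (lift l0 l)) *
      J (contract_index i l0 l) (tensor (contract_fun f l0 l)) omega}.
Proof.
move=> fD.
apply: (cvgL2_mul_unique
  (u := grid_sum t T w (fun _ : 'I_1 => i l0) (fun=> f l0))
  (v := grid_sum t T w (fun l => i (lift l0 l)) (fun l => f (lift l0 l)))
  (w := fun N omega => grid_sum t T w i f N omega +
     \sum_(l < n) (covariation_sum t T w i f l0 l N omega +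
    cov (i l0) (i (lift l0 l)) *
    grid_sum t T w (contract_index i l0 l) (contract_fun f l0 l) N omega))).
- by apply: (grid_sum_cvg ht htT hF hw).
- by apply: (grid_sum_cvg ht htT hF hw).
- apply: cvgL2D; first exact: (grid_sum_cvg ht htT hF hw).
  apply: cvgL2_sum => l _.
  rewrite (_ : (fun x => _) = (fun x => 0 + cov (i l0) (i (lift l0 l)) *
     J (contract_index i l0 l) (tensor (contract_fun f l0 l)) x)); last first.
    by apply/funext => x; rewrite add0r.
  apply: cvgL2D; first exact: (covariation_sum_cvg0 ht htT hF hw).
  apply: cvgL2Z; apply: (grid_sum_cvg ht htT hF hw).
  exact: contract_fun_left_approx.
- by move=> N; apply: aeW => omega; exact: grid_sum_mul.
Qed.

Lemma Rintegral_mul1 f : \int[mu1]_x (f x * 1) = \int[mu1]_x f x.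
Proof. by apply: eq_Rintegral => x _; rewrite mulr1. Qed.

Lemma cvg_integral (u : nat -> R -> R) f : cvgL2 mu1 u f ->
  \int[mu1]_x u p x @[p --> \oo] --> \int[mu1]_x f x.
Proof.
move=> uf; have := cvg_inner uf (cvgL2_cst (L2_cst mu1 1)).
by rewrite Rintegral_mul1; under eq_fun do rewrite Rintegral_mul1.
Qed.

Lemma cvgL2_real (a : nat -> R) (l : R) : a p @[p --> \oo] --> l ->
  cvgL2 P (fun p _ => a p) (fun=> l).
Proof.
move=> al; have := cvgL2_scale al (cvgL2_cst (L2_cst P 1)).
rewrite (_ : (fun x => l * 1) = fun=> l); last by apply/funext => x; rewrite mulr1.
by apply: cvgL2_ext => p x; rewrite mulr1.
Qed.

(** For a [left_approx] function the grid sums against time are the integrals of [left_step];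
    continuity in L_2 extends the limit. *)
Lemma line_integral_time f : L2 mu1 f ->
  {ae P, forall omega, line_integral ord0 f omega = \int[mu1]_x f x}.
Proof.
have left g : left_approx t T g -> {ae P, forall omega, line_integral ord0 g omega = \int[mu1]_x g x}.
  move=> gD; have [_ _ gc] := gD.
  apply: (cvgL2_unique (u := grid_sum t T w (fun _ : 'I_1 => ord0) (fun=> g))).
    exact: (grid_sum_cvg ht htT hF hw).
  apply: cvgL2_ext (cvgL2_real (cvg_integral gc)) => N omega.
  rewrite left_step_integral// grid_sum1; apply: eq_bigr => e _; congr (_ * _).
  by rewrite /time_increment /with_time unlift_none -(mesh_grid t T e).
move=> fL; have [u uD uf] := left_approx_sequence htT fL.
apply: (cvgL2_unique (u := fun p => line_integral ord0 (u p))).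
  by apply: (@cvgL2_tensor_integral 1 _ (fun _ => u)).
apply: cvgL2_ae_seq (cvgL2_real (cvg_integral uf)) => p.
  by apply: L2_measurable; apply: tensor_integral_L2 => _; exact: left_approx_L2.
by apply: filterS (left _ (uD p)) => omega ->.
Qed.

(** The product formula at a time position: all covariation terms vanish there, so the variable
    splits off. *)
Lemma time_factor n (i : 'I_n.+1 -> 'I_m.+1) (f : 'I_n.+1 -> R -> R) (l0 : 'I_n.+1) :
  (forall l, left_approx t T (f l)) -> i l0 = ord0 ->
  {ae P, forall omega, J i (tensor f) omega = (\int[mu1]_x f l0 x) *
    J (fun l => i (lift l0 l)) (tensor (fun l => f (lift l0 l))) omega}.
Proof.
move=> fD il0; have f0L := left_approx_L2 (fD l0).
apply: filterS2 (product_formula_grid i l0 fD) (line_integral_time f0L) => omega.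
rewrite il0 => h e; rewrite e in h; rewrite h big1 ?addr0// => l _.
by rewrite eqxx andbF mul0r.
Qed.

(** Applied at the merged position, [time_factor] turns each contracted integral into an inner
    product times an integral in the variables other than [l0] and the contracted one. *)
Lemma product_formula_left n (i : 'I_n.+1 -> 'I_m.+1) (f : 'I_n.+1 -> R -> R) (l0 : 'I_n.+1) :
  (forall l, left_approx t T (f l)) ->
  {ae P, forall omega, line_integral (i l0) (f l0) omega *
    J (fun l => i (lift l0 l)) (tensor (fun l => f (lift l0 l))) omega =
    J i (tensor f) omega + \sum_(l < n) cov (i l0) (i (lift l0 l)) *
      ((\int[mu1]_x (f l0 x * f (lift l0 l) x)) *
       J (fun j => i (lift l0 (lift l j))) (tensor (fun j => f (lift l0 (lift l j)))) omega)}.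
Proof.
case: n i f l0 => [|n] i f l0 fD.
  by apply: filterS (product_formula_grid i l0 fD) => omega ->; rewrite !big_ord0.
have contr (l : 'I_n.+1) : {ae P, forall omega,
    J (contract_index i l0 l) (tensor (contract_fun f l0 l)) omega =
    (\int[mu1]_x (f l0 x * f (lift l0 l) x)) *
       J (fun j => i (lift l0 (lift l j))) (tensor (fun j => f (lift l0 (lift l j)))) omega}.
  have := @time_factor n (contract_index i l0 l) (contract_fun f l0 l) l
    (contract_fun_left_approx l0 l fD); rewrite /contract_index eqxx => /(_ erefl).
  apply: filterS => omega ->; congr (_ * _).
    by rewrite /contract_fun eqxx.
  have E j : (lift l j == l) = false by rewrite eq_sym (negbTE (neq_lift _ _)).
  congr (J _ (tensor _) omega); apply/funext => j; first by rewrite E.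
  by rewrite /contract_fun E.
have {}contr : {ae P, forall omega, forall l : 'I_n.+1,
    J (contract_index i l0 l) (tensor (contract_fun f l0 l)) omega =
    (\int[mu1]_x (f l0 x * f (lift l0 l) x)) *
       J (fun j => i (lift l0 (lift l j))) (tensor (fun j => f (lift l0 (lift l j)))) omega}.
  exact: filter_forall.
apply: filterS2 (product_formula_grid i l0 fD) contr => omega -> H.
by congr (_ + _); apply: eq_bigr => l _; rewrite H.
Qed.

(** Now the product of two factors occurs only inside an inner product, so the right side depends
    continuously on the factors in L_2. In [product_formula_grid] that product is itself an
    integrand, which L_2 factors would not allow. *)
Lemma product_formula n (i : 'I_n.+1 -> 'I_m.+1) (f : 'I_n.+1 -> R -> R) (l0 : 'I_n.+1) :
  (forall l, L2 mu1 (f l)) ->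
  {ae P, forall omega, line_integral (i l0) (f l0) omega *
    J (fun l => i (lift l0 l)) (tensor (fun l => f (lift l0 l))) omega =
    J i (tensor f) omega + \sum_(l < n) cov (i l0) (i (lift l0 l)) *
      ((\int[mu1]_x (f l0 x * f (lift l0 l) x)) *
       J (fun j => i (lift l0 (lift l j))) (tensor (fun j => f (lift l0 (lift l j)))) omega)}.
Proof.
move=> fL.
have /choice[u uP] l : exists u : nat -> R -> R, (forall p, left_approx t T (u p)) /\ cvgL2 mu1 u (f l).
  by have [u] := left_approx_sequence htT (fL l); exists u.
have uD l p := (uP l).1 p; have uf l := (uP l).2.
apply: (cvgL2_mul_unique
  (u := fun p => line_integral (i l0) (u l0 p))
  (v := fun p => J (fun l => i (lift l0 l)) (tensor (fun l => u (lift l0 l) p)))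
  (w := fun p omega => J i (tensor (fun l => u l p)) omega +
     \sum_(l < n) cov (i l0) (i (lift l0 l)) *
      ((\int[mu1]_x (u l0 p x * u (lift l0 l) p x)) *
       J (fun j => i (lift l0 (lift l j))) (tensor (fun j => u (lift l0 (lift l j)) p)) omega))).
- by apply: (@cvgL2_tensor_integral 1 _ (fun _ => u l0)).
- by apply: (@cvgL2_tensor_integral _ _ (fun l => u (lift l0 l))).
- apply: cvgL2D; first exact: cvgL2_tensor_integral.
  apply: cvgL2_sum => l _; apply: cvgL2Z; apply: cvgL2_scale; first exact: cvg_inner.
  by apply: (@cvgL2_tensor_integral _ _ (fun j => u (lift l0 (lift l j)))).
- by move=> p; apply: (product_formula_left i l0 (f := fun l => u l p)).
Qed.

Lemma single_integralE i f : L2 mu1 f ->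
  {ae P, forall omega, single_integral P t T w i f omega = line_integral i f omega}.
Proof.
move=> fL; rewrite /single_integral; case: eqP => [->|_].
  by apply: filterS (line_integral_time fL) => omega ->.
apply: aeW => omega; rewrite /line_integral; congr (J _ _ omega).
by apply/funext => x; rewrite /tensor big_ord1.
Qed.

Lemma single_integral_L2 i f : L2 mu1 f -> L2 P (single_integral P t T w i f).
Proof.
move=> fL; apply: ae_L2 (tensor_integral_L2 (fun _ : 'I_1 => i) (fun=> fL)) _; last first.
  by apply: filterS (single_integralE i fL) => omega ->.
rewrite /single_integral; case: eqP => _; first exact: measurable_cst.
apply: L2_measurable; have := tensor_integral_L2 (fun _ : 'I_1 => i) (fun=> fL).
by congr (L2 P (J _ _)); apply/funext => x; rewrite /tensor big_ord1.
Qed.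

End ProductFormula.

(** The function behind [lift] is [bump]: deleting an element from an enumeration skips its
    position, which translates positions of variables into subsets. *)
Lemma nth_rem_bump (T : eqType) (x0 a : T) (s : seq T) l :
  nth x0 (rem a s) l = nth x0 s (bump (index a s) l).
Proof.
rewrite remE nth_cat size_take_min; have le := index_size a s.
rewrite (minn_idPl le) /bump; have [lt|ge] := ltnP l (index a s).
  by rewrite nth_take// leqNgt lt.
by rewrite nth_drop addSn subnKC// add1n.
Qed.

Lemma enum_setD1 (T : finType) (A : {set T}) a :
  enum (A :\ a)%SET = rem a (enum A).
Proof.
rewrite rem_filter ?enum_uniq// /enum_mem -filter_predI.
by apply: eq_filter => x /=; rewrite !inE.
Qed.

(** * Integrals whose variables are indexed by a finite set *)

Section SetIndexed.
Context d (Omega : measurableType d) (R : realType).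
Variables (P : probability Omega R) (t T : R).
Hypotheses (ht : 0 <= t) (htT : t < T).
Variables (F : R -> set (set Omega)) (m : nat) (w : 'I_m -> R -> Omega -> R).
Hypotheses (hF : is_filtration T F) (hw : is_wiener P T F w).
Local Notation mu1 := (interval_measure t T).
Local Notation J := (multiple_wiener P t T w).
Local Notation cov i j := ((i == j) && (i != ord0))%:R.

Lemma multiple_wiener_cast n n' (e : n = n') (i : 'I_n -> 'I_m.+1) (i' : 'I_n' -> 'I_m.+1)
    (f : n.-tuple (measurableTypeR R) -> R) (f' : n'.-tuple (measurableTypeR R) -> R) :
  (forall l, i l = i' (cast_ord e l)) -> (forall x, f x = f' (tcast e x)) -> J i f = J i' f'.
Proof.
case: n' / e i' f' => i' f' ii' ff'; congr (J _ _).
  by apply/funext => l; rewrite ii' cast_ord_id.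
by apply/funext => x; rewrite ff' tcast_id.
Qed.

Lemma tensor_integral_cast n n' (i : 'I_n -> 'I_m.+1) (i' : 'I_n' -> 'I_m.+1) f f' :
  n = n' -> (forall (l : 'I_n) (l' : 'I_n'), l = l' :> nat -> i l = i' l' /\ f l = f' l') ->
  J i (tensor f) = J i' (tensor f').
Proof.
move=> e; case: n' / e i' f' => i' f' h.
by congr (J _ (tensor _)); apply/funext => l; have [] := h l l erefl.
Qed.

Section Product.
Variables (I : finType) (i : I -> 'I_m.+1) (f : I -> R -> R).
Hypothesis fL : forall a, L2 mu1 (f a).

(** Variables are named by elements of [A] and not by positions, so that removing pairs in any order
    leads to the same integral. *)
Definition set_integral (A : {set I}) : Omega -> R :=
  J (fun l : 'I_#|A| => i (enum_val l)) (tensor (fun l : 'I_#|A| => f (enum_val l))).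

Lemma set_integral_enum n (A : {set I}) (s : 'I_n -> I) a0 : n = #|A| ->
  (forall l : 'I_n, s l = nth a0 (enum A) l) ->
  J (fun l => i (s l)) (tensor (fun l => f (s l))) = set_integral A.
Proof.
move=> e sE; apply: tensor_integral_cast => // l l' ll'.
by rewrite (enum_val_nth a0) sE ll'.
Qed.

(** This is [product_formula] with [l0] the position of [a] in the enumeration of [A]. *)
Lemma product_formula_set (A : {set I}) a : a \in A ->
  {ae P, forall omega,
    line_integral P t T w (i a) (f a) omega * set_integral (A :\ a) omega =
    set_integral A omega + \sum_(b in (A :\ a)%SET) cov (i a) (i b) *
      (\int[mu1]_x (f a x * f b x)) * set_integral (A :\ a :\ b) omega}.
Proof.
move=> aA; have cA : #|A| = #|(A :\ a)%SET|.+1 by rewrite (cardsD1 a) aA.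
have ia : (index a (enum A) < #|(A :\ a)%SET|.+1)%N by rewrite -cA cardE index_mem mem_enum.
pose l0 := Ordinal ia.
pose s (l : 'I_(#|(A :\ a)%SET|.+1)) := nth a (enum A) l.
have s0 : s l0 = a by rewrite /s nth_index// mem_enum.
have s1 l : s (lift l0 l) = nth a (enum (A :\ a)%SET) l.
  by rewrite enum_setD1 nth_rem_bump.
have s1' (l : 'I_#|(A :\ a)%SET|) : s (lift l0 l) = enum_val l by rewrite s1 -enum_val_nth.
have s2 (l : 'I_#|(A :\ a)%SET|) j : s (lift l0 (lift l j)) = nth a (enum (A :\ a :\ enum_val l)%SET) j.
  rewrite s1 [in RHS]enum_setD1 nth_rem_bump; congr nth; congr bump.
  by rewrite (enum_val_nth a) index_uniq ?enum_uniq// -cardE.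
have := product_formula ht htT hF hw (fun l => i (s l)) l0 (fun l => fL (s l)).
apply: filterS => omega; rewrite s0.
rewrite (set_integral_enum (A := (A :\ a)%SET) (s := fun l => s (lift l0 l)) (a0 := a))//.
rewrite (set_integral_enum (A := A) (s := s) (a0 := a))// => ->; congr (_ + _).
rewrite [RHS]big_enum_val; apply: eq_bigr => l _; rewrite s1' mulrA; congr (_ * _).
rewrite (set_integral_enum (A := (A :\ a :\ enum_val l)%SET) (s := fun j => s (lift l0 (lift l j))) (a0 := a))//.
by rewrite [X in X.-1](cardsD1 (enum_val l)) enum_valP.
Qed.

End Product.
End SetIndexed.

(** * Pairings *)

Section Matchings.
Variable I : finType.
Implicit Types (D : {set I}) (g : {set {set I}}).

(** Partial matchings, with any number of pairs including none; the ground set [D] is what the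
    induction over the factors runs on. *)
Definition matchings D : {set {set {set I}}} :=
  [set g | [&& finset.trivIset g, [forall B in g, #|B| == 2] & finset.cover g \subset D]]%SET.

Lemma matchingsP D g : reflect [/\ finset.trivIset g, forall B, B \in g -> #|B| = 2 &
  finset.cover g \subset D] (g \in matchings D).
Proof.
rewrite inE; apply: (iffP and3P) => [[h1 /forall_inP h2 h3]|[h1 h2 h3]]; split => //.
  by move=> B /h2/eqP.
by apply/forall_inP => B /h2 ->.
Qed.

Lemma mem_cover g B x : B \in g -> x \in B -> x \in finset.cover g.
Proof. by move=> Bg xB; apply/bigcupP; exists B. Qed.

Lemma cover_setU1 B g : finset.cover (B |: g)%SET = (B :|: finset.cover g)%SET.
Proof. by rewrite /finset.cover finset.bigcup_setU big_set1. Qed.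

Lemma pick_pair (a b : I) : a != b -> odflt a [pick c in ([set a; b] :\ a)%SET] = b.
Proof.
move=> ab; case: pickP => [c|/(_ b)].
  by rewrite !inE => /andP[/negbTE -> /= /eqP].
by rewrite !inE eqxx eq_sym ab orbT.
Qed.

Lemma matchings_setU1 D a b g : a \notin D -> g \in matchings D ->
  b \in (D :\: finset.cover g)%SET ->
  [/\ ([set a; b] |: g)%SET \in matchings (a |: D)%SET, a != b, ([set a; b] \notin g)%SET &
      finset.cover ([set a; b] |: g)%SET = ([set a; b] :|: finset.cover g)%SET].
Proof.
move=> aD /matchingsP[tg cg gD]; rewrite inE => /andP[bg bD].
have ab : a != b by apply: contraNneq aD => ->.
have ag : a \notin finset.cover g by apply: contra aD; exact: (fintype.subsetP gD).
have [||tU nU] := @finset.trivIsetU1 _ [set a; b]%SET g _ tg.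
- move=> B Bg; rewrite disjoint_subset; apply/fintype.subsetP => x; rewrite !inE => /orP[]/eqP ->.
    by apply: contra ag; exact: mem_cover.
  by apply: contra bg; exact: mem_cover.
- by apply/negP => /cg; rewrite cards0.
split => //; last exact: cover_setU1.
apply/matchingsP; split => // [B|].
  by rewrite inE => /orP[|/cg//]; rewrite inE => /eqP ->; rewrite cards2 ab.
rewrite cover_setU1 finset.subUset; apply/andP; split.
  by apply/fintype.subsetP => x; rewrite !inE => /orP[]/eqP ->; rewrite ?eqxx// bD orbT.
by apply: fintype.subset_trans gD _; exact: finset.subsetUr.
Qed.

(** A matching either leaves [a] free or pairs it with some [b] that the rest, a matching of [D],
    leaves free. *)
Lemma sum_matchings (V : nmodType) D a (X : {set {set I}} -> V) : a \notin D ->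
  \sum_(g in matchings (a |: D)%SET) X g =
  \sum_(g in matchings D)
    (X g + \sum_(b in (D :\: finset.cover g)%SET) X ([set a; b] |: g)%SET).
Proof.
move=> aD; rewrite big_split/= (bigID (fun g => a \notin finset.cover g))/=.
congr (_ + _).
  apply: eq_bigl => g; rewrite !inE -!andbA; do 2!congr andb.
  by rewrite -finset.subsetD1 finset.setU1K.
rewrite pair_big_dep/=.
(* The inverse of [(g, b) |-> [set a; b] |: g]: remove the pair of [a] and return the partner. The
   default [a] is not reached when the block of [a] is a pair. *)
pose h' g := (g :\ finset.pblock g a, odflt a [pick b in finset.pblock g a :\ a])%SET.
rewrite (reindex_onto (fun p => ([set a; p.2] |: p.1)%SET) h')/=.
  apply: eq_bigl => -[g b] /=; apply/andP/andP; last first.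
    move=> [gD bD]; have [gM ab nB cU] := matchings_setU1 aD gD bD.
    have aB : a \in [set a; b]%SET by rewrite !inE eqxx.
    have BU : [set a; b]%SET \in ([set a; b] |: g)%SET by rewrite !inE eqxx.
    split; first by rewrite gM negbK (mem_cover BU).
    have [tU _ _] := matchingsP _ _ gM.
    by rewrite /h' (finset.def_pblock tU BU aB) pick_pair// finset.setU1K.
  move=> [/andP[gM _]]; have [tU cU UD] := matchingsP _ _ gM.
  have aB : a \in [set a; b]%SET by rewrite !inE eqxx.
  have bB : b \in [set a; b]%SET by rewrite !inE eqxx orbT.
  have BU : [set a; b]%SET \in ([set a; b] |: g)%SET by rewrite !inE eqxx.
  rewrite /h' (finset.def_pblock tU BU aB) => /eqP[gE _].
  have nB : [set a; b]%SET \notin g by rewrite -gE !inE eqxx.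
  have free x : x \in [set a; b]%SET -> x \notin finset.cover g.
    move=> xB; apply/bigcupP => -[C Cg xC].
    have CU : C \in ([set a; b] |: g)%SET by rewrite !inE Cg orbT.
    by move: nB; rewrite -(finset.def_pblock tU BU xB) (finset.def_pblock tU CU xC) Cg.
  have ab : a != b by have := cU _ BU; rewrite cards2; case: (a != b).
  have gU : g \subset ([set a; b] |: g)%SET by exact: finset.subsetUr.
  split.
    apply/matchingsP; split; first exact: finset.trivIsetS gU tU.
      by move=> B Bg; apply: cU; rewrite !inE Bg orbT.
    rewrite -(finset.setU1K aD) finset.subsetD1 free// andbT.
    by apply: fintype.subset_trans UD; rewrite cover_setU1 finset.subsetUr.
  have bD : b \in (a |: D)%SET by apply: (fintype.subsetP UD); exact: mem_cover BU bB.
  by rewrite inE free//; move: bD; rewrite !inE eq_sym (negbTE ab).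
move=> g /andP[gM]; rewrite negbK => ag; have [tg cg _] := matchingsP _ _ gM.
have Bg := finset.pblock_mem ag.
have aB : a \in finset.pblock g a by rewrite finset.mem_pblock.
rewrite /h'/=; have := cg _ Bg; rewrite (cardsD1 a) aB => -[/eqP/cards1P[b bE]].
rewrite bE; case: pickP => [c|/(_ b)]; last by rewrite inE eqxx.
rewrite inE => /eqP ->/=.
by rewrite -bE finset.setD1K// finset.setD1K.
Qed.

Lemma matchings0 : matchings finset.set0 = [set finset.set0]%SET.
Proof.
apply/finset.setP => g; rewrite finset.in_set1; apply/matchingsP/eqP => [[_ cg gD]|->]; last first.
  split; first by apply/finset.trivIsetP => ?; rewrite inE.
    by move=> ?; rewrite inE.
  by rewrite /finset.cover big_set0 finset.sub0set.
apply/eqP; rewrite -finset.subset0; apply/fintype.subsetP => B Bg.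
have [x xB] : exists x, x \in B by apply/finset.set0Pn; rewrite -card_gt0 cg.
by have := fintype.subsetP gD _ (mem_cover Bg xB); rewrite inE.
Qed.

End Matchings.

(** * Expansion of a product of single integrals over matchings *)

Section ProductExpansion.
Context d (Omega : measurableType d) (R : realType).
Variables (P : probability Omega R) (t T : R).
Hypotheses (ht : 0 <= t) (htT : t < T).
Variables (F : R -> set (set Omega)) (m : nat) (w : 'I_m -> R -> Omega -> R).
Hypotheses (hF : is_filtration T F) (hw : is_wiener P T F w).
Local Notation mu1 := (interval_measure t T).
Local Notation J := (multiple_wiener P t T w).
Variables (k : nat) (i : 'I_k -> 'I_m.+1).

Definition index_weight (B : {set 'I_k}) : R :=
  (constant_on B i && [forall a in B, i a != ord0])%:R.

Lemma constant_on_pair (I : eqType) (a b : 'I_k) (j : 'I_k -> I) :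
  constant_on [set a; b]%SET j = (j a == j b).
Proof.
apply/forall_inP/eqP => [h|ab x].
  have /forall_inP := h a (set21 a b).
  by move=> /(_ b (set22 a b)) /eqP.
rewrite !inE => xab; apply/forall_inP => y; rewrite !inE => yab.
by case/orP : xab => /eqP ->; case/orP : yab => /eqP ->; rewrite ?ab.
Qed.

Lemma index_weight_pair (a b : 'I_k) :
  index_weight [set a; b]%SET = ((i a == i b) && (i a != ord0))%:R.
Proof.
rewrite /index_weight constant_on_pair; case: eqP => //= ab; congr (_ %:R); congr nat_of_bool.
apply/forall_inP/idP => [h|ia x]; first exact: h (set21 a b).
by rewrite !inE => /orP[]/eqP ->; rewrite -?ab.
Qed.

Section Integrands.
Variable f : 'I_k -> R -> R.
Hypothesis fL : forall a, L2 mu1 (f a).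
Local Notation SI := (set_integral P t T w i f).

Definition pair_weight (B : {set 'I_k}) : R :=
  index_weight B * \int[mu1]_x \prod_(a in B) f a x.

Lemma pair_weight_pair (a b : 'I_k) : a != b -> pair_weight [set a; b]%SET =
  ((i a == i b) && (i a != ord0))%:R * \int[mu1]_x (f a x * f b x).
Proof.
move=> ab; rewrite /pair_weight index_weight_pair; congr (_ * _).
by apply: eq_Rintegral => x _; rewrite big_setU1 ?inE// big_set1.
Qed.

(** One null set serves all [C], of which there are finitely many; the expansion uses the formula
    for all free sets at the same [omega]. *)
Lemma product_formula_setU1 a : {ae P, forall omega, forall C : {set 'I_k}, a \notin C ->
    line_integral P t T w (i a) (f a) omega * SI C omega =
    SI (a |: C)%SET omega + \sum_(b in C) pair_weight [set a; b]%SET * SI (C :\ b)%SET omega}.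
Proof.
apply: filter_forall => C.
have [aC|aC] := boolP (a \in C); first by apply: aeW => omega /negP.
have := product_formula_set ht htT hF hw i fL (setU11 a C).
rewrite finset.setU1K//; apply: filterS => omega -> _; congr (_ + _).
apply: eq_bigr => b bC; rewrite pair_weight_pair//.
by apply: contraNneq aC => ->.
Qed.

Lemma set_integral0 omega : SI finset.set0 omega = 1.
Proof.
have empty n (i' : 'I_n -> 'I_m.+1) f' : n = 0%N -> J i' (tensor f') omega = 1.
  by case: n i' f' => // i' f' _; exact: tensor0.
by apply: empty; rewrite cards0.
Qed.

(** Induction on the size of [D]: multiplying by the factor of a new [a] either adds [a] to the free
    variables or contracts it with a free [b], which is the recursion [sum_matchings]. *)
Lemma product_expansion (D : {set 'I_k}) : {ae P, forall omega,
  \prod_(a in D) line_integral P t T w (i a) (f a) omega =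
  \sum_(g in matchings D) (\prod_(B in g) pair_weight B) * SI (D :\: finset.cover g)%SET omega}.
Proof.
have [n] := ubnP #|D|; elim: n D => // n IH D Dn.
have [->|[a aD]] := finset.set_0Vmem D.
  apply: aeW => omega; rewrite big_set0 matchings0 big_set1 big_set0 mul1r.
  by rewrite finset.set0D set_integral0.
have [D' aD' DE] : exists2 D' : {set 'I_k}, a \notin D' & D = (a |: D')%SET.
  by exists (D :\ a)%SET; rewrite ?finset.setD1K// !inE eqxx.
rewrite {}DE in Dn aD *; have /IH D'n : (#|D'| < n)%N by move: Dn; rewrite cardsU1 aD' add1n.
apply: filterS2 D'n (product_formula_setU1 a) => omega IHo pf.
rewrite big_setU1//= IHo mulr_sumr sum_matchings//; apply: eq_bigr => g gM.
have [_ _ gD] := matchingsP _ _ gM.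
have ag : a \notin finset.cover g by apply: contra aD'; exact: (fintype.subsetP gD).
rewrite mulrCA pf ?inE ?negb_and ?aD' ?orbT//.
rewrite mulrDr mulr_sumr; congr (_ * SI _ omega + _).
  apply/finset.setP => x; rewrite !inE; case: eqP => //= ->; by rewrite ag.
apply: eq_bigr => b bD; have [_ ab nB cU] := matchings_setU1 aD' gM bD.
rewrite big_setU1//= cU mulrA; congr (_ * SI _ omega); first by rewrite mulrC.
apply/finset.setP => x; rewrite !inE; case: (eqVneq x a) => [->|_] /=.
  by rewrite (negbTE aD') !andbF.
by rewrite negb_or andbA.
Qed.

Lemma single_integral_expansion : {ae P, forall omega,
  \prod_(a < k) single_integral P t T w (i a) (f a) omega =
  \sum_(g in matchings [set: 'I_k]%SET) (\prod_(B in g) pair_weight B) * SI (unpaired g) omega}.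
Proof.
have sE : {ae P, forall omega, forall a,
   single_integral P t T w (i a) (f a) omega = line_integral P t T w (i a) (f a) omega}.
  by apply: filter_forall => a; exact: (single_integralE ht htT hF hw).
apply: filterS2 sE (product_expansion [set: 'I_k]%SET) => omega sE.
rewrite (eq_bigl xpredT) => [E|a]; last by rewrite inE.
rewrite (eq_bigr _ (fun a _ => sE a)) E; apply: eq_bigr => g _.
by rewrite /unpaired finset.setTD.
Qed.

End Integrands.
End ProductExpansion.

(** * Stratonovich sums *)

Lemma matchings_pairings k g : (g \in matchings [set: 'I_k]%SET) = (g \in pairings k #|g|).
Proof. by rewrite !inE finset.subsetT eqxx. Qed.

Lemma pairings_matchings k r g : (g \in pairings k r) =
  (g \in matchings [set: 'I_k]%SET) && (#|g| == r).
Proof. by rewrite !inE finset.subsetT andbT -andbA. Qed.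

Lemma card_matching_le k g : g \in matchings [set: 'I_k]%SET -> (#|g| <= k./2)%N.
Proof.
move=> /matchingsP[tg cg _]; rewrite geq_half_double -[leqRHS]card_ord.
have /eqP := tg; rewrite (eq_bigr (fun=> 2%N)) => [|B /cg //].
by rewrite sum_nat_const muln2 => ->; exact: max_card.
Qed.

Lemma enum_val_unpaired0 k (e : #|unpaired (finset.set0 : {set {set 'I_k}})| = k) l :
  enum_val l = cast_ord e l.
Proof.
apply: val_inj; rewrite (enum_val_nth (cast_ord e l))/=.
rewrite (@eq_enum _ _ 'I_k) => [|x]; first by rewrite nth_enum_ord// -[X in (_ < X)%N]e.
by rewrite !inE /finset.cover big_set0 inE.
Qed.

Section Assembly.
Context d (Omega : measurableType d) (R : realType).
Variables (P : probability Omega R) (t T : R).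
Hypotheses (ht : 0 <= t) (htT : t < T).
Variables (F : R -> set (set Omega)) (m : nat) (w : 'I_m -> R -> Omega -> R).
Hypotheses (hF : is_filtration T F) (hw : is_wiener P T F w).
Variables (k : nat) (i : 'I_k -> 'I_m.+1) (phi : nat -> R -> R).
Hypothesis hphi : complete_orthonormal_system t T phi.
Variable Phi : k.-tuple (measurableTypeR R) -> R.
Local Notation mu1 := (interval_measure t T).
Local Notation Q n := (cube_measure t T n).
Local Notation J := (multiple_wiener P t T w).
Local Notation coef j := (fourier_coef t T phi Phi (fun l => j l)).

Let phiL j : L2 mu1 (phi j). Proof. by have [h _ _] := hphi. Qed.

Lemma pair_weight_basis p (j : {ffun 'I_k -> 'I_p.+1}) (B : {set 'I_k}) : #|B| = 2%N ->
  pair_weight t T i (fun l => phi (j l)) B = index_weight R i B * (constant_on B j)%:R.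
Proof.
move=> /eqP/cards2P[a [b [ab ->]]]; rewrite pair_weight_pair// index_weight_pair constant_on_pair.
by have [_ -> _] := hphi.
Qed.

Lemma matching_weight_basis p (j : {ffun 'I_k -> 'I_p.+1}) g : g \in matchings [set: 'I_k]%SET ->
  \prod_(B in g) pair_weight t T i (fun l => phi (j l)) B =
  (\prod_(B in g) index_weight R i B) * [forall B in g, constant_on B j]%:R.
Proof.
move=> /matchingsP[_ cg _].
rewrite (eq_bigr (fun B => index_weight R i B * (constant_on B j)%:R)) => [|B /cg]; last first.
  exact: pair_weight_basis.
rewrite big_split/=; congr (_ * _).
have [/forall_inP h|] := boolP [forall B in g, constant_on B j].
  by apply: big1 => B /h ->.
rewrite negb_forall => /existsP[B]; rewrite negb_imply => /andP[Bg /negbTE Bj].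
by rewrite (bigD1 B)//= Bj mul0r.
Qed.

(** After exchanging the sums over multi-indices and matchings, the terms of a matching [g] add up
    to J' of the partial trace along [g], by linearity over finite sums; the null sets are united
    over the finitely many [j] and [g]. *)
Lemma stratonovich_sum_expansion p : {ae P, forall omega,
  stratonovich_sum P t T w i phi Phi p omega =
  \sum_(g in matchings [set: 'I_k]%SET) (\prod_(B in g) index_weight R i B) *
    J (fun l => i (enum_val l)) (partial_trace t T phi Phi g p) omega}.
Proof.
have prodE : {ae P, forall omega, forall j : {ffun 'I_k -> 'I_p.+1},
    \prod_(a < k) single_integral P t T w (i a) (phi (j a)) omega =
    \sum_(g in matchings [set: 'I_k]%SET) (\prod_(B in g) pair_weight t T i (fun l => phi (j l)) B) *
      set_integral P t T w i (fun l => phi (j l)) (unpaired g) omega}.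
  apply: filter_forall => j.
  exact: (single_integral_expansion ht htT hF hw i (fun l => phiL (j l))).
have traceE : {ae P, forall omega, forall g,
    J (fun l => i (enum_val l)) (partial_trace t T phi Phi g p) omega =
    \sum_(j : {ffun 'I_k -> 'I_p.+1} | [forall B in g, constant_on B j]) coef j *
      set_integral P t T w i (fun l => phi (j l)) (unpaired g) omega}.
  apply: filter_forall => g.
  apply: (multiple_wiener_sum ht htT hF hw (fun l => i (enum_val l))
    (index_enum {ffun 'I_k -> 'I_p.+1}) (fun j => [forall B in g, constant_on B j])
    (fun j => coef j) (f := fun j : {ffun 'I_k -> 'I_p.+1} => tensor (fun l => phi (j (enum_val l))))).
  by move=> j; exact: (tensor_L2 (fun l => phiL _)).1.
apply: filterS2 prodE traceE => omega prodE traceE.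
rewrite /stratonovich_sum.
under eq_bigr do rewrite prodE mulr_sumr.
rewrite exchange_big/=; apply: eq_bigr => g gM.
rewrite traceE mulr_sumr [RHS]big_mkcond; apply: eq_bigr => j _.
rewrite matching_weight_basis//; case: ifP => _; last by rewrite mulr0 mul0r mulr0.
by rewrite mulr1 mulrCA.
Qed.

Lemma stratonovich_sum_measurable p :
  measurable_fun setT (stratonovich_sum P t T w i phi Phi p).
Proof.
apply: measurable_sum => j; apply: measurable_funM => //.
apply: measurable_prod => l _; apply: L2_measurable.
exact: (single_integral_L2 ht htT hF hw).
Qed.

Hypothesis hPhi : L2 (Q k) Phi.

(** With no pairs the partial trace is the partial Fourier sum; the two live on tuples whose lengths
    are equal but not convertible, hence the casts. *)
Lemma empty_trace_cvg :
  cvgL2 P (fun p => J (fun l => i (enum_val l)) (partial_trace t T phi Phi finset.set0 p)) (J i Phi).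
Proof.
have := cvgL2_multiple_wiener ht htT hF hw i (fourier_cvgL2 hphi hPhi).
apply: cvgL2_ext => p omega; congr (_ omega); apply/esym.
have e : #|unpaired (finset.set0 : {set {set 'I_k}})| = k.
  rewrite -[RHS]card_ord; apply: eq_card => x.
  by rewrite !inE /finset.cover big_set0 inE.
apply: (@multiple_wiener_cast _ _ _ P t T _ w _ _ e) => [l|x]; first by rewrite (enum_val_unpaired0 e).
rewrite /partial_trace; apply: eq_big => [j|j _].
  by apply/forall_inP => B; rewrite inE.
congr (_ * _); rewrite /tensor [RHS](reindex (cast_ord e))/=; last first.
  by exists (cast_ord (esym e)) => l _; rewrite ?cast_ordK ?cast_ordKV.
apply: eq_bigr => l _; rewrite (enum_val_unpaired0 e) tcastE.
by congr (phi _ (tnth _ _)); rewrite cast_ordK.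
Qed.

Hypothesis htrace : forall r : nat, (1 <= r <= k./2)%N ->
  forall g : {set {set 'I_k}}, g \in pairings k r -> limiting_trace_exists t T phi Phi g.

(** The empty matching is kept apart: the trace hypothesis starts at one pair, and here the Fourier
    series of [Phi] gives the limit. *)
Definition limit_term (g : {set {set 'I_k}}) : Omega -> R :=
  if g == finset.set0 then J i Phi
  else J (fun l => i (enum_val l)) (limiting_trace t T phi Phi g).

Lemma trace_cvg g : g \in matchings [set: 'I_k]%SET ->
  cvgL2 P (fun p => J (fun l => i (enum_val l)) (partial_trace t T phi Phi g p)) (limit_term g).
Proof.
move=> gM; rewrite /limit_term; case: eqP => [->|/eqP g0]; first exact: empty_trace_cvg.
have gr : (1 <= #|g| <= k./2)%N by rewrite card_gt0 g0 card_matching_le.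
have gp : g \in pairings k #|g| by rewrite -matchings_pairings.
have [f fP] := htrace gr gp.
exact: (cvgL2_multiple_wiener ht htT hF hw _ (limL2_cvg fP)).
Qed.

Lemma stratonovich_sum_cvg : cvgL2 P (stratonovich_sum P t T w i phi Phi)
  (fun omega => \sum_(g in matchings [set: 'I_k]%SET) (\prod_(B in g) index_weight R i B) *
     limit_term g omega).
Proof.
apply: (cvgL2_ae_seq (u := fun p omega => \sum_(g in matchings [set: 'I_k]%SET)
  (\prod_(B in g) index_weight R i B) *
    J (fun l => i (enum_val l)) (partial_trace t T phi Phi g p) omega)).
- exact: stratonovich_sum_measurable.
- by move=> p; apply: filterS (stratonovich_sum_expansion p) => omega ->.
- by apply: cvgL2_sum => g gM; apply: cvgL2Z; exact: trace_cvg.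
Qed.

(** Matchings are sorted by their number of pairs: only the empty one has none, and disjoint pairs
    among [k] points number at most [k./2]. *)
Lemma sum_limit_term omega :
  \sum_(g in matchings [set: 'I_k]%SET) (\prod_(B in g) index_weight R i B) * limit_term g omega =
  J i Phi omega + \sum_(1 <= r < (k./2).+1) \sum_(g in pairings k r)
     (\prod_(B in g) index_weight R i B) *
     J (fun l => i (enum_val l)) (limiting_trace t T phi Phi g) omega.
Proof.
have M0 : finset.set0 \in matchings [set: 'I_k]%SET.
  apply/matchingsP; split; first by apply/finset.trivIsetP => ?; rewrite inE.
    by move=> ?; rewrite inE.
  exact: finset.subsetT.
rewrite (bigD1 _ M0)/= big_set0 mul1r {1}/limit_term eqxx; congr (_ + _).
rewrite big_nat (exchange_big_dep (fun g => (g \in matchings [set: 'I_k]%SET) && (g != finset.set0)))/=.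
  apply: eq_bigr => g /andP[gM' g0].
  have gM : g \in matchings [set: 'I_k]%SET by exact: gM'.
  have gr : (0 < #|g| < k./2.+1)%N by rewrite card_gt0 g0 ltnS card_matching_le.
  rewrite (eq_bigl (fun r => r == #|g|)) => [|r].
    by rewrite big_nat1_eq gr /limit_term (negbTE g0).
  rewrite pairings_matchings gM eq_sym /=.
  by case: (r =P #|g|) => [->|_]; rewrite ?gr ?andbF.
move=> r g /andP[r0 _]; rewrite pairings_matchings => /andP[-> /eqP rE].
by rewrite -card_gt0 rE.
Qed.

End Assembly.

Theorem mainTheorem1
  (R : realType) (d : measure_display) (Omega : measurableType d)
  (P : probability Omega R) (hP : measure_is_complete P)
  (t T : R) (ht : 0 <= t) (htT : t < T)
  (m : nat) (F : R -> set (set Omega)) (hF : is_filtration T F)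
  (w : 'I_m -> R -> Omega -> R) (hw : is_wiener P T F w)
  (k : nat) (hk : (2 <= k)%N) (i : 'I_k -> 'I_m.+1)
  (phi : nat -> R -> R) (hphi : complete_orthonormal_system t T phi)
  (Phi : k.-tuple (measurableTypeR R) -> R)
  (hPhi : Phi \in Lfun (cube_measure t T k) 2%:E)
  (htrace : forall r : nat, (1 <= r <= k./2)%N ->
     forall g : {set {set 'I_k}}, g \in pairings k r ->
       limiting_trace_exists t T phi Phi g) :
  stratonovich_exists P t T w i phi Phi /\
  {ae P, forall omega,
    stratonovich_integral P t T w i phi Phi omega =
    multiple_wiener P t T w i Phi omega +
    \sum_(1 <= r < (k./2).+1) \sum_(g in pairings k r)
      (\prod_(B in g)
         (constant_on B i && [forall a in B, i a != ord0])%:R) *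
      multiple_wiener P t T w (fun l => i (enum_val l))
        (limiting_trace t T phi Phi g) omega}.
Proof.
have cvg := stratonovich_sum_cvg ht htT hF hw i hphi hPhi htrace.
split; first by eexists; exact: cvg.
(* The Stratonovich integral is a chosen limit; uniqueness makes it agree almost surely with the
   explicit one. *)
by apply: filterS (limL2_ae cvg) => omega; rewrite sum_limit_term.
Qed.
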